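(* Let $d\ge 2$ and let $\Phi$ be a symmetric linear graph directed Markov system associated to the free group $F_d=\langle g_1,\dots,g_d\rangle$. For every normal subgroup $N$ of $F_d$ we have $$\dim_H\left(\Lambda_{r}(N,\Phi)\right)=\dim_H\left(\Lambda_{r}(F_d,\Phi)\right)\quad\text{if and only if}\quad F_d/N\text{ is amenable}.$$ Moreover, if $N$ is non-trivial, then $$\dim_H\left(\Lambda_{r}(N,\Phi)\right)>\dim_H\left(\Lambda_{r}(F_d,\Phi)\right)/2.$$ Here $\dim_H$ denotes Hausdorff dimension.
   Context: Let $d\ge2$ and let $F_d=\langle g_1,\dots,g_d\rangle$ be the free group on $g_1,\dots,g_d$. Put $V:=\{g_1,g_1^{-1},\dots,g_d,g_d^{-1}\}$ and $E:=\{(v,w)\in V^2: v\ne w^{-1}\}$. A linear graph directed Markov system (linear GDMS) $\Phi$ associated to $F_d$ consists of nonempty compact sets $X_v\subset\mathbb{R}^D$ ($v\in V$), for some $D\ge1$, and of maps $\phi_{(v,w)}:X_w\to X_v$ ($(v,w)\in E$), each of which is the restriction of a similarity of $\mathbb{R}^D$ with contraction ratio in $(0,1)$, such that: (i) each $X_v$ is connected and equal to the closure of its interior; (ii) (open set condition) for all distinct edges $(v,w)\neq(v',w')$ in $E$, $\phi_{(v,w)}(\mathrm{Int}(X_w))\cap\phi_{(v',w')}(\mathrm{Int}(X_{w'}))=\emptyset$; (iii) (cone property) there exist $l>0$ and $0<\gamma<\pi/2$ such that for each $v\in V$ and $x\in X_v$ there is an open cone with vertex $x$, central angle of measure $\gamma$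 and altitude $l$ contained in $\mathrm{Int}(X_v)$; (iv) the contraction ratio of $\phi_{(v,w)}$ is independent of $w$; it is denoted $c_\Phi(v)$. (The remaining conditions in the definition of a conformal GDMS hold automatically for similarities.) $\Phi$ is called symmetric if $c_\Phi(g)=c_\Phi(g^{-1})$ for all $g\in V$. Let $\Sigma_\Phi$ be the set of sequences $((v_i,w_i))_{i\ge1}\in E^{\mathbb{N}}$ with $w_i=v_{i+1}$ for all $i\ge 1$. The coding map $\pi_\Phi:\Sigma_\Phi\to\bigoplus_{v\in V}X_v$ (disjoint union) is defined by $\{\pi_\Phi(\omega)\}=\bigcap_{n\ge1}\phi_{\omega_1}\circ\cdots\circ\phi_{\omega_n}(X_{w_n})$ for $\omega=((v_i,w_i))_{i\ge 1}$, $\omega_i=(v_i,w_i)$. For a subgroup $H$ of $F_d$, the radial limit set of $H$ with respect to $\Phi$ is $$\Lambda_r(H,\Phi):=\pi_\Phi\{((v_i,w_i))\in\Sigma_\Phi:\exists\gamma\in F_d \text{ such that } v_1\cdots v_n\in H\gamma\text{ for infinitely many }n\in\mathbb{N}\}.$$ Convention: $\dim_H(\emptyset)=0$. *)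

(* Defs.v *)
From HB Require Import structures.
From mathcomp Require Import all_boot all_order all_algebra.
From mathcomp Require Import generic_quotient.
From mathcomp Require Import all_classical all_reals all_analysis.

Set Implicit Arguments.
Unset Strict Implicit.
Unset Printing Implicit Defensive.

Import Order.TTheory GRing.Theory Num.Theory.
Import numFieldNormedType.Exports.

Local Open Scope classical_set_scope.
Local Open Scope ring_scope.

(* The letter (i, false) stands for the free generator g_i and (i, true) for
   its inverse, so that letter d is the alphabet V. *)
Definition letter (d : nat) := ('I_d * bool)%type.

Definition invl (d : nat) (v : letter d) : letter d := (v.1, ~~ v.2).

Lemma invlK (d : nat) : involutive (@invl d).
Proof. by case=> i b; rewrite /invl /= negbK. Qed.

Definition reduced (d : nat) (s : seq (letter d)) : bool :=
  sorted (fun v w => v != invl w) s.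

Record free_group (d : nat) := FreeWord {
  word_of :> seq (letter d);
  word_ofP : reduced word_of }.

HB.instance Definition _ d := [isSub for @word_of d].
HB.instance Definition _ d := [Choice of free_group d by <:].

(* Left multiplication of a reduced word by one letter, cancelling if needed. *)
Definition push (d : nat) (v : letter d) (t : seq (letter d)) :=
  if t is w :: t' then if v == invl w then t' else v :: t else [:: v].

Section FreeGroupLaw.
Variable d : nat.
Implicit Types (v w : letter d) (s t u : seq (letter d)).

Lemma push_reduced v t : reduced t -> reduced (push v t).
Proof.
case: t => [//|w t] /= rt; case: ifP => [_|/negbT vw].
  exact: path_sorted rt.
by rewrite /reduced /= vw.
Qed.

Lemma foldr_push_reduced s t : reduced t -> reduced (foldr (@push d) t s).
Proof. by move=> rt; elim: s => //= v s; apply: push_reduced. Qed.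

Lemma push_invl v t : reduced t -> push (invl v) (push v t) = t.
Proof.
case: t => [_|w t rt] /=; first by rewrite eqxx.
case: eqP => [->|_] /=; last by rewrite eqxx.
rewrite invlK; case: t rt => [//|x t] /= /andP[wx _].
by rewrite (negbTE wx).
Qed.

Lemma foldr_push v s u : reduced u ->
  foldr (@push d) u (push v s) = push v (foldr (@push d) u s).
Proof.
move=> ru; case: s => [//|w s] /=; case: eqP => [->|//].
by rewrite push_invl // foldr_push_reduced.
Qed.

Lemma foldr_push_nil s : reduced s -> foldr (@push d) [::] s = s.
Proof.
elim: s => [//|v s IH] rs /=; rewrite (IH (path_sorted rs)).
by case: s rs {IH} => [//|w s] /= /andP[/negbTE->].
Qed.

Definition inv_word s := rev (map (@invl d) s).

Lemma inv_wordK : involutive inv_word.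
Proof.
by move=> s; rewrite /inv_word map_rev revK (mapK (@invlK d)).
Qed.

Lemma inv_word_reduced s : reduced s -> reduced (inv_word s).
Proof.
rewrite /reduced /inv_word rev_sorted sorted_map; apply: sub_sorted => v w /=.
by apply: contra => /eqP ->; rewrite invlK.
Qed.

Lemma foldr_push_inv s : foldr (@push d) s (inv_word s) = [::].
Proof.
elim: s => [//|v s IH].
by rewrite /inv_word /= rev_cons foldr_rcons /= eqxx.
Qed.

Definition free_one : free_group d := @FreeWord d [::] isT.
Definition free_mul (x y : free_group d) : free_group d :=
  FreeWord (foldr_push_reduced x (word_ofP y)).
Definition free_inv (x : free_group d) : free_group d :=
  FreeWord (inv_word_reduced (word_ofP x)).

Lemma free_mulA : associative free_mul.
Proof.
move=> x y z; apply: val_inj => /=.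
elim: (x : seq _) => [//|v s IH] /=; rewrite IH foldr_push //.
exact: word_ofP.
Qed.

Lemma free_mul1 : left_id free_one free_mul.
Proof. by move=> x; apply: val_inj. Qed.

Lemma free_mulr1 : right_id free_one free_mul.
Proof. by move=> x; apply: val_inj; apply: foldr_push_nil; apply: word_ofP. Qed.

Lemma free_mulV : left_inverse free_one free_inv free_mul.
Proof. by move=> x; apply: val_inj; apply: foldr_push_inv. Qed.

Lemma free_mulrV : right_inverse free_one free_inv free_mul.
Proof.
move=> x; apply: val_inj.
by have := foldr_push_inv (inv_word x); rewrite inv_wordK.
Qed.

End FreeGroupLaw.

HB.instance Definition _ d := isGroup.Build (free_group d)
  (@free_mulA d) (@free_mul1 d) (@free_mulr1 d) (@free_mulV d) (@free_mulrV d).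

Definition gen (d : nat) (v : letter d) : free_group d := @FreeWord d [:: v] isT.

Lemma gen_invl (d : nat) (v : letter d) : gen (invl v) = ((gen v)^-1)%g.
Proof. exact: val_inj. Qed.

Record normal_subgroup (G : groupType) (N : set G) : Prop := NormalSubgroup {
  normal1 : N 1%g;
  normalM : forall x y, N x -> N y -> N (x * y)%g;
  normalV : forall x, N x -> N (x^-1)%g;
  normalJ : forall x g, N x -> N (x ^ g)%g }.

Section QuotientGroup.
Variables (G : groupType) (N : set G) (hN : normal_subgroup N).
Local Open Scope group_scope.

Definition coset_rel of normal_subgroup N :=
  fun x y : G => `[< N (x^-1 * y) >].
Local Notation coset_eq := (coset_rel hN).

Lemma coset_refl : reflexive coset_eq.
Proof. by move=> x; apply/asboolP; rewrite mulVg; apply: normal1. Qed.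

Lemma coset_sym : symmetric coset_eq.
Proof.
move=> x y; apply/asbool_equiv_eq.
by split=> /(normalV hN); rewrite invgM invgK.
Qed.

Lemma coset_trans : transitive coset_eq.
Proof.
move=> y x z /asboolP Nxy /asboolP Nyz; apply/asboolP.
by have := normalM hN Nxy Nyz; rewrite -mulgA mulVKg.
Qed.

Canonical coset_equiv := EquivRel coset_eq coset_refl coset_sym coset_trans.

Definition quotient_group := {eq_quot coset_equiv}%qT.
HB.instance Definition _ := Choice.on quotient_group.

Definition proj (x : G) : quotient_group := (\pi_quotient_group x)%qT.

Lemma projP x y : proj x = proj y <-> N (x^-1 * y).
Proof.
by split=> [/eqquotP/asboolP//|Nxy]; apply/eqquotP/asboolP.
Qed.

Definition quotient_one : quotient_group := proj 1.
Definition quotient_inv (x : quotient_group) : quotient_group :=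
  proj (repr x)^-1.
Definition quotient_mul (x y : quotient_group) : quotient_group :=
  proj (repr x * repr y).

Lemma repr_proj x : N (x^-1 * repr (proj x)).
Proof. by apply/projP; rewrite /proj reprK. Qed.

Lemma proj_repr (a : quotient_group) : proj (repr a) = a.
Proof. exact: reprK. Qed.

Lemma proj_mul x y : proj (x * y) = quotient_mul (proj x) (proj y).
Proof.
apply/projP.
have := normalM hN (repr_proj y) (normalJ hN (repr (proj y)) (repr_proj x)).
by rewrite /conjg invgM -!mulgA mulVKg.
Qed.

Lemma quotient_mulA : associative quotient_mul.
Proof.
move=> a b c; rewrite -(proj_repr a) -(proj_repr b) -(proj_repr c).
by rewrite -!proj_mul mulgA.
Qed.

Lemma quotient_mul1 : left_id quotient_one quotient_mul.
Proof. by move=> a; rewrite -(proj_repr a) -proj_mul mul1g. Qed.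

Lemma quotient_mulr1 : right_id quotient_one quotient_mul.
Proof. by move=> a; rewrite -(proj_repr a) -proj_mul mulg1. Qed.

Lemma quotient_mulV : left_inverse quotient_one quotient_inv quotient_mul.
Proof.
move=> a; rewrite -{2}(proj_repr a) /quotient_inv -proj_mul mulVg //.
Qed.

Lemma quotient_mulrV : right_inverse quotient_one quotient_inv quotient_mul.
Proof.
move=> a; rewrite -{1}(proj_repr a) /quotient_inv -proj_mul mulgV //.
Qed.

HB.instance Definition _ := isGroup.Build quotient_group
  quotient_mulA quotient_mul1 quotient_mulr1 quotient_mulV quotient_mulrV.

End QuotientGroup.

(* Von Neumann's definition, for G with the discrete topology. *)
Definition amenable (R : realType) (G : groupType) : Prop :=
  exists mu : set G -> R,
    [/\ forall A, 0 <= mu A,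
        mu setT = 1,
        forall A B, A `&` B = set0 -> mu (A `|` B) = mu A + mu B
      & forall g A, mu [set (g * x)%g | x in A] = mu A].

(* Distances take values in \bar R, so that points in different components of
   a disjoint union can be put at distance +oo. *)
Section HausdorffDimension.
Variables (R : realType) (T : Type) (dist : T -> T -> \bar R).
Implicit Types (A U : set T) (s delta : R).
Local Open Scope ereal_scope.

Definition diam U : \bar R := ereal_sup [set dist x y | x in U & y in U].

(* The empty set is given weight 0 separately: its diam is -oo, and 0 `^ 0 is
   1 as is needed for singletons when s = 0. *)
Definition weight s U : \bar R := if U == set0 then 0 else diam U `^ s.

Definition hausdorff_content s delta A : \bar R :=
  ereal_inf [set \sum_(0 <= i <oo) weight s (U i) | U in
    [set U : nat -> set T |
      A `<=` \bigcup_i U i /\ forall i, diam (U i) <= delta%:E]].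

Definition hausdorff_measure s A : \bar R :=
  ereal_sup [set hausdorff_content s delta A | delta in
    [set delta | (0 < delta)%R]].

Definition hausdorff_dim A : \bar R :=
  ereal_inf [set s%:E | s in
    [set s | (0 <= s)%R /\ hausdorff_measure s A = 0]].

End HausdorffDimension.

Section Euclidean.
Variables (R : realType) (D : nat).
Implicit Types x y u : 'rV[R]_D.

Definition dotp x y : R := \sum_(i < D) x 0 i * y 0 i.

(* The library's norm on 'rV[R]_D is the sup norm; it induces the same
   topology as the Euclidean norm. *)
Definition enorm x : R := Num.sqrt (dotp x x).

Definition edist x y : R := enorm (x - y).

Definition similarity (c : R) (f : 'rV[R]_D -> 'rV[R]_D) : Prop :=
  forall x y, edist (f x) (f y) = c * edist x y.

(* The open cone with vertex x, axis direction u (a unit vector), altitude l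
   and central angle gamma, measured across the whole opening. *)
Definition open_cone x u (gamma l : R) : set 'rV[R]_D :=
  [set y | enorm (y - x) * cos (gamma / 2) < dotp (y - x) u < l].

End Euclidean.

Definition edge (d : nat) := {e : letter d * letter d | e.1 != invl e.2}.

Definition src (d : nat) (e : edge d) : letter d := (val e).1.
Definition tgt (d : nat) (e : edge d) : letter d := (val e).2.

(* The map phi_(v,w) : X_w -> X_v is recorded by a similarity of R^D extending
   it. Its contraction ratio may not depend on w, so ratio is a function of the
   letter v alone. *)
Record linear_GDMS (R : realType) (d D : nat) := LinearGDMS {
  space : letter d -> set 'rV[R]_D;
  smap : edge d -> 'rV[R]_D -> 'rV[R]_D;
  ratio : letter d -> R;
  space_neq0 : forall v, space v !=set0;
  space_compact : forall v, compact (space v);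
  space_connected : forall v, connected (space v);
  space_regular : forall v, closure (interior (space v)) = space v;
  ratio_itv : forall v, 0 < ratio v < 1;
  smap_similarity : forall e, similarity (ratio (src e)) (smap e);
  smap_space : forall e, smap e @` space (tgt e) `<=` space (src e);
  open_set_condition : forall e e', e <> e' ->
    (smap e @` interior (space (tgt e))) `&`
    (smap e' @` interior (space (tgt e'))) = set0;
  cone_property : exists l gamma : R,
    [/\ 0 < l, 0 < gamma < pi / 2 &
        forall v x, space v x -> exists2 u, enorm u = 1 &
          open_cone x u gamma l `<=` interior (space v)] }.

Definition symmetric_GDMS (R : realType) (d D : nat)
    (Phi : linear_GDMS R d D) : Prop :=
  forall v, ratio Phi v = ratio Phi (invl v).

Section LimitSet.
Variables (R : realType) (d D : nat) (Phi : linear_GDMS R d D).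
Implicit Types (omega : nat -> edge d) (n : nat).

(* Sequences are indexed from 0: omega i is the edge (v_(i+1), w_(i+1)). *)
Definition code_space : set (nat -> edge d) :=
  [set omega | forall i, tgt (omega i) = src (omega i.+1)].

Fixpoint comp_smap omega n : 'rV[R]_D -> 'rV[R]_D :=
  if n is m.+1 then comp_smap omega m \o smap Phi (omega m) else id.

Definition cylinder omega n : set 'rV[R]_D :=
  comp_smap omega n.+1 @` space Phi (tgt (omega n)).

(* A point x of the component X_v of the disjoint union is the pair (v, x).
   For omega in code_space the intersection is a singleton and get returns its
   only element. *)
Definition coding omega : letter d * 'rV[R]_D :=
  (src (omega 0%N), get (\bigcap_n cylinder omega n)).

Definition sum_dist (p q : letter d * 'rV[R]_D) : \bar R :=
  if p.1 == q.1 then (edist p.2 q.2)%:E else +oo%E.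

(* prefix omega n is the group element v_1 ... v_n. *)
Definition prefix omega n : free_group d :=
  (\big[*%g/1]_(i < n) gen (src (omega i)))%g.

Definition radial_limit_set (H : set (free_group d)) :
    set (letter d * 'rV[R]_D) :=
  [set coding omega | omega in code_space `&`
    [set omega | exists gamma : free_group d,
      infinite_set [set n |
        [set (h * gamma)%g | h in H] (prefix omega n)]]].

Definition dimH (A : set (letter d * 'rV[R]_D)) : \bar R :=
  hausdorff_dim sum_dist A.

End LimitSet.

(* Main.v *)
(* Let c(g) be the product of the contraction ratios along a reduced word g, and
   let b > 0 solve sum_v c(v)^b / (1 + c(v)^b) = 1. The sum of c(g)^s over a
   coset of N bounds the Hausdorff measure of the radial limit set from above.
   Conversely, a finite prefix code of words of N with sum of c(w)^s at least 1
   generates a self-similar subset of dimension at least s, and such a code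
   exists as soon as the sums of c(g)^s over the elements of N of length n are
   unbounded. This gives dimension b for the whole limit set, and it remains to
   study the sums S_n(x) of c(g)^s over the elements g of length n of a coset x.

   If F_d / N is amenable and s < b, then sum_n S_n(x) is infinite: otherwise it
   would be a positive superharmonic function for a symmetric measure of total
   mass greater than 1, which an invariant mean excludes. If S_n does not decay
   exponentially at s = b, then the normalized S_n are square summable functions
   whose norm hardly decreases along the walk, hence almost invariant, and their
   squares converge along an ultrafilter to an invariant mean.

   For the strict bound let h in N be long and let g run through the words such
   that g h contains h only at its end. The words g h g^-1 form a prefix code and
   the sum of c(g)^b c(h)^b is bounded below, being essentially the probability
   that h occurs at all; so the sum of c(g h g^-1)^(b/2) is of the order of
   c(h)^(-b/2), which exceeds 1. *)
Require Import Defs.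
From mathcomp Require Import all_boot all_order all_algebra.
From mathcomp Require Import ring lra zify.
From mathcomp Require Import all_classical all_reals all_analysis.

Set Implicit Arguments.
Unset Strict Implicit.
Unset Printing Implicit Defensive.

Import Order.TTheory GRing.Theory Num.Theory.
Import numFieldNormedType.Exports.

Local Open Scope classical_set_scope.
Local Open Scope ring_scope.

(* The analysis library has its own edist and proj, which hide those of Defs. *)
Local Notation edist := Defs.edist.
Local Notation proj := Defs.proj.

(** * Almost invariant functions and invariant means *)

(** Origin of the equation for b: put f = c^b and let t be the Perron vector of the admissible
    transitions, with sum 1. Then t(a) = f(a) (1 - t(a^-1)); symmetry of the ratios gives t(a^-1) =
    t(a), hence t = f / (1 + f), and the normalization is the equation. The obstacle is that reduced
    words describe a walk without backtracking, which is not a convolution operator on F_d / N. At s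
    = b the sums are therefore kept apart by first letter, and t makes them a Markov chain with a
    decreasing energy. As there are at least four letters, any two of them may follow a common one,
    so a small loss of energy forces the functions of all first letters to be close to each other.
    For amenable quotients the same sums are instead the Green function of a symmetric walk with
    steps proportional to f / (1 - f^2). Its mass exceeds 1 exactly when the sum of f / (1 + f)
    does. Strictness comes from room in the exponent: exponential decay at b survives a slightly
    smaller exponent, and a finite code with sum above 1 survives a slightly larger one. *)

Lemma ultra_cvg_itv (R : realType) (I : Type) (F : set_system I) (u : I -> R) :
  UltraFilter F -> (forall i, 0 <= u i <= 1) -> cvg (u @ F).
Proof.
move=> UF u01.
have cI : compact `[0 : R, 1] by exact: segment_compact.
have F01 : F (u @^-1` `[0 : R, 1]).
  by apply: filterE => i /=; rewrite in_itv /=; exact: u01.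
have [p [_ clp]] := cI (u @ F) _ F01.
apply/cvg_ex; exists p => B Bp.
have [//|nB] := in_ultra_setVsetC (u @^-1` B) UF.
by have [x []] := clp (~` B) B nB Bp.
Qed.

Section AlmostInvariant.
Variables (R : realType) (G : groupType).
Implicit Types (A B : set G) (h : G -> R).
Local Open Scope ereal_scope.

Definition sqmass h A : \bar R := \esum_(x in A) ((h x) ^+ 2)%:E.
Definition sqnorm h : \bar R := sqmass h setT.

Lemma sqmass_ge0 h A : 0 <= sqmass h A.
Proof. by apply: esum_ge0 => x _; rewrite lee_fin sqr_ge0. Qed.

Lemma sqnorm_ge0 h : 0 <= sqnorm h.
Proof. exact: sqmass_ge0. Qed.

Lemma sqmass_le h A : sqmass h A <= sqnorm h.
Proof.
rewrite /sqnorm /sqmass esum_mkcond; apply: le_esum => x _.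
by case: ifP => //; rewrite lee_fin sqr_ge0.
Qed.

Lemma sqnorm_translate h g : sqnorm (fun x => h (g * x)%g) = sqnorm h.
Proof.
rewrite /sqnorm /sqmass [RHS](reindex_esum setT setT (fun x => (g * x)%g)) //.
split=> //; first by move=> x y _ _; apply: mulgI.
by move=> x _; exists (g^-1 * x)%g; rewrite ?mulVKg.
Qed.

Lemma sqmass_translate h g A :
  sqmass h [set (g * x)%g | x in A] = sqmass (fun x => h (g * x)%g) A.
Proof.
by rewrite /sqmass (esum_image _ (fun x => (g * x)%g)) // => x y _ _; apply: mulgI.
Qed.

Lemma esumZ (c : R) (f : G -> R) A : (0 < c)%R -> (forall x, 0 <= f x)%R ->
  \esum_(x in A) (c * f x)%:E = c%:E * \esum_(x in A) (f x)%:E.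
Proof.
move=> c0 f0.
have le (k : R) (g : G -> R) : (0 < k)%R -> (forall x, 0 <= g x)%R ->
    \esum_(x in A) (k * g x)%:E <= k%:E * \esum_(x in A) (g x)%:E.
  move=> k0 g0; apply: ge_ereal_sup => _ [X XA <-].
  have -> : \sum_(x \in X) (k * g x)%:E = k%:E * \sum_(x \in X) (g x)%:E.
    rewrite ge0_mule_fsumr; first by apply: eq_fsbigr => x _; rewrite EFinM.
    by move=> x; rewrite lee_fin.
  apply: lee_wpmul2l; first by rewrite lee_fin ltW.
  by apply: ereal_sup_ubound; exists X.
apply/eqP; rewrite eq_le le //=.
have := le c^-1%R (fun x => c * f x)%R.
rewrite invr_gt0 => /(_ c0); under eq_esum do rewrite mulKf ?gt_eqF //.
move=> H; have {}H := H (fun x => mulr_ge0 (ltW c0) (f0 x)).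
have := lee_wpmul2l (_ : 0 <= c%:E) H; rewrite lee_fin => /(_ (ltW c0)).
by rewrite muleA -EFinM divff ?gt_eqF // mul1e.
Qed.

End AlmostInvariant.

Section AlmostInvariantMean.
Variables (R : realType) (G : groupType) (I : Type) (i0 : I) (s : I -> G).
Hypothesis s_gen : forall P : G -> Prop,
  P 1%g -> (forall i x, P x -> P (s i * x)%g) -> forall x, P x.
Hypothesis s_inv : forall i, exists j, s j = ((s i)^-1)%g.
Implicit Types (A B : set G) (h : G -> R).

Lemma sqmassU h A B : A `&` B = set0 ->
  sqmass h (A `|` B) = (sqmass h A + sqmass h B)%E.
Proof.
move=> AB0; rewrite /sqmass (esumID A) //; last first.
  by move=> x _; rewrite lee_fin sqr_ge0.
rewrite (_ : (A `|` B) `&` A = A); last by apply/seteqP; split=> x /=; tauto.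
rewrite (_ : (A `|` B) `&` ~` A = B) //; apply/seteqP; split=> x /=; first tauto.
move=> Bx; split; first by right.
by move=> Ax; have : (A `&` B) x by []; rewrite AB0.
Qed.

Lemma sqmass_fin h A : (sqnorm h < +oo)%E -> sqmass h A \is a fin_num.
Proof.
by move=> h1; rewrite ge0_fin_numE ?sqmass_ge0 // (le_lt_trans (sqmass_le h A)).
Qed.

(** Weighted AM-GM applied to [(p - q) * (p + q)]. When t^2 is of the order of the relative error in
    the squared norm, both correction terms are of order t. *)
Lemma sqmass_perturb (t : R) h1 h2 A : 0 < t ->
  (sqmass h1 A <= sqmass h2 A + ((2 * t)^-1%:E * sqmass (fun x => h1 x - h2 x)%R A
     + t%:E * (sqmass h1 A + sqmass h2 A)))%E.
Proof.
move=> t0; have t20 : 0 < (2 * t)^-1 by rewrite invr_gt0 mulr_gt0.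
have sq0 h x : (0 <= (h x ^+ 2)%:E)%E by rewrite lee_fin sqr_ge0.
rewrite /sqmass -esumD // -!esumZ //; try by move=> x; rewrite ?addr_ge0 ?sqr_ge0.
rewrite -!esumD //; try by move=> x _;
  rewrite -?EFinD lee_fin ?addr_ge0 // mulr_ge0 ?addr_ge0 ?sqr_ge0 ?ltW.
apply: le_esum => x _; rewrite -!EFinD lee_fin.
set p := h1 x; set q := h2 x.
rewrite -subr_ge0.
have -> : q ^+ 2 + ((2 * t)^-1 * (p - q) ^+ 2 + t * (p ^+ 2 + q ^+ 2)) - p ^+ 2
  = (2 * t)^-1 * ((p - q - t * (p + q)) ^+ 2 + t ^+ 2 * (p - q) ^+ 2).
  by field; rewrite gt_eqF.
apply: mulr_ge0; first exact: ltW.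
by rewrite addr_ge0 ?sqr_ge0 // mulr_ge0 ?sqr_ge0.
Qed.

(** Functions on a bipartite Cayley graph may live on words of one parity, so only translates by two
    generators are compared with each other. The limit mean M is then invariant under products of an
    even number of generators, and [M'] averages M with its translate by one generator. *)
Lemma amenable_of_almost_invariant :
  (forall e : R, 0 < e -> exists2 h, (0 < sqnorm h < +oo)%E &
     forall i j, (sqnorm (fun x => h (s i * x)%g - h (s j * x)%g)%R <= e%:E * sqnorm
       h)%E) ->
  amenable R G.
Proof.
move=> ai.
have t0 k : 0 < harmonic k :> R by rewrite /harmonic /= invr_gt0 ltr0n.
(* The tolerance is the square of [harmonic k], because [sqmass_perturb] with t = [harmonic k]
   divides it by 2 t. The total error is then 5/2 t, rounded up to 3 t below. *)
have /choice[h hP] : forall k, exists h, (0 < sqnorm h < +oo)%E /\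
     forall i j, (sqnorm (fun x => h (s i * x)%g - h (s j * x)%g)%R <= ((harmonic k :
       R) ^+ 2)%:E * sqnorm h)%E.
  by move=> k; have [|h h1 h2] := ai (harmonic k ^+ 2); [rewrite exprn_gt0|exists h].
have hf k A : sqmass (h k) A \is a fin_num.
  by apply: sqmass_fin; have [/andP[]] := hP k.
pose n k := fine (sqnorm (h k)).
have n0 k : 0 < n k by apply: fine_gt0; have [] := hP k.
pose mu A k : R := fine (sqmass (h k) A) / n k.
have mu01 A k : 0 <= mu A k <= 1.
  rewrite /mu divr_ge0 ?fine_ge0 ?sqmass_ge0 ?(ltW (n0 k)) //=.
  by rewrite ler_pdivrMr // mul1r fine_le ?hf ?sqmass_le.
have muT k : mu setT k = 1 by rewrite /mu divff // (gt_eqF (n0 k)).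
have muU A B k : A `&` B = set0 -> mu (A `|` B) k = mu A k + mu B k.
  by move=> AB; rewrite /mu sqmassU // fineD ?hf // mulrDl.
have mus A i j k : mu [set (s i * x)%g | x in A] k <=
    mu [set (s j * x)%g | x in A] k + harmonic k * 3.
  rewrite /mu ler_pdivrMr // mulrDl divfK ?(gt_eqF (n0 k)) //.
  have fi l : sqmass (fun x => h k (s l * x)%g) A \is a fin_num.
    by rewrite -sqmass_translate.
  have := sqmass_perturb (fun x => h k (s i * x)%g) (fun x => h k (s j * x)%g) A (t0 k).
  set D := sqmass (fun x => _ - _) A.
  have DB : (D <= (harmonic k ^+ 2 * n k)%:E)%E.
    rewrite EFinM fineK ?hf //; have [_ /(_ i j)] := hP k.
    by apply: le_trans; apply: sqmass_le.
  have Df : D \is a fin_num.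
    by rewrite ge0_fin_numE ?sqmass_ge0 // (le_lt_trans DB) ?ltry.
  have Dr : fine D <= harmonic k ^+ 2 * n k by rewrite -lee_fin fineK.
  have Bd l : fine (sqmass (fun x => h k (s l * x)%g) A) <= n k.
    by rewrite fine_le ?hf // -sqmass_translate sqmass_le.
  rewrite !sqmass_translate -(fineK (fi i)) -(fineK (fi j)) -(fineK Df).
  rewrite -!EFinD. have fE (x : R) : fine x%:E = x by [].
  rewrite lee_fin !fE => /le_trans; apply.
  rewrite lerD2l; set t := harmonic k.
  have t_gt0 : 0 < t := t0 k.
  apply: (@le_trans _ _ ((2 * t)^-1 * (t ^+ 2 * n k) + t * (n k + n k))).
    apply: lerD; apply: ler_wpM2l => //; [by rewrite invr_ge0 mulr_ge0 ?(ltW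
      t_gt0)|exact: ltW|].
    by apply: lerD; apply: Bd.
  have -> : (2 * t)^-1 * (t ^+ 2 * n k) = t * n k / 2 by field; rewrite gt_eqF.
  have : 0 < t * n k by rewrite mulr_gt0.
  have -> : t * n k / 2 + t * (n k + n k) = 5 / 2 * (t * n k) by field.
  have -> : t * 3 * n k = 3 * (t * n k) by ring.
  lra.
have [F [UF Foo]] := ultraFilterLemma eventually_filter.
have cv A : cvg (mu A @ F) by apply: ultra_cvg_itv.
pose M A : R := lim (mu A @ F).
have MU A B : A `&` B = set0 -> M (A `|` B) = M A + M B.
  move=> AB; apply/cvg_lim => //.
  rewrite (_ : mu (A `|` B) = (fun k => mu A k + mu B k)).
    by apply: cvgD; apply: cv.
  by apply/funext => k; apply: muU.
have M0 A : 0 <= M A by apply: limr_ge => //; apply: nearW => k; case/andP: (mu01 A k).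
have MT : M setT = 1.
  apply/cvg_lim => //; rewrite (_ : mu setT = cst 1); first exact: cvg_cst.
  by apply/funext => k; apply: muT.
have Ms A i j : M [set (s i * x)%g | x in A] = M [set (s j * x)%g | x in A].
  have le a b : M [set (s a * x)%g | x in A] <= M [set (s b * x)%g | x in A].
    have cvR : (fun k => mu [set (s b * x)%g | x in A] k + harmonic k * 3) @ F -->
        M [set (s b * x)%g | x in A] + 0 * 3.
      apply: cvgD; first exact: cv.
      apply: cvgM; last exact: cvg_cst.
      by apply: cvg_trans cvg_harmonic; apply: cvg_app.
    rewrite -[leRHS]addr0 -[X in _ + X](mul0r 3) -(cvg_lim _ cvR) //.
    apply: ler_lim; [exact: cv|by apply/cvg_ex; exists (M [set (s b * x)%g | x in A] +
      0 * 3)|].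
    by apply: nearW => k; apply: mus.
  by apply/le_anti; rewrite !le.
have imA (g g' : G) A : [set (g * x)%g | x in [set (g' * x)%g | x in A]] = [set ((g *
  g') * x)%g | x in A].
  by rewrite image_comp; congr image; apply/funext => x /=; rewrite mulgA.
pose M' A := (M A + M [set (s i0 * x)%g | x in A]) / 2.
have M's i A : M' [set (s i * x)%g | x in A] = M' A.
  rewrite /M'; congr (_ / 2); rewrite [LHS]addrC; congr (_ + _); last exact: Ms.
  have [j sj] := s_inv i.
  rewrite (Ms _ i0 j) imA sj mulVg.
  by congr M; under eq_imagel do rewrite mul1g; rewrite image_id.
exists M'; split.
- by move=> A; rewrite divr_ge0 // addr_ge0.
- rewrite /M' MT (_ : [set _ | _ in setT] = setT) ?MT; first by rewrite -[1 + 1]/(2%:R)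
  divff ?pnatr_eq0.
  by apply/seteqP; split=> // x _; exists ((s i0)^-1 * x)%g; rewrite ?mulVKg.
- move=> A B AB; rewrite /M' image_setU !MU //; first by field.
  rewrite -subset0 => _ [[x Ax <-] [y By /mulgI yx]].
  by have : (A `&` B) x; [split; rewrite // -yx|rewrite AB].
- move=> g; elim/s_gen: g => [A|i g IH A].
    by congr M'; under eq_imagel do rewrite mul1g; rewrite image_id.
  by rewrite -imA M's IH.
Qed.

End AlmostInvariantMean.

(** * Energy estimates for square summable functions *)

Section SquareSummable.
Variables (R : realType) (G : groupType).
Implicit Types (h : G -> R).

Definition l2 h : Prop := (sqnorm h < +oo)%E.
Definition nrm2 h : R := fine (sqnorm h).

Lemma nrm2E h : l2 h -> sqnorm h = (nrm2 h)%:E.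
Proof. by move=> hf; rewrite fineK // ge0_fin_numE ?sqnorm_ge0. Qed.

Lemma nrm2_ge0 h : 0 <= nrm2 h.
Proof. by rewrite fine_ge0 ?sqnorm_ge0. Qed.

Lemma nrm2_translate h g : nrm2 (fun x => h (g * x)%g) = nrm2 h.
Proof. by rewrite /nrm2 sqnorm_translate. Qed.

Lemma l2_translate h g : l2 h -> l2 (fun x => h (g * x)%g).
Proof. by rewrite /l2 sqnorm_translate. Qed.

Lemma sqr_le_nrm2 h x : l2 h -> h x ^+ 2 <= nrm2 h.
Proof.
move=> hf; rewrite -lee_fin -nrm2E // -[X in (X <= _)%E](@esum_set1 R G x (fun y => (h
  y ^+ 2)%:E)) ?lee_fin ?sqr_ge0 //.
exact: sqmass_le.
Qed.

Lemma esum_sqr_sum (I : finType) (c : I -> R) (h : I -> G -> R) :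
  (forall i, 0 <= c i) -> (forall i, l2 (h i)) ->
  (\esum_(x in [set: G]) (\sum_i c i * h i x ^+ 2)%:E)%E
  = (\sum_i c i * nrm2 (h i))%:E.
Proof.
move=> c0 hf; under eq_esum do rewrite -sumEFin.
rewrite esum_sum; last by move=> x i _ _; rewrite lee_fin mulr_ge0 ?sqr_ge0.
rewrite -sumEFin; apply: eq_bigr => i _.
have := c0 i; rewrite le_eqVlt => /predU1P[<-|ci].
  by rewrite mul0r esum1 // => x _; rewrite mul0r.
by rewrite esumZ // ?EFinM -?nrm2E // => x; apply: sqr_ge0.
Qed.

(** Integrates a pointwise inequality between combinations of squares; the energy estimates below
    thus reduce to polynomial inequalities. *)
Lemma nrm2_sum_le (I J : finType) (c : I -> R) (h : I -> G -> R)
    (e : J -> R) (k : J -> G -> R) :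
  (forall i, 0 <= c i) -> (forall i, l2 (h i)) ->
  (forall j, 0 <= e j) -> (forall j, l2 (k j)) ->
  (forall x, \sum_i c i * h i x ^+ 2 <= \sum_j e j * k j x ^+ 2) ->
  \sum_i c i * nrm2 (h i) <= \sum_j e j * nrm2 (k j).
Proof.
move=> c0 hf e0 kf le; rewrite -lee_fin -!esum_sqr_sum //.
by apply: le_esum => x _; rewrite lee_fin.
Qed.

Lemma nrm2_le_sum (J : finType) (h : G -> R) (e : J -> R) (k : J -> G -> R) :
  (forall j, 0 <= e j) -> (forall j, l2 (k j)) ->
  (forall x, h x ^+ 2 <= \sum_j e j * k j x ^+ 2) ->
  l2 h /\ nrm2 h <= \sum_j e j * nrm2 (k j).
Proof.
move=> e0 kf le; have hf : l2 h.
  apply: (@le_lt_trans _ _ (\sum_j e j * nrm2 (k j))%:E); last exact: ltry.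
  by rewrite -esum_sqr_sum //; apply: le_esum => x _; rewrite lee_fin.
split => //; have := @nrm2_sum_le unit J (fun=> 1) (fun=> h) e k.
rewrite big_const card_unit /= addr0 mul1r; apply => //.
by move=> x; rewrite big_const card_unit /= addr0 mul1r.
Qed.

Lemma l2B h1 h2 : l2 h1 -> l2 h2 -> l2 (fun x => h1 x - h2 x).
Proof.
move=> h1f h2f.
have H := @nrm2_le_sum bool (fun x => h1 x - h2 x) (fun=> 2) (fun b => if b then h1
  else h2).
apply: (proj1 (H _ _ _)) => [//|[] //|x]; rewrite big_bool /= -subr_ge0.
by rewrite [leRHS](_ : _ = (h1 x + h2 x) ^+ 2) ?sqr_ge0 //; ring.
Qed.

End SquareSummable.

(** Jensen's inequality with a remainder: the variance is the sum of [p i * p j * (h i - h j) ^+ 2]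
    over all pairs, and one pair is kept. This remainder is what turns a small loss of norm into
    almost invariance. *)
Lemma variance_ge (R : realType) (I : finType) (p h : I -> R) (i j : I) :
  (forall k, 0 <= p k) -> \sum_k p k = 1 ->
  (\sum_k p k * h k) ^+ 2 + p i * p j * (h i - h j) ^+ 2 <= \sum_k p k * h k ^+ 2.
Proof.
move=> p0 p1; set m := \sum_k p k * h k.
have Hv : \sum_k p k * (h k - m) ^+ 2 = \sum_k p k * h k ^+ 2 - m ^+ 2.
  under eq_bigr do rewrite sqrrB mulrDr mulrBr.
  rewrite big_split sumrB /= -mulr_suml p1 mul1r.
  under [X in _ - X + _]eq_bigr do rewrite mulrnAr mulrA -mulr_natr.
  rewrite -2!mulr_suml -/m; ring.
suff : p i * p j * (h i - h j) ^+ 2 <= \sum_k p k * (h k - m) ^+ 2 by rewrite Hv; lra.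
have [<-|ij] := eqVneq i j; first by rewrite subrr expr0n mulr0 sumr_ge0 // => k _;
  rewrite mulr_ge0 ?sqr_ge0.
rewrite (bigD1 i) //= (bigD1 j) /=; last by rewrite eq_sym.
have : 0 <= \sum_(k | (k != i) && (k != j)) p k * (h k - m) ^+ 2.
  by apply: sumr_ge0 => k _; rewrite mulr_ge0 ?sqr_ge0.
have : p i + p j <= 1.
  rewrite -p1 (bigD1 i) //= lerD2l (bigD1 j) /=; last by rewrite eq_sym.
  by rewrite lerDl sumr_ge0.
have := p0 i; have := p0 j.
set u := h i - m; set v := h j - m.
rewrite (_ : h i - h j = u - v); last by rewrite /u /v; ring.
move: (p i) (p j) u v => a b u v b0 a0 ab.
set S := \sum_(_ | _) _ => S0.
rewrite -subr_ge0 (_ : _ - _ = a * (1 - a - b) * u ^+ 2 + b * (1 - a - b) * v ^+ 2 + (a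
  * u + b * v) ^+ 2 + S); last by ring.
by rewrite !addr_ge0 ?sqr_ge0 // mulr_ge0 ?sqr_ge0 // mulr_ge0 //; lra.
Qed.

Lemma ex_letter (d : nat) (s : seq (letter d)) :
  (size s < 2 * d)%N -> exists c, c \notin s.
Proof.
move=> sd; apply/existsP; rewrite -negb_forall; apply/negP => /forallP sT.
have : (#|{: letter d}| <= size s)%N.
  apply: leq_trans (card_size s); apply: subset_leq_card.
  by apply/fintype.subsetP => x _; apply: sT.
by rewrite card_prod card_ord card_bool; lia.
Qed.

(** * Sums over spheres in the quotient group *)

(* sphere f s n x a is the sum of f v_0 * .. * f v_n over the reduced words
   a = v_0, .., v_n of length n.+1 representing x. *)
Fixpoint sphere (R : realType) (d : nat) (G : groupType) (f : letter d -> R)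
    (s : letter d -> G) n (x : G) (a : letter d) : R :=
  if n is m.+1 then
    f a * \sum_(b | b != invl a) sphere f s m ((s a)^-1 * x)%g b
  else if x == s a then f a else 0.

Section CriticalSphere.
Variables (R : realType) (d : nat) (G : groupType).
Variables (f : letter d -> R) (s : letter d -> G).
Hypothesis hd : (2 <= d)%N.
Hypothesis f_itv : forall a, 0 < f a < 1.
Hypothesis f_inv : forall a, f (invl a) = f a.
Hypothesis f_crit : \sum_a f a / (1 + f a) = 1.
Hypothesis s_inv : forall a, s (invl a) = ((s a)^-1)%g.
Hypothesis s_gen : forall P : G -> Prop,
  P 1%g -> (forall a x, P x -> P (s a * x)%g) -> forall x, P x.

(** Here t is the Perron vector of the admissible transitions, q the Markov kernel it defines, and w
    its stationary weight: [w a * q a b = t a * t b] on admissible pairs. Dividing [sphere] by t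
    makes the recursion an average with respect to q. *)
Let t a := f a / (1 + f a).
Let q a b := if b != invl a then (1 + f a) * t b else 0.
Let w a := t a / (1 + f a).
Let sigma n a x := sphere f s n x a / t a.
Let Q n := \sum_a w a * nrm2 (sigma n a).

Let f_gt0 a : 0 < f a. Proof. by have /andP[] := f_itv a. Qed.
Let f1_gt0 a : 0 < 1 + f a. Proof. by rewrite addr_gt0. Qed.
Let t_gt0 a : 0 < t a. Proof. by rewrite divr_gt0. Qed.
Let w_gt0 a : 0 < w a. Proof. by rewrite divr_gt0. Qed.
Let t_inv a : t (invl a) = t a. Proof. by rewrite /t f_inv. Qed.

Let sum_t_neq a : \sum_(b | b != invl a) t b = (1 + f a)^-1.
Proof.
have : \sum_a t a = 1 := f_crit.
rewrite (bigD1 (invl a)) //= t_inv => /(canRL (addKr _)) ->.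
by rewrite /t; field; rewrite gt_eqF.
Qed.

Let q_ge0 a b : 0 <= q a b.
Proof. by rewrite /q; case: ifP => // _; rewrite ltW // mulr_gt0. Qed.

Let q_sum a : \sum_b q a b = 1.
Proof. by rewrite /q -big_mkcond /= -mulr_sumr sum_t_neq divff // gt_eqF. Qed.

Let w_stat b : \sum_a w a * q a b = w b.
Proof.
have E a : w a * q a b = if a != invl b then t b * t a else 0.
  rewrite /q [in RHS]eq_sym -[in RHS](inj_eq (can_inj (@invlK d))) invlK eq_sym.
  case: ifP => _; last by rewrite mulr0.
  by rewrite /w mulrA divfK ?gt_eqF // mulrC.
under eq_bigr do rewrite E.
by rewrite -big_mkcond /= -mulr_sumr sum_t_neq.
Qed.

Let sigmaS n a x : sigma n.+1 a x = \sum_b q a b * sigma n b ((s a)^-1 * x)%g.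
Proof.
rewrite /sigma /= big_mkcond /= mulr_sumr mulr_suml; apply: eq_bigr => b _.
rewrite /q; case: ifP => _; last by rewrite mulr0 !mul0r.
by rewrite /t; field; rewrite !gt_eqF.
Qed.

Let sigma_step n a b c y :
  sigma n.+1 a (s a * y)%g ^+ 2 + q a b * q a c * (sigma n b y - sigma n c y) ^+ 2
    <= \sum_k q a k * sigma n k y ^+ 2.
Proof.
rewrite sigmaS; under [in leLHS]eq_bigr do rewrite mulKg.
exact: variance_ge.
Qed.

Let sigma_l2 n a : l2 (sigma n a).
Proof.
elim: n a => [|n IH] a.
  rewrite /l2 /sqnorm /sqmass (esumID [set s a]); last first.
    by move=> x _; rewrite lee_fin sqr_ge0.
  rewrite setTI esum_set1 ?lee_fin ?sqr_ge0 // setTI esum1 ?adde0 ?ltry //.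
  move=> x /= /eqP xa; rewrite /sigma /= (negbTE xa).
  by rewrite mul0r expr0n.
rewrite /l2 -(sqnorm_translate _ (s a)).
apply: (proj1 (@nrm2_le_sum _ _ _ (fun y => sigma n.+1 a (s a * y)%g) (q a) (sigma n) _
  _ _)) => //.
by move=> y; apply: le_trans (sigma_step n a a a y); rewrite subrr expr0n mulr0 addr0.
Qed.

(** Jensen's inequality for every letter, averaged with the stationary weight w, shows that Q
    decreases; the variance remainder is kept for one letter a and one pair b, c. *)
Let Q_step n a b c :
  Q n.+1 + w a * (q a b * q a c * nrm2 (fun y => sigma n b y - sigma n c y)) <= Q n.
Proof.
have dl2 : l2 (fun y => sigma n b y - sigma n c y) by apply: l2B.
have le a' b' c' : l2 (fun y => sigma n b' y - sigma n c' y) ->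
    nrm2 (sigma n.+1 a') + q a' b' * q a' c' * nrm2 (fun y => sigma n b' y - sigma n c' y)
      <= \sum_k q a' k * nrm2 (sigma n k).
  move=> l2d.
  have := @nrm2_sum_le _ _ bool _
    (fun e => if e then 1 else q a' b' * q a' c')
    (fun e => if e then (fun y => sigma n.+1 a' (s a' * y)%g)
              else (fun y => sigma n b' y - sigma n c' y)) (q a') (sigma n).
  rewrite big_bool /= mul1r nrm2_translate; apply => //.
  - by case; rewrite ?mulr_ge0.
  - by case=> //; apply: l2_translate.
  - by move=> y; rewrite big_bool /= mul1r; apply: sigma_step.
have -> : Q n = \sum_a' w a' * \sum_k q a' k * nrm2 (sigma n k).
  under [RHS]eq_bigr do rewrite mulr_sumr.
  rewrite exchange_big /=; apply: eq_bigr => k _.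
  by under [RHS]eq_bigr do rewrite mulrA; rewrite -mulr_suml w_stat.
rewrite /Q (bigD1 a) //= [leRHS](bigD1 a) //= addrAC -mulrDr.
apply: lerD; first by rewrite ler_pM2l // le.
apply: ler_sum => a' _; rewrite ler_pM2l //.
apply: le_trans (le a' a' a' _); first by rewrite lerDl mulr_ge0 ?nrm2_ge0 // mulr_ge0.
exact: l2B.
Qed.

Let Q_ge0 n : 0 <= Q n.
Proof. by apply: sumr_ge0 => a _; rewrite mulr_ge0 ?nrm2_ge0 ?(ltW (w_gt0 a)). Qed.

Let Q_dec n : Q n.+1 <= Q n.
Proof.
have [a _] := ex_letter (s := [::] : seq (letter d)) ltac:(by rewrite muln_gt0 /=;
  apply: leq_trans hd).
apply: le_trans (Q_step n a a a).
rewrite lerDl; apply: mulr_ge0; first exact: ltW.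
by apply: mulr_ge0; [apply: mulr_ge0|apply: nrm2_ge0].
Qed.

(** Some letter e differs from b and c, and then both may follow [invl e], so the loss at [invl e]
    sees their difference. The minimum over all triples makes k independent of n. *)
Let kappa_ex : exists2 k : R, 0 < k & forall n b c,
  k * nrm2 (fun y => sigma n b y - sigma n c y) <= Q n - Q n.+1.
Proof.
pose k := \big[Num.min/1]_(abc : letter d * letter d * letter d) (w abc.1.1 * ((1 + f
  abc.1.1) * t abc.1.2 * ((1 + f abc.1.1) * t abc.2))).
exists k.
  rewrite /k; elim/big_ind: _ => //; first by move=> x y; rewrite lt_min => -> ->.
  move=> abc _; apply: mulr_gt0; first exact: w_gt0.
  by apply: mulr_gt0; apply: mulr_gt0.
move=> n b c.
have [e] := ex_letter (s := [:: b; c]) ltac:(by rewrite /=; lia).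
rewrite !inE negb_or => /andP[eb ec].
have := Q_step n (invl e) b c.
rewrite /q invlK eq_sym eb eq_sym ec => H.
rewrite lerBrDl; apply: le_trans H; rewrite lerD2l mulrA ler_wpM2r ?nrm2_ge0 //.
by rewrite /k (bigD1 (invl e, b, c)) //= ge_min lexx.
Qed.

Lemma sphere_decay : ~ amenable R G ->
  exists C l : R, [/\ 0 <= C, 0 < l < 1 & forall n x a, sphere f s n x a <= C * l ^+ n].
Proof.
move=> namen.
have [k k0 kP] := kappa_ex.
(* Two steps are needed: the translate of [sigma n a0] by [s i] is compared with
   [sigma n.+1 (invl i)], which averages such translates of all [sigma n b], and the latter
   functions are compared with each other at time n.+1. So the losses at n and at n.+1 both
   enter. *)
have [e e0 eP] : exists2 e : R, 0 < e < 1 & forall n, Q n.+2 <= (1 - e) * Q n.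
  apply: contrapT => H; apply: namen.
  have [a0 _] := ex_letter (s := [::] : seq (letter d)) ltac:(by rewrite muln_gt0 /=;
    apply: leq_trans hd).
  apply: (amenable_of_almost_invariant a0 s_gen).
    by move=> i; exists (invl i).
  move=> e e0.
  (* [2^-1] keeps r below 1, and [k / 4] gives [Q n <= 4 * nrm2 h]. The constant 24 is 3 * 2 * 4:
     three squares in the final split, losses adding up to at most [2 * (r * Q n)], and this factor
     4. *)
  pose r := Num.min 2^-1 (Num.min (k / 4) (e * k / 24)).
  have r0 : 0 < r.
    by rewrite !lt_min invr_gt0 !divr_gt0 ?mulr_gt0 //= ltr0n.
  have r12 : r <= 2^-1 by rewrite ge_min lexx.
  have rk : r <= k / 4 by rewrite !ge_min lexx orbT.
  have re : r <= e * k / 24 by rewrite !ge_min lexx !orbT.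
  have [n Hn] : exists n, (1 - r) * Q n < Q n.+2.
    apply: contrapT => H'; apply: H; exists r; first by rewrite r0 /=; lra.
    by move=> n; rewrite leNgt; apply/negP => H1; apply: H'; exists n.
  have D1 := Q_dec n; have D2 := Q_dec n.+1; have Q0 := Q_ge0 n.
  have dr : Q n - Q n.+2 <= r * Q n.
    by rewrite lerBlDr -lerBlDl -[X in X - _]mul1r -mulrBl ltW.
  have Qp : 0 < Q n.
    rewrite lt_neqAle Q0 andbT; apply/eqP => Q00.
    by move: Hn; rewrite -Q00 mulr0; lra.
  have kB m b c : nrm2 (fun y => sigma m b y - sigma m c y) <= (Q m - Q m.+1) / k.
    by rewrite ler_pdivlMr // mulrC kP.
  pose h := sigma n a0.
  have Qh : Q n <= 4 * nrm2 h.
    have Hb b : nrm2 (sigma n b) <= 2 * nrm2 h + 2 * ((Q n - Q n.+1) / k).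
      have := @nrm2_le_sum _ _ bool (sigma n b) (fun=> 2)
        (fun b' => if b' then h else (fun y => sigma n b y - sigma n a0 y)).
      case=> //.
      - by case; [apply: sigma_l2|apply: l2B].
      - move=> x; rewrite big_bool /= -/h -subr_ge0.
        rewrite (_ : _ - _ = (sigma n b x - 2 * h x) ^+ 2) ?sqr_ge0 //; ring.
      move=> _ /le_trans; apply; rewrite big_bool /= lerD2l ler_pM2l //.
    have : Q n <= \sum_b w b * (2 * nrm2 h + 2 * ((Q n - Q n.+1) / k)).
      by apply: ler_sum => b _; rewrite ler_pM2l.
    rewrite -mulr_suml => H1.
    have w1 : \sum_b w b <= 1.
      rewrite -f_crit; apply: ler_sum => b _.
      by rewrite /w ler_pdivrMr // ler_peMr ?ltW // -[ltLHS]addr0 ltrD2l.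
    have H2 : Q n <= 2 * nrm2 h + 2 * ((Q n - Q n.+1) / k).
      apply: le_trans H1 _; rewrite ler_piMl //.
      by rewrite addr_ge0 ?mulr_ge0 ?nrm2_ge0 ?invr_ge0 ?(ltW k0) //; lra.
    have : (Q n - Q n.+1) / k <= Q n / 4.
      rewrite ler_pdivrMr //; apply: (@le_trans _ _ (r * Q n)); first lra.
      by rewrite mulrAC -mulrA mulrC ler_wpM2l.
    lra.
  have sl2 m b : l2 (sigma m b) := sigma_l2 m b.
  have hi i : l2 (fun x => h (s i * x)%g - sigma n.+1 (invl i) x) /\
      nrm2 (fun x => h (s i * x)%g - sigma n.+1 (invl i) x) <= (Q n - Q n.+1) / k.
    have [|x|H1 H2] := @nrm2_le_sum _ _ _ (fun x => h (s i * x)%g - sigma n.+1 (invl i) x)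
      (q (invl i)) (fun b x => sigma n a0 (s i * x)%g - sigma n b (s i * x)%g) (q_ge0 _).
    - by move=> b; apply: (@l2_translate _ _ (fun y => sigma n a0 y - sigma n b y));
      apply: l2B.
    - rewrite sigmaS s_inv invgK.
      have := @variance_ge _ _ (q (invl i)) (fun b => sigma n a0 (s i * x)%g - sigma n
        b (s i * x)%g) a0 a0 (q_ge0 _) (q_sum _).
      rewrite !subrr expr0n mulr0 addr0; apply: le_trans.
      under [X in _ <= X ^+ 2]eq_bigr do rewrite mulrBr.
      by rewrite sumrB -mulr_suml q_sum mul1r.
    split=> //; apply: le_trans H2 _.
    apply: (@le_trans _ _ (\sum_b q (invl i) b * ((Q n - Q n.+1) / k))).
      apply: ler_sum => b _; rewrite ler_wpM2l //.
      by rewrite (nrm2_translate (fun y => sigma n a0 y - sigma n b y)).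
    by rewrite -mulr_suml q_sum mul1r.
  exists h; first by rewrite (nrm2E (sigma_l2 n a0)) lte_fin ltry andbT; lra.
  move=> i j.
  have [Ai Bi] := hi i; have [Aj Bj] := hi j.
  have := @nrm2_le_sum _ _ 'I_3 (fun x => h (s i * x)%g - h (s j * x)%g) (fun=> 3)
    (fun l => match val l with
      | 0%N => fun x => h (s i * x)%g - sigma n.+1 (invl i) x
      | 1%N => fun x => h (s j * x)%g - sigma n.+1 (invl j) x
      | _ => fun x => sigma n.+1 (invl i) x - sigma n.+1 (invl j) x end).
  case=> //.
  - by case=> [[|[|]]] //= *; apply: l2B.
  - move=> x; rewrite !big_ord_recl big_ord0 /= addr0.
    set a := h _; set b := h _; set c := sigma _ _ _; set c' := sigma _ _ _.
    rewrite -subr_ge0 (_ : _ - _ = ((a - c) + (b - c')) ^+ 2 + ((a - c) - (c - c')) ^+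
      2 + ((b - c') + (c - c')) ^+ 2).
      by rewrite !addr_ge0 ?sqr_ge0.
    ring.
  move=> l2d; rewrite !big_ord_recl big_ord0 /= addr0 => H1.
  rewrite (nrm2E l2d) (nrm2E (sigma_l2 n a0)) -EFinM lee_fin; apply: le_trans H1 _.
  have B3 := kB n.+1 (invl i) (invl j).
  have : (Q n - Q n.+1) / k + (Q n - Q n.+1) / k + (Q n.+1 - Q n.+2) / k <= 2 * (r * Q
    n / k).
    rewrite -!mulrDl mulrA ler_pM2r ?invr_gt0 //; lra.
  have : r * Q n / k <= e * nrm2 h / 6.
    rewrite ler_pdivrMr //; apply: (@le_trans _ _ (e * k / 24 * (4 * nrm2 h))).
      by apply: ler_pM => //; exact: ltW.
    by rewrite le_eqVlt; apply/orP; left; apply/eqP; field.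
  rewrite -/h; lra.
have e1 : 0 < 1 - e by case/andP: e0 => *; lra.
pose m := Num.sqrt (1 - e).
have m2 : m ^+ 2 = 1 - e by rewrite sqr_sqrtr // ltW.
have m0 : 0 < m by rewrite sqrtr_gt0.
have m1 : m < 1 by rewrite -sqrtr1 ltr_sqrt //; case/andP: e0 => *; lra.
pose C0 := Q 0%N / m.
have QC n : Q n <= C0 * m ^+ n /\ Q n.+1 <= C0 * m ^+ n.+1.
  elim: n => [|n [IH1 IH2]].
    rewrite expr0 expr1 mulr1 divfK ?gt_eqF //; split; last exact: Q_dec.
    by rewrite ler_pdivlMr // ler_piMr // ltW.
  split=> //; apply: le_trans (eP n) _.
  rewrite -m2 (_ : C0 * m ^+ n.+2 = m ^+ 2 * (C0 * m ^+ n)); last by rewrite !exprS; ring.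
  by rewrite ler_pM2l ?exprn_gt0.
have C00 : 0 <= C0 by rewrite divr_ge0 // ltW.
have wm n x a : w a * sigma n a x ^+ 2 <= Q n.
  apply: (@le_trans _ _ (w a * nrm2 (sigma n a))).
    by rewrite ler_pM2l //; apply: sqr_le_nrm2.
  rewrite /Q (bigD1 a) //= lerDl; apply: sumr_ge0 => b _.
  by apply: mulr_ge0; [exact: ltW|exact: nrm2_ge0].
(* The rate is a fourth root of 1 - e: one square root because the loss occurs over two steps,
   another because Q controls squares. *)
exists (Num.sqrt C0), (Num.sqrt m); split; rewrite ?sqrtr_ge0 //.
  by rewrite sqrtr_gt0 m0 -sqrtr1 ltr_sqrt.
move=> n x a; have [QCn _] := QC n.
apply: le_trans (ler_norm _) _.
rewrite -(@ler_pXn2r _ 2) ?nnegrE ?mulr_ge0 ?sqrtr_ge0 ?exprn_ge0 ?sqrtr_ge0 //.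
rewrite real_normK ?num_real // exprMn -exprM mulnC exprM !sqr_sqrtr ?(ltW m0) //.
apply: le_trans QCn; apply: le_trans (wm n x a).
rewrite /sigma expr_div_n /w /t.
have f1 : f a <= 1 by have /andP[_ /ltW] := f_itv a.
have := f_gt0 a; have := f1_gt0 a; set F := f a in f1 *; set Y := sphere _ _ _ _ _ =>
  F1 F0.
rewrite (_ : _ * _ = Y ^+ 2 / F); last by field; rewrite !gt_eqF.
by rewrite ler_pdivlMr // ler_piMr ?sqr_ge0.
Qed.

End CriticalSphere.

(** * Means of finitely valued functions *)

Section FiniteMean.
Variables (R : realType) (G : groupType) (mu : set G -> R).
Hypothesis mu_ge0 : forall A, 0 <= mu A.
Hypothesis muT : mu setT = 1.
Hypothesis muU : forall A B, A `&` B = set0 -> mu (A `|` B) = mu A + mu B.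
Hypothesis mu_inv : forall g A, mu [set (g * x)%g | x in A] = mu A.

(** The mean of [phi \o J]. As mu is only finitely additive, functions are first discretized by a
    map J to a finite type; different discretizations are compared through [mean_comp]. *)
Definition mean (T : finType) (J : G -> T) (phi : T -> R) : R :=
  \sum_t phi t * mu (J @^-1` [set t]).

Let mu0 : mu set0 = 0.
Proof. have := muU (setI0 set0); rewrite setU0; lra. Qed.

Let mu_bigU (T : finType) (J : G -> T) (P : pred T) :
  mu [set x | P (J x)] = \sum_(t | P t) mu (J @^-1` [set t]).
Proof.
rewrite -big_filter; set e := [seq _ <- _ | _].
have -> : [set x | P (J x)] = [set x | J x \in e].
  by apply/seteqP; split=> x /=; rewrite mem_filter mem_index_enum andbT.
have : uniq e by rewrite filter_uniq ?index_enum_uniq.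
elim: e => [_|t r IH /= /andP[tr ur]].
  by rewrite big_nil -[RHS]mu0; congr mu; apply/seteqP; split.
rewrite big_cons -IH // -muU.
  congr mu; apply/seteqP; split=> x /=; rewrite inE.
    by case/predU1P; [left|right].
  by case=> [->|->]; rewrite ?eqxx ?orbT.
by apply/seteqP; split=> // x /= [-> tr']; rewrite tr' in tr.
Qed.

Lemma mean_cst (T : finType) (J : G -> T) c : mean J (fun=> c) = c.
Proof.
rewrite /mean -mulr_sumr -(mu_bigU J xpredT) (_ : [set x | _] = setT) ?muT ?mulr1 //.
by apply/seteqP; split.
Qed.

Lemma mean_comp (T U : finType) (J : G -> T) (h : T -> U) phi :
  mean (h \o J) phi = mean J (phi \o h).
Proof.
rewrite /mean [RHS](partition_big h xpredT) //=; apply: eq_bigr => u _.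
rewrite (eq_bigr (fun t => phi u * mu (J @^-1` [set t]))) => [|t /eqP -> //].
rewrite -mulr_sumr -(mu_bigU J (fun t => h t == u)); congr (_ * mu _).
by apply/seteqP; split=> x /= /eqP.
Qed.

Lemma mean_le (T : finType) (J : G -> T) phi psi :
  (forall x, phi (J x) <= psi (J x)) -> mean J phi <= mean J psi.
Proof.
move=> le; apply: ler_sum => t _.
have [[x /= <-]|] := pselect (J @^-1` [set t] !=set0); first by rewrite ler_wpM2r.
by move/set0P/negP/negPn/eqP => ->; rewrite mu0 !mulr0.
Qed.

Lemma mean_translate (T : finType) (J : G -> T) g phi :
  mean (fun x => J (g * x)%g) phi = mean J phi.
Proof.
apply: eq_bigr => t _; congr (_ * _); rewrite -(mu_inv g); congr mu.
apply/seteqP; split=> [_ [x /= Jx <-]|x /= Jx]; first by [].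
by exists (g^-1 * x)%g; rewrite /= mulVKg.
Qed.

Lemma meanD (T : finType) (J : G -> T) phi psi :
  mean J (fun t => phi t + psi t) = mean J phi + mean J psi.
Proof. by rewrite /mean -big_split; apply: eq_bigr => t _; rewrite mulrDl. Qed.

Lemma mean_sum (T I : finType) (J : G -> T) (c : I -> R) (phi : I -> T -> R) :
  mean J (fun t => \sum_i c i * phi i t) = \sum_i c i * mean J (phi i).
Proof.
rewrite /mean; under eq_bigr do rewrite mulr_suml.
rewrite exchange_big /=; apply: eq_bigr => i _.
by rewrite mulr_sumr; apply: eq_bigr => t _; rewrite mulrA.
Qed.

End FiniteMean.

(* If r is the ratio of two translates of u then the mean of r + 1 / r is at
   least 2; since the walk is symmetric, r and 1 / r are both ratios that occur
   in the superharmonicity inequality. *)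
Lemma amenable_superharmonic (R : realType) (d : nat) (G : groupType)
    (s : letter d -> G) (m : letter d -> R) (u : G -> R) :
  (forall a, s (invl a) = ((s a)^-1)%g) ->
  (forall a, 0 < m a) -> (forall a, m (invl a) = m a) -> (forall x, 0 < u x) ->
  (forall x, \sum_a m a * u ((s a)^-1 * x)%g <= u x) ->
  amenable R G -> \sum_a m a <= 1.
Proof.
move=> sV m0 mV u0 um [mu [mu_ge0 muT muU mu_inv]].
pose r a x := u ((s a)^-1 * x)%g / u x.
have r0 a x : 0 < r a x by rewrite divr_gt0.
have rV a x : r (invl a) x = (r a (s a * x)%g)^-1.
  by rewrite /r sV invgK mulKg invf_div.
have rm x : \sum_a m a * r a x <= 1.
  rewrite /r; under eq_bigr do rewrite mulrA.
  by rewrite -mulr_suml ler_pdivrMr // mul1r.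
have rb a x : r a x <= (m a)^-1.
  rewrite -[leRHS]mul1r ler_pdivlMr // mulrC; apply: le_trans (rm x).
  rewrite (bigD1 a) //= lerDl; apply: sumr_ge0 => b _.
  by rewrite mulr_ge0 // ltW.
(* The ratios are rounded down to multiples of 1/k; they take finitely many values by [rb]. The
   rounding costs the factor 1 - 1/k, and k tends to infinity at the end. *)
have main k : (0 < k)%N -> \sum_a m a * (1 - k%:R^-1) <= 1.
  move=> k0; have kR : 0 < k%:R :> R by rewrite ltr0n.
  pose B := (\max_a Num.truncn (k%:R / m a)).
  pose j a x : 'I_B.+1 := inord (Num.truncn (k%:R * r a x)).
  have jE a x : j a x = Num.truncn (k%:R * r a x) :> nat.
    rewrite inordK // ltnS (leq_trans _ (leq_bigmax a)) //.
    by apply: le_truncn; apply: ler_wpM2l; [exact: ltW|exact: rb].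
  have jr a x : (j a x)%:R / k%:R <= r a x < (j a x).+1%:R / k%:R.
    rewrite ler_pdivrMr // ltr_pdivlMr // mulrC jE.
    by apply: truncn_itv; rewrite mulr_ge0 ?ltW.
  pose v (i : 'I_B.+1) : R := i%:R / k%:R.
  have H1 : \sum_a m a * mean mu (j a) v <= 1.
    pose J x : {ffun letter d -> 'I_B.+1} := [ffun a => j a x].
    have -> : \sum_a m a * mean mu (j a) v
        = mean mu J (fun t : {ffun letter d -> 'I_B.+1} => \sum_a m a * v (t a)).
      rewrite mean_sum; apply: eq_bigr => a _; congr (_ * _).
      rewrite -(@mean_comp _ _ mu muU _ _ J (fun t : {ffun letter d -> 'I_B.+1} => t a)).
      by congr mean; apply/funext => x; rewrite /= ffunE.
    rewrite -(@mean_cst _ _ mu muT muU _ J 1); apply: mean_le => // x.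
    apply: le_trans (rm x); apply: ler_sum => a _; rewrite ler_pM2l // ffunE.
    by have /andP[] := jr a x.
  have H2 a : 2 - 2 / k%:R <= mean mu (j a) v + mean mu (j (invl a)) v.
    (* If the rounded value of [r a] at [s a * x] is i / k, then [r (invl a) x > k / i.+1], and
       rounding this down loses at most 1/k. *)
    pose phi (i : 'I_B.+1) : R := k%:R / i.+1%:R - k%:R^-1.
    have le1 : mean mu (j a) phi <= mean mu (j (invl a)) v.
      rewrite -(mean_translate mu_inv (j a) (s a)).
      pose J x := (j (invl a) x, j a (s a * x)%g).
      rewrite -[X in mean _ X _]/(snd \o J) -[X in _ <= mean _ X _]/(fst \o J).
      rewrite !mean_comp //; apply: mean_le => // x; rewrite /= /phi /v.
      have /andP[_] := jr (invl a) x; rewrite rV.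
      have /andP[_] := jr a (s a * x)%g.
      set p := r a _; have p0 : 0 < p := r0 _ _.
      set i := nat_of_ord (j a _); set i' := nat_of_ord (j (invl a) x).
      rewrite -[i'.+1%:R]natr1 mulrDl mul1r => h1 h2.
      rewrite lerBlDr; apply: ltW; apply: le_lt_trans h2.
      by rewrite -invf_div lef_pV2 ?posrE ?divr_gt0 // ltW.
    apply: (@le_trans _ _ (mean mu (j a) v + mean mu (j a) phi)); last by rewrite lerD2l.
    rewrite -meanD -(@mean_cst _ _ mu muT muU _ (j a) (2 - 2 / k%:R)).
    apply: mean_le => // x; rewrite /v /phi.
    set i := nat_of_ord _.
    have i0 : 0 < i.+1%:R :> R by rewrite ltr0n.
    have -> : i%:R = i.+1%:R - 1 :> R by rewrite -natr1 addrK.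
    move: i.+1%:R i0 => y y0.
    rewrite -subr_ge0 (_ : _ - _ = (y - k%:R) ^+ 2 / (y * k%:R)); last first.
      by field; rewrite !gt_eqF.
    by rewrite divr_ge0 ?sqr_ge0 // mulr_ge0 // ltW.
  have sV' (F : letter d -> R) : \sum_a F (invl a) = \sum_a F a.
    by rewrite [RHS](reindex_inj (can_inj (@invlK d))).
  have E : \sum_a m a * mean mu (j (invl a)) v = \sum_a m a * mean mu (j a) v.
    by rewrite -sV'; apply: eq_bigr => a _; rewrite invlK mV.
  have : \sum_a m a * (2 - 2 / k%:R) <= \sum_a m a * (mean mu (j a) v + mean mu (j
    (invl a)) v).
    by apply: ler_sum => a _; rewrite ler_pM2l.
  under [leRHS]eq_bigr do rewrite mulrDr.
  rewrite big_split /= E -!mulr_suml.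
  move: (\sum_a m a) (\sum_a m a * _) H1 => X Y; lra.
rewrite leNgt; apply/negP => S1.
set S := \sum_a m a in S1 *.
pose k := (Num.truncn (S / (S - 1))).+1.
have := main k isT; rewrite -mulr_suml -/S; apply/negP; rewrite -ltNge.
have kR : 0 < k%:R :> R by rewrite ltr0n.
have S2 : 0 <= S / (S - 1) by rewrite divr_ge0; lra.
have : S / (S - 1) < k%:R by case/andP: (truncn_itv S2).
rewrite ltr_pdivrMr; last lra.
move=> H; rewrite mulrBr mulr1 ltrBrDr -ltrBrDl ltr_pdivrMr //.
by rewrite mulrC.
Qed.

(** * The truncated Green function of a symmetric walk *)

Section SphereGreen.
Variables (R : realType) (d : nat) (G : groupType).
Variables (f : letter d -> R) (s : letter d -> G).
Hypothesis f_itv : forall a, 0 < f a < 1.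
Hypothesis f_inv : forall a, f (invl a) = f a.
Hypothesis s_inv : forall a, s (invl a) = ((s a)^-1)%g.
Hypothesis s_gen : forall P : G -> Prop,
  P 1%g -> (forall a x, P x -> P (s a * x)%g) -> forall x, P x.

Lemma sphere_ge0 n x a : 0 <= sphere f s n x a.
Proof.
have f0 b : 0 <= f b by have /andP[/ltW] := f_itv b.
elim: n x a => [|n IH] x a /=; first by case: ifP.
by apply: mulr_ge0 => //; apply: sumr_ge0 => b _; apply: IH.
Qed.

(* The weights [step] are those of the symmetric random walk on the free group
   whose Green function is a constant multiple of the product of [f] along
   reduced words. *)
Let c : R := 1 + \sum_a f a ^+ 2 / (1 - f a ^+ 2).
Let step a := f a / (c * (1 - f a ^+ 2)).
Let ball L x : R := (x == 1%g)%:R + \sum_(n < L) \sum_a sphere f s n x a.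

Let f_gt0 a : 0 < f a. Proof. by have /andP[] := f_itv a. Qed.
Let f2_gt0 a : 0 < 1 - f a ^+ 2.
Proof. by have /andP[f0 f1] := f_itv a; rewrite subr_gt0 expr_lt1 // ltW. Qed.
Let c_gt0 : 0 < c.
Proof.
rewrite /c ltr_wpDr //; apply: sumr_ge0 => a _.
by apply: divr_ge0; [exact: sqr_ge0|exact: ltW].
Qed.
Let step_gt0 a : 0 < step a.
Proof. by apply: divr_gt0 => //; apply: mulr_gt0. Qed.

Let sphereS n v x : sphere f s n.+1 x v =
  f v * (\sum_a sphere f s n ((s v)^-1 * x)%g a - sphere f s n ((s v)^-1 * x)%g (invl v)).
Proof.
by rewrite /=; congr (_ * _); rewrite [in RHS](bigD1 (invl v)) //= addrAC subrr add0r.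
Qed.

Let sphere_back n v x : sphere f s n.+1 ((s v)^-1 * x)%g (invl v) =
  f v * (\sum_a sphere f s n x a - sphere f s n x v).
Proof. by rewrite sphereS f_inv s_inv invgK mulVKg invlK. Qed.

(** Multiplication by the inverse of v strips the first letter of the words that begin with v,
    dividing their weight by [f v], and prepends [invl v] to the others, multiplying it by [f v].
    Truncation is responsible for the inequality and for the radius L.+1. *)
Let ball_translate L v x : ball L ((s v)^-1 * x)%g <=
  ((f v)^-1 - f v) * (\sum_(n < L.+1) sphere f s n x v) + f v * ball L.+1 x.
Proof.
have E : ball L ((s v)^-1 * x)%g = (f v)^-1 * (\sum_(n < L.+1) sphere f s n x v)
    + \sum_(n < L) sphere f s n ((s v)^-1 * x)%g (invl v).
  rewrite big_ord_recl mulrDr -addrA; congr (_ + _).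
    have -> : ((s v)^-1 * x == 1)%g = (x == s v).
      by rewrite -[LHS](inj_eq (mulgI (s v))) mulVKg mulg1.
    rewrite [sphere _ _ ord0 _ _]/=.
    by case: eqP => _; rewrite ?mulr0 // mulVf // gt_eqF.
  rewrite mulr_sumr -big_split; apply: eq_bigr => n _.
  by rewrite lift0 sphereS mulKf ?gt_eqF //= subrK.
rewrite E mulrBl -addrA lerD2l.
pose D n := \sum_a sphere f s n x a - sphere f s n x v.
have D0 n : 0 <= D n.
  rewrite /D (bigD1 v) //= addrAC subrr add0r.
  by apply: sumr_ge0 => b _; apply: sphere_ge0.
have -> : - (f v * \sum_(n < L.+1) sphere f s n x v) + f v * ball L.+1 x
    = f v * ((x == 1%g)%:R + \sum_(n < L.+1) D n).
  by rewrite sumrB /ball; ring.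
case: L {E} => [|L].
  rewrite big_ord0 mulr_ge0 ?(ltW (f_gt0 _)) // addr_ge0 ?ler0n // big_ord1; exact: D0.
rewrite big_ord_recl [sphere _ _ ord0 _ _]/= s_inv f_inv.
have -> : ((s v)^-1 * x == (s v)^-1)%g = (x == 1)%g.
  by rewrite -[LHS](inj_eq (mulgI (s v))) mulVKg mulgV.
under eq_bigr do rewrite lift0 sphere_back.
have -> : (if x == 1%g then f v else 0) = f v * (x == 1%g)%:R.
  by case: eqP; rewrite ?mulr1 ?mulr0.
rewrite -mulr_sumr -mulrDr ler_pM2l // lerD2l.
by rewrite [leRHS]big_ord_recr /= [in leRHS]big_ord_recr /= -addrA lerDl addr_ge0.
Qed.

(** This computation dictates the choice of [step] and c: [step v * ((f v)^-1 - f v) = c^-1] and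
    [\sum_v step v * f v = 1 - c^-1], so the two terms of [ball_translate] add up to the ball minus
    [c^-1] times the delta function at 1. *)
Let ball_superharmonic L x : \sum_v step v * ball L ((s v)^-1 * x)%g <= ball L.+1 x.
Proof.
apply: (@le_trans _ _ (\sum_v (c^-1 * (\sum_(n < L.+1) sphere f s n x v)
   + step v * f v * ball L.+1 x))).
  apply: ler_sum => v _; apply: (le_trans (ler_wpM2l (ltW (step_gt0 v)) (ball_translate
    L v x))).
  rewrite mulrDr !mulrA lerD2r le_eqVlt; apply/orP; left; apply/eqP; congr (_ * _).
  by rewrite /step; field; rewrite !gt_eqF.
rewrite big_split /= -mulr_sumr -mulr_suml exchange_big /=.
have -> : \sum_v step v * f v = 1 - c^-1.
  have -> : \sum_v step v * f v = c^-1 * (c - 1).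
    have -> : c - 1 = \sum_a f a ^+ 2 / (1 - f a ^+ 2) by rewrite /c addrAC subrr add0r.
    by rewrite mulr_sumr; apply: eq_bigr => v _; rewrite /step; field; rewrite !gt_eqF.
  by rewrite mulrBr mulVf ?gt_eqF // mulr1.
rewrite mulrBl mul1r addrCA gerDl /ball mulrDr opprD addrCA subrr addr0.
by rewrite oppr_le0 mulr_ge0 ?ler0n // invr_ge0 ltW.
Qed.

Let ball_ge0 L x : 0 <= ball L x.
Proof.
rewrite addr_ge0 ?ler0n //; apply: sumr_ge0 => n _; apply: sumr_ge0 => a _.
exact: sphere_ge0.
Qed.

Let ball_step L v x : step v * ball L ((s v)^-1 * x)%g <= ball L.+1 x.
Proof.
apply: le_trans (ball_superharmonic L x); rewrite (bigD1 v) //= lerDl.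
by apply: sumr_ge0 => b _; apply: mulr_ge0; [exact: ltW|exact: ball_ge0].
Qed.

Let ball_nd x : nondecreasing_seq (ball ^~ x).
Proof.
apply/nondecreasing_seqP => L; rewrite /ball lerD2l big_ord_recr /= lerDl.
by apply: sumr_ge0 => a _; apply: sphere_ge0.
Qed.

Lemma sphere_sum_unbounded : 1 < \sum_a f a / (1 + f a) -> amenable R G ->
  forall B, exists L, B < \sum_(n < L) \sum_a sphere f s n 1%g a.
Proof.
move=> f1 amG B; apply: contrapT => nB.
(* [ball_step] acts as a Harnack inequality: a bound at 1 spreads along the generators to every x,
   and so does positivity below. *)
have bnd x : exists C, forall L, ball L x <= C.
  elim/s_gen: x => [|a x [C HC]].
    exists (1 + B) => L; rewrite /ball eqxx lerD2l leNgt; apply/negP => H.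
    by apply: nB; exists L.
  exists ((step (invl a))^-1 * C) => L.
  have := ball_step L (invl a) x; rewrite s_inv invgK => /le_trans/(_ (HC _)).
  by rewrite -ler_pdivlMl.
have cv x : cvgn (ball ^~ x).
  apply: nondecreasing_is_cvgn; first exact: ball_nd.
  by have [C HC] := bnd x; exists C => _ [L _ <-].
pose u x := limn (ball ^~ x).
have bu L x : ball L x <= u x by apply: nondecreasing_cvgn_le; [exact: ball_nd|exact: cv].
have u0 x : 0 < u x.
  suff [L HL] : exists L, 0 < ball L x by apply: lt_le_trans (bu L x).
  elim/s_gen: x => [|a x [L HL]]; first by exists 0%N; rewrite /ball big_ord0 addr0 eqxx.
  exists L.+1; apply: lt_le_trans (ball_step L a _); rewrite mulKg.
  exact: mulr_gt0.
have su x : \sum_v step v * u ((s v)^-1 * x)%g <= u x.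
  have cvs : (fun L => \sum_v step v * ball L ((s v)^-1 * x)%g) @ \oo --> \sum_v step v
    * u ((s v)^-1 * x)%g.
    apply: cvg_big => [|v _]; first exact: add_continuous.
    by apply: cvgMl_tmp; apply: cv.
  rewrite -(cvg_lim _ cvs) //; apply: limr_le; first by apply/cvg_ex; exists (\sum_v
    step v * u ((s v)^-1 * x)%g).
  by apply: nearW => L; apply: le_trans (ball_superharmonic L x) (bu _ _).
have step_inv a : step (invl a) = step a by rewrite /step f_inv.
have := amenable_superharmonic s_inv step_gt0 step_inv u0 su amG.
apply/negP; rewrite -ltNge.
have -> : \sum_a step a = c^-1 * (\sum_a f a / (1 - f a ^+ 2)).
  by rewrite mulr_sumr; apply: eq_bigr => a _; rewrite /step; field; rewrite !gt_eqF.
(* [f / (1 - f^2) - f^2 / (1 - f^2) = f / (1 + f)], so total mass above 1 is exactly the hypothesis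
   on the critical sum. *)
rewrite -ltr_pdivrMl ?invr_gt0 // invrK mulr1 /c -ltrBrDr -sumrB.
congr (_ < _) : f1; apply: eq_bigr => a _.
have := f_gt0 a; have := f2_gt0 a.
move: (f a) => y y2 y0; field.
by rewrite !gt_eqF // addr_gt0.
Qed.

End SphereGreen.

(** * Words *)

Arguments reduced : simpl never.

Section Words.
Variable d : nat.
Implicit Types (u v w : seq (letter d)) (a b : letter d).

Fixpoint words n : seq (seq (letter d)) :=
  if n is m.+1 then [seq a :: w | a <- index_enum (letter d), w <- words m] else [::
    [::]].

Lemma mem_words n w : (w \in words n) = (size w == n).
Proof.
elim: n w => [|n IH] [|a w] //=; first by apply/negbTE/negP => /allpairsP[[b u] []].
rewrite eqSS -IH; apply/allpairsP/idP => [[[b u] [_ uw [_ ->]]] //|wn].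
by exists (a, w); rewrite mem_index_enum.
Qed.

Lemma uniq_words n : uniq (words n).
Proof.
elim: n => //= n IH; apply: allpairs_uniq => //; first exact: index_enum_uniq.
by move=> [a u] [b w] _ _ /= [-> ->].
Qed.

Lemma big_words_cons (R : nmodType) n (P : pred (seq (letter d))) (F : seq (letter d)
  -> R) :
  \sum_(w <- words n.+1 | P w) F w =
  \sum_a \sum_(w <- words n | P (a :: w)) F (a :: w).
Proof.
by rewrite big_mkcond big_allpairs_dep; apply: eq_bigr => a _; rewrite -big_mkcond.
Qed.

Lemma big_words_cat (R : nmodType) m n (P : pred (seq (letter d))) (F : seq (letter d)
  -> R) :
  \sum_(w <- words (m + n) | P w) F w =
  \sum_(u <- words m) \sum_(v <- words n | P (u ++ v)) F (u ++ v).
Proof.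
elim: m P F => [|m IH] P F; first by rewrite big_seq1.
rewrite addSn !big_words_cons; apply: eq_bigr => a _.
by rewrite IH.
Qed.

Lemma invl_neq a b : (a != invl b) = (b != invl a).
Proof. by rewrite -(inj_eq (can_inj (@invlK d))) invlK eq_sym. Qed.

Lemma reduced_cons a w : reduced (a :: w) = (if w is b :: _ then a != invl b else true)
  && reduced w.
Proof. by rewrite /reduced; case: w. Qed.

Lemma reduced_cat u w a b : u != [::] -> w != [::] ->
  reduced (u ++ w) = [&& reduced u, reduced w & last a u != invl (head b w)].
Proof.
case: u => // e u _; case: w => // g w _.
by rewrite /reduced /= cat_path /= [X in _ && X]andbC.
Qed.

Definition wordg w : free_group d := (\big[*%g/1]_(a <- w) gen a)%g.

Lemma wordg_cons a w : wordg (a :: w) = (gen a * wordg w)%g.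
Proof. by rewrite /wordg big_cons. Qed.

Lemma wordg_cat u w : wordg (u ++ w) = (wordg u * wordg w)%g.
Proof. by rewrite /wordg big_cat. Qed.

Lemma wordgE w : reduced w -> word_of (wordg w) = w.
Proof.
elim: w => [|a w IH]; first by rewrite /wordg big_nil.
rewrite reduced_cons wordg_cons => /andP[aw rw] /=; rewrite IH //.
by case: w aw {rw IH} => //= b w /negbTE ->.
Qed.

Lemma wordg_word (g : free_group d) : wordg g = g.
Proof. by apply: val_inj; apply: wordgE; apply: word_ofP. Qed.

Lemma wordg_inv w : wordg (inv_word w) = ((wordg w)^-1)%g.
Proof.
elim: w => [|a w IH]; first by rewrite /wordg !big_nil invg1.
rewrite /inv_word /= rev_cons -cats1 wordg_cat -/(inv_word w) IH [wordg (a ::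
  w)]wordg_cons.
by rewrite invgM wordg_cons /wordg big_nil mulg1 gen_invl.
Qed.

Lemma free_group_ind (P : free_group d -> Prop) :
  P 1%g -> (forall a x, P x -> P (gen a * x)%g) -> forall x, P x.
Proof.
move=> P1 PM x; rewrite -(wordg_word x); elim: (word_of x) => [|a w IH].
  by rewrite /wordg big_nil.
by rewrite wordg_cons; apply: PM.
Qed.

End Words.

Section QuotientWords.
Variables (d : nat) (N : set (free_group d)) (hN : normal_subgroup N).

Definition qgen a : quotient_group hN := proj hN (gen a).

Lemma proj1g : proj hN 1%g = 1%g. Proof. by []. Qed.

Lemma projM x y : proj hN (x * y)%g = (proj hN x * proj hN y)%g.
Proof. exact: proj_mul. Qed.

Lemma projV x : proj hN (x^-1)%g = ((proj hN x)^-1)%g.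
Proof. by apply: (mulgI (proj hN x)); rewrite -projM !mulgV. Qed.

Lemma proj_eq1 x : proj hN x = 1%g <-> N x.
Proof.
rewrite -proj1g; split=> [/esym/projP|Nx]; first by rewrite invg1 mul1g.
by apply/esym/projP; rewrite invg1 mul1g.
Qed.

Lemma qgen_inv a : qgen (invl a) = ((qgen a)^-1)%g.
Proof. by rewrite /qgen gen_invl projV. Qed.

Lemma qgen_ind (P : quotient_group hN -> Prop) :
  P 1%g -> (forall a x, P x -> P (qgen a * x)%g) -> forall x, P x.
Proof.
move=> P1 PM x; rewrite -(proj_repr x).
elim/free_group_ind: (repr x) => [|a g Pg]; first exact: P1.
by rewrite projM; apply: PM.
Qed.

Lemma rcoset_proj g x :
  [set (h * g)%g | h in N] x <-> proj hN x = proj hN g.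
Proof.
split=> [[h Nh <-]|xg].
  by rewrite projM (_ : proj hN h = 1%g) ?mul1g //; apply/proj_eq1.
exists (x * g^-1)%g; last by rewrite mulgVK.
by apply/proj_eq1; rewrite projM projV xg mulgV.
Qed.

Lemma sphere_words (R : realType) (f : letter d -> R) n x a :
  sphere f qgen n x a =
  \sum_(w <- words d n | reduced (a :: w) && (proj hN (wordg (a :: w)) == x))
    \prod_(v <- a :: w) f v.
Proof.
elim: n x a => [|n IH] x a.
  rewrite /= big_mkcond big_seq1 /= big_seq1 eq_sym.
  by rewrite wordg_cons /wordg big_nil mulg1.
rewrite big_words_cons /= big_mkcond /= mulr_sumr; apply: eq_bigr => b _.
rewrite invl_neq; case: ifP => ab; last first.
  by rewrite mulr0 big1 // => w; rewrite reduced_cons /= ab.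
rewrite IH mulr_sumr; apply: eq_big => [w|w _]; last by rewrite [RHS]big_cons.
rewrite [in RHS]reduced_cons /= ab [in RHS]wordg_cons projM.
by congr (_ && _); rewrite -(inj_eq (mulgI (qgen a))) mulVKg.
Qed.

Lemma sum_sphere_words (R : realType) (f : letter d -> R) n x :
  \sum_a sphere f qgen n x a =
  \sum_(w <- words d n.+1 | reduced w && (proj hN (wordg w) == x)) \prod_(v <- w) f v.
Proof. by rewrite big_words_cons; apply: eq_bigr => a _; apply: sphere_words. Qed.

End QuotientWords.

(** * Prefix codes of words *)

Definition wt (R : realType) (d : nat) (f : letter d -> R) (w : seq (letter d)) : R :=
  \prod_(v <- w) f v.

(* Concatenations of elements of W are again reduced words of elements of N. *)
Record prefix_code (d : nat) (N : set (free_group d)) (y : letter d)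
    (W : seq (seq (letter d))) : Prop := PrefixCode {
  code_uniq : uniq W;
  code_prefix : forall w w', w \in W -> w' \in W -> seq.prefix w w' -> w = w';
  code_reduced : forall w, w \in W -> reduced w;
  code_mem : forall w, w \in W -> N (wordg w);
  code_head : forall w, w \in W -> exists u, w = y :: u;
  code_last : forall w, w \in W -> y != invl (last y w) }.

Section Codes.
Variables (R : realType) (d : nat) (N : set (free_group d)).
Hypothesis hd : (2 <= d)%N.
Hypothesis hN : normal_subgroup N.
Implicit Types (f : letter d -> R) (u v w t : seq (letter d)).

Lemma wt_cons f a w : wt f (a :: w) = f a * wt f w.
Proof. exact: big_cons. Qed.

Lemma wt_cat f u w : wt f (u ++ w) = wt f u * wt f w.
Proof. exact: big_cat. Qed.

Lemma wt_gt0 f w : (forall a, 0 < f a) -> 0 < wt f w.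
Proof. by move=> f0; apply: prodr_gt0. Qed.

Lemma wt_inv f w : (forall a, f (invl a) = f a) -> wt f (inv_word w) = wt f w.
Proof.
move=> fV; rewrite /wt /inv_word (perm_big (map (@invl d) w)); last by rewrite perm_rev.
by rewrite big_map; apply: eq_bigr.
Qed.

(** Three letters are excluded out of at least four: c, the inverse of the first letter of t, and
    its last letter. The result starts with x and ends with [invl x], so it fits between a word
    ending in [invl c] and a word starting with c, whose direct concatenation would cancel. *)
Lemma conj_word t c : t != [::] -> reduced t -> N (wordg t) ->
  exists x, [/\ x != c, reduced (x :: t ++ [:: invl x]) & N (wordg (x :: t ++ [:: invl
    x]))].
Proof.
case: t => // p t _ rt Nt.
have [x] := ex_letter (s := [:: c; invl p; last p t]) ltac:(by rewrite /=; lia).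
rewrite !inE !negb_or => /and3P[xc xp xq].
exists x; split=> //.
  rewrite reduced_cons /= xp /= -cat_cons (reduced_cat x x) // rt /= /reduced /=.
  by rewrite invlK eq_sym.
rewrite wordg_cons wordg_cat (_ : wordg [:: invl x] = ((gen x)^-1)%g).
  by have := normalJ hN ((gen x)^-1)%g Nt; rewrite /conjg invgK.
by rewrite wordg_cons /wordg big_nil mulg1 gen_invl.
Qed.

Lemma long_conj_word k t : t != [::] -> reduced t -> N (wordg t) ->
  exists x u, [/\ (k <= size u)%N, reduced (x :: u ++ [:: invl x]) & N (wordg (x :: u
    ++ [:: invl x]))].
Proof.
move=> t0 rt Nt; elim: k => [|k [x [u [ku ru Nu]]]].
  have c : letter d := (Ordinal (ltnW hd), false).
  by have [x [_ rx Nx]] := conj_word c t0 rt Nt; exists x, t.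
have [x' [_ rx' Nx']] := conj_word x (isT : x :: u ++ [:: invl x] != [::]) ru Nu.
exists x', (x :: u ++ [:: invl x]); split=> //.
by rewrite /= size_cat /=; lia.
Qed.

(** Words of equal length are prefix-free. Fixing their first and last letters makes one connecting
    word [link] serve all of them; it is empty unless these letters cancel. *)
Lemma prefix_code_of_unbounded f t : (forall a, 0 < f a < 1) ->
  t != [::] -> reduced t -> N (wordg t) ->
  (forall M, exists n, M < \sum_(w <- words d n | reduced w && `[< N (wordg w) >]) wt f
    w) ->
  exists y W, prefix_code N y W /\ 1 < \sum_(w <- W) wt f w.
Proof.
move=> f_itv t0 rt Nt unb.
have f0 a : 0 < f a by have /andP[] := f_itv a.
have /choice[x xP] := fun a => conj_word a t0 rt Nt.
pose link a b := if b == invl a then x a :: t ++ [:: invl (x a)] else [::].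
have link0 a b : 0 < wt f (link a b) by apply: wt_gt0.
pose y0 : letter d := (Ordinal (ltnW hd), false).
(* By pigeonhole some pair (a, b) has a class of weight above the reciprocal of the weight of its
   link. The summand 1 rules out length 0. *)
pose M := 1 + \sum_(ab : letter d * letter d) (wt f (link ab.1 ab.2))^-1.
have [n] := unb M.
have M1 : 1 <= M by rewrite lerDl; apply: sumr_ge0 => ab _; rewrite invr_ge0 ltW.
have n0 : n != 0%N -> \sum_(w <- words d n | reduced w && `[< N (wordg w) >]) wt f w =
  \sum_(ab : letter d * letter d) \sum_(w <- words d n | (reduced w && `[< N (wordg w)
    >]) && ((head y0 w, last y0 w) == ab)) wt f w.
  move=> _; exact: (partition_big _ xpredT).
case: n n0 => [_|n /(_ isT) ->].
  by rewrite big_mkcond big_seq1; case: ifP => _; rewrite /wt ?big_nil; lra.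
move=> H; have [[a b] ab] : exists ab : letter d * letter d, (wt f (link ab.1 ab.2))^-1 <
    \sum_(w <- words d n.+1 | (reduced w && `[< N (wordg w) >]) && ((head y0 w, last y0
      w) == ab)) wt f w.
  apply: contrapT => H'; move: H; apply/negP; rewrite -leNgt.
  apply: (@le_trans _ _ (\sum_(ab : letter d * letter d) (wt f (link ab.1 ab.2))^-1));
    last by rewrite lerDr.
  by apply: ler_sum => ab _; rewrite leNgt; apply/negP => H1; apply: H'; exists ab.
move=> {H}.
pose S := [seq w <- words d n.+1 | (reduced w && `[< N (wordg w) >]) && ((head y0 w,
  last y0 w) == (a, b))].
have SP w : w \in S -> [/\ size w = n.+1, reduced w, N (wordg w), exists u, w = a :: u
  & last a w = b].
  rewrite mem_filter mem_words => /andP[/andP[/andP[rw /asboolP Nw] /eqP [hw lw]] /eqP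
    sw].
  by split=> //; move: sw hw lw; case: w {rw Nw} => //= c u _ -> // ; exists u.
have linkP : a != invl b -> link a b = [::].
  by rewrite /link invl_neq => /negbTE ->.
have [xa rx Nx] := xP a.
have size_eq w w' : w \in S -> w' \in S -> seq.prefix (w ++ link a b) (w' ++ link a b)
  -> w = w'.
  move=> /SP[sw _ _ _ _] /SP[sw' _ _ _ _] /prefixP[z].
  rewrite -!catA => E; apply/eqP; move/eqP: E; rewrite eqseq_cat ?sw ?sw' //.
  by case/andP => /eqP ->.
exists a, [seq w ++ link a b | w <- S]; split; last first.
  rewrite big_map; under eq_bigr do rewrite wt_cat.
  by rewrite -mulr_suml big_filter -ltr_pdivrMr // mul1r.
split.
- rewrite map_inj_in_uniq ?filter_uniq ?uniq_words // => w w' ws ws' E.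
  by apply: size_eq => //; rewrite E prefix_refl.
- by move=> _ _ /mapP[w ws ->] /mapP[w' ws' ->] /size_eq -> .
- move=> _ /mapP[w /SP[sw rw Nw [u wu] lw] ->].
  have [E|ba] := eqVneq b (invl a); last by rewrite linkP ?cats0 // invl_neq.
  rewrite (reduced_cat a a) ?rw; [|by rewrite wu|by rewrite /link E eqxx].
  rewrite lw /link E eqxx rx /= (inj_eq (can_inj (@invlK d))).
  by rewrite eq_sym.
- move=> _ /mapP[w /SP[sw rw Nw [u wu] lw] ->].
  rewrite wordg_cat; apply: (normalM hN) => //.
  rewrite /link; case: ifP => // _; rewrite /wordg big_nil; exact: normal1 hN.
- by move=> _ /mapP[w /SP[sw rw Nw [u wu] lw] ->]; exists (u ++ link a b); rewrite wu.
- move=> _ /mapP[w /SP[sw rw Nw [u wu] lw] ->]; rewrite last_cat lw /link.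
  case: ifP => [_|/negbT]; last by rewrite /= invl_neq.
  by rewrite /= last_cat /= invlK eq_sym.
Qed.

End Codes.

(** * First occurrences of a fixed word *)

Section FirstOccurrence.
Variables (R : realType) (d : nat) (f : letter d -> R).
Hypothesis hd : (2 <= d)%N.
Hypothesis f_itv : forall a, 0 < f a < 1.
Hypothesis f_inv : forall a, f (invl a) = f a.
Hypothesis f_crit : \sum_a f a / (1 + f a) = 1.
Variables (y : letter d) (h : seq (letter d)).
Hypothesis h_red : reduced h.
Hypothesis h_size : (1 < size h)%N.
Implicit Types u v w : seq (letter d).

Let f0 a : 0 < f a. Proof. by have /andP[] := f_itv a. Qed.
Let f10 a : 0 < 1 + f a. Proof. by rewrite addr_gt0. Qed.

(* The mass of the cylinder of u under the conformal measure on the boundary. *)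
Let nu u : R := wt f u / (1 + f (last y u)).
Let good u := (head y u == y) && reduced u.

Let nu_gt0 u : 0 < nu u. Proof. by rewrite divr_gt0 // wt_gt0. Qed.
Let nu_le u : nu u <= wt f u.
Proof. by rewrite ler_pdivrMr // ler_peMr ?lerDl ?ltW // wt_gt0. Qed.

Let sum_crit_neq a : \sum_(b | b != invl a) f b / (1 + f b) = (1 + f a)^-1.
Proof.
have := f_crit; rewrite (bigD1 (invl a)) //= f_inv => /(canRL (addKr _)) ->.
by field; rewrite gt_eqF.
Qed.

Let nu_cat1 u : u != [::] -> reduced u ->
  \sum_(b | reduced (rcons u b)) nu (rcons u b) = nu u.
Proof.
move=> u0 ru; rewrite /nu -sum_crit_neq mulr_sumr; apply: eq_big => [b|b _].
  by rewrite -cats1 (reduced_cat y y) // ru /= invl_neq.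
by rewrite -cats1 wt_cat /wt big_seq1 last_cat mulrA.
Qed.

Let nu_cat n u : u != [::] -> reduced u ->
  \sum_(z <- words d n | reduced (u ++ z)) nu (u ++ z) = nu u.
Proof.
elim: n u => [|n IH] u u0 ru; first by rewrite big_mkcond big_seq1 cats0 ru.
rewrite big_words_cons -[RHS]nu_cat1 // [RHS]big_mkcond; apply: eq_bigr => b _.
under eq_bigl do rewrite -cat_rcons.
under eq_bigr do rewrite -cat_rcons.
case: ifP => [rb|/negbT rb]; first by rewrite IH // -cats1; case: (u).
rewrite big1 // => z; rewrite cat_rcons -cat1s catA cats1.
case: z => [|c z]; first by rewrite cats0 (negbTE rb).
by rewrite (reduced_cat y y) // -?cats1 ?(negbTE rb) //; [rewrite cats1 (negbTE
  rb)|case: (u)].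
Qed.

Definition first_occurrence u :=
  [&& head y u == y, reduced u, infix h u & ~~ infix h (take (size u).-1 u)].

Let av n := \sum_(u <- words d n | good u && ~~ infix h u) nu u.

Let good_cat u z : u != [::] -> good (u ++ z) = (head y u == y) && reduced (u ++ z).
Proof. by case: u. Qed.

Let av_ext n k : (0 < n)%N ->
  \sum_(w <- words d (n + k) | good w && ~~ infix h (take n w)) nu w = av n.
Proof.
move=> n0; rewrite big_words_cat /av [RHS]big_mkcond big_seq [RHS]big_seq.
apply: eq_bigr => u; rewrite mem_words => /eqP su.
have u0 : u != [::] by rewrite -size_eq0 su -lt0n.
under eq_bigl do rewrite take_size_cat // good_cat // andbAC.
rewrite /good andbAC; case: ifP => [/andP[/andP[-> ->] ru]|/negbT nu'] /=; first exact:
  nu_cat.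
rewrite big1 // => z /andP[/andP[yu hu] ruz]; move: nu'; rewrite yu hu /=.
move: ruz; case: z => [|c z]; first by rewrite cats0 => ->.
by rewrite (reduced_cat y y) // => /and3P[->].
Qed.

Let L := (size h).+1.
(** Any u can be continued by a letter e compatible with both sides and then by h, hence the block
    length [size h] + 1. This continuation has conditional mass at least k; the factor 1/2 absorbs
    the denominator [1 + f _] of nu and keeps k below 1. *)
Let kappa_ex : exists2 k : R, 0 < k < 1 & forall n, (0 < n)%N -> av (n + L) <= (1 - k)
  * av n.
Proof.
pose m := \big[Num.min/1]_a f a.
have m0 : 0 < m.
  by rewrite /m; elim/big_ind: _ => //; first by move=> *; rewrite lt_min; apply/andP.
have mf a : m <= f a by rewrite /m (bigD1 a) //= ge_min lexx.
pose k := m * wt f h / 2.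
have h1 : wt f h <= 1.
  by rewrite /wt; apply: prodr_ile1 => a _; have /andP[/ltW -> /ltW ->] := f_itv a.
have m1 : m <= 1 by have := mf y; have /andP[_] := f_itv y; lra.
have h0 : 0 < wt f h by apply: wt_gt0.
have mh1 : m * wt f h <= 1 by rewrite mulr_ile1 // ltW.
have mh0 : 0 < m * wt f h by rewrite mulr_gt0.
exists k; first by rewrite /k; apply/andP; split; lra.
move=> n n0.
pose H := \sum_(u <- words d (n + L) | (good u && ~~ infix h (take n u)) && infix h u)
  nu u.
have E : av n = H + av (n + L).
  rewrite -(av_ext L n0) (bigID (infix h)) /= /av -/H; congr (_ + _).
  apply: eq_bigl => u; case: (boolP (infix h u)) => hu; first by rewrite !andbF.
  rewrite !andbT; case: (good u) => //=; apply/negP => /infix_prefix_trans H'.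
  by move/negP: hu; apply; apply: H'; rewrite -{2}(cat_take_drop n u) prefix_prefix.
suff : k * av n <= H by rewrite mulrBl mul1r; lra.
rewrite /H big_words_cat /av [X in k * X]big_mkcond mulr_sumr big_seq [leRHS]big_seq.
apply: ler_sum => u; rewrite mem_words => /eqP su.
have u0 : u != [::] by rewrite -size_eq0 su -lt0n.
case: ifP => [/andP[/andP[yu ru] hu]|_]; last first.
  by rewrite mulr0; apply: sumr_ge0 => z _; apply: ltW.
have [e] := ex_letter (s := [:: invl (last y u); invl (head y h)]) ltac:(by rewrite /=;
  lia).
rewrite !inE negb_or => /andP[eu eh].
have hn : h != [::] by case: (h) h_size.
have reh : reduced (e :: h) by rewrite reduced_cons h_red andbT; case: (h) eh hn.
have ruh : reduced (u ++ e :: h) by rewrite (reduced_cat y y) // ru reh /= invl_neq.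
rewrite big_mkcond (bigD1_seq (e :: h)) ?uniq_words ?mem_words /L //=.
rewrite take_size_cat // hu /good ruh infix_catl ?infix_cons //.
have -> : head y (u ++ e :: h) == y by case: (u) yu u0.
rewrite /= -[leLHS]addr0; apply: lerD; last first.
  by apply: sumr_ge0 => z _; case: ifP => // _; apply: ltW.
have wu : 0 < wt f u by apply: wt_gt0.
apply: (@le_trans _ _ (k * wt f u)); first by rewrite ler_pM2l // /k divr_gt0.
rewrite /nu wt_cat wt_cons last_cat /= ler_pdivlMr // /k.
have l2 : 1 + f (last e h) <= 2 by have /andP[_] := f_itv (last e h); lra.
apply: (@le_trans _ _ (m * wt f h / 2 * wt f u * 2)).
  by rewrite ler_pM2l // mulr_gt0 // divr_gt0.
rewrite (_ : _ * 2 = wt f u * (m * wt f h)); last by field.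
by rewrite ler_pM2l // ler_pM2r.
Qed.

Let av1_gt0 : nu [:: y] <= av 1.
Proof.
have hy : infix h [:: y] = false by apply/negP => /size_infix; rewrite leqNgt h_size.
have gy : good [:: y] && ~~ infix h [:: y] by rewrite hy /good /= eqxx.
rewrite /av big_mkcond (bigD1_seq [:: y]) ?uniq_words ?mem_words // gy.
rewrite lerDl; apply: sumr_ge0 => z _; case: ifP => // _; exact: ltW.
Qed.

Let av_small e : 0 < e -> exists n, av n.+1 <= e.
Proof.
move=> e0; have [k /andP[k0 k1] kP] := kappa_ex.
have le j : av (j * L + 1) <= (1 - k) ^+ j * av 1.
  elim: j => [|j IH]; first by rewrite expr0 mul1r.
  have -> : (j.+1 * L + 1 = (j * L + 1) + L)%N by rewrite mulSn; lia.
  apply: (le_trans (kP _ _)); first by rewrite addn1.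
  by rewrite exprS -mulrA ler_pM2l // subr_gt0.
have cv : (fun j => (1 - k) ^+ j * av 1) @ \oo --> 0 * av 1.
  by apply: cvgMr_tmp; apply: cvg_expr; rewrite ger0_norm; lra.
rewrite mul0r in cv.
have /cvgr0Pnorm_le/(_ e e0)[j _ /(_ j (leqnn _))] := cv.
rewrite /= => H; exists (j * L)%N; rewrite -addn1; apply: le_trans (le j) _.
exact: le_trans (ler_norm _) H.
Qed.

Let hits_sum n : exists U : seq (seq (letter d)), [/\ uniq U,
  forall u, u \in U -> first_occurrence u /\ (size u <= n.+1)%N &
  \sum_(u <- U) nu u = av 1 - av n.+1].
Proof.
elim: n => [|n [U [uU UP US]]]; first by exists [::]; rewrite big_nil subrr.
pose P u := (good u && ~~ infix h (take n.+1 u)) && infix h u.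
exists (U ++ [seq u <- words d n.+2 | P u]); split.
- rewrite cat_uniq uU filter_uniq ?uniq_words // andbT.
  apply/hasPn => u; rewrite mem_filter mem_words => /andP[_ /eqP su].
  by apply/negP => /UP[_]; rewrite su ltnn.
- move=> u; rewrite mem_cat => /orP[/UP[? /leqW ?] //|].
  rewrite mem_filter mem_words => /andP[/andP[/andP[/andP[yu ru] hu] hu'] /eqP su].
  by rewrite /first_occurrence yu ru hu' su hu.
rewrite big_cat US big_filter /=.
have := av_ext 1 (ltn0Sn n); rewrite addn1 (bigID (infix h)) /= => <-.
rewrite (_ : av n.+2 = \sum_(u <- words d n.+2 | (good u && ~~ infix h (take n.+1 u))
  && ~~ infix h u) nu u); first by rewrite /P; ring.
apply: eq_bigl => u; case: (boolP (infix h u)) => hu; first by rewrite !andbF.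
rewrite !andbT; case: (good u) => //=; apply/esym/negP => /infix_prefix_trans H'.
by move/negP: hu; apply; apply: H'; rewrite -{2}(cat_take_drop n.+1 u) prefix_prefix.
Qed.

(** The mass avoiding h tends to 0, so half of the mass [f y / (1 + f y)] of the cylinder of y can
    be collected at finitely many first occurrences; this mass is at least [f y / 2]. *)
Lemma first_occurrences : exists U, [/\ uniq U,
  forall u, u \in U -> first_occurrence u &
  f y / 4 <= \sum_(u <- U) wt f u].
Proof.
have ny : 0 < nu [:: y] / 2 by rewrite divr_gt0.
have [n Hn] := av_small ny; have [U [uU UP US]] := hits_sum n.
exists U; split=> // [u /UP[]//|].
apply: (@le_trans _ _ (\sum_(u <- U) nu u)); last by apply: ler_sum.
rewrite US; apply: (@le_trans _ _ (nu [:: y] / 2)); last by have := av1_gt0; lra.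
rewrite /nu /wt big_seq1 /= -mulrA -invfM ler_pM2l // lef_pV2 ?posrE ?mulr_gt0 //.
have /andP[_] := f_itv y; lra.
Qed.

End FirstOccurrence.

Lemma inv_word_cat (d : nat) (u w : seq (letter d)) :
  inv_word (u ++ w) = inv_word w ++ inv_word u.
Proof. by rewrite /inv_word map_cat rev_cat. Qed.

(* The code consists of the words g h g^-1 t for a fixed connecting word t,
   where h is long and g h contains h only at its end. *)
Lemma prefix_code_of_critical (R : realType) (d : nat) (N : set (free_group d))
    (f : letter d -> R) (t : seq (letter d)) :
  (2 <= d)%N -> normal_subgroup N ->
  (forall a, 0 < f a < 1) -> (forall a, f (invl a) = f a) ->
  \sum_a f a ^+ 2 / (1 + f a ^+ 2) = 1 ->
  t != [::] -> reduced t -> N (wordg t) ->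
  exists y W, prefix_code N y W /\ 1 < \sum_(w <- W) wt f w.
Proof.
move=> hd hN f_itv f_inv f_crit t0 rt Nt.
have f0 a : 0 < f a by have /andP[] := f_itv a.
have f2_itv a : 0 < f a ^+ 2 < 1.
  by have /andP[? ?] := f_itv a; rewrite exprn_gt0 // expr_lt1 // ltW.
have f2_inv a : f (invl a) ^+ 2 = f a ^+ 2 by rewrite f_inv.
pose y : letter d := (Ordinal (ltnW hd), false).
have [x [xy rx Nx]] := conj_word hd hN y t0 rt Nt.
set t' := x :: t ++ [:: invl x] in rx Nx.
have wt'0 : 0 < wt f t' by apply: wt_gt0.
pose m := \big[Num.max/0]_a f a.
have fm a : f a <= m by rewrite /m (bigD1 a) //= le_max lexx.
have m0 : 0 < m by apply: lt_le_trans (fm y).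
have m1 : m < 1.
  rewrite /m; elim/big_ind: _ => //; first by move=> *; rewrite gt_max; apply/andP.
  by move=> a _; have /andP[] := f_itv a.
(* The sum over the code will be at least [f y ^+ 2 / 4 * wt f t' / wt f h], and [wt f h <= m ^+ k]
   once h has length at least k. *)
have [k Hk] : exists k, m ^+ k < f y ^+ 2 / 4 * wt f t'.
  have e0 : 0 < f y ^+ 2 / 4 * wt f t' / 2 by rewrite !mulr_gt0 // exprn_gt0.
  have cv : (fun j => m ^+ j) @ \oo --> 0 by apply: cvg_expr; rewrite ger0_norm // ltW.
  have /cvgr0Pnorm_le/(_ _ e0)[j _ /(_ j (leqnn _))] := cv.
  rewrite /= ger0_norm ?exprn_ge0 ?(ltW m0) // => H; exists j.
  by apply: le_lt_trans H _; move: e0; lra.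
have [z [u0 [ku]]] := long_conj_word hd hN k t0 rt Nt.
set h := z :: u0 ++ [:: invl z] => rh Nh.
have sh : (1 < size h)%N by rewrite /h /= size_cat /= addnC.
have wh : wt f h <= m ^+ k.
  apply: (@le_trans _ _ (m ^+ size h)).
    rewrite /wt; elim: (h) => [|a w IH]; first by rewrite big_nil expr0.
    rewrite big_cons exprS; apply: ler_pM => //; first exact: ltW.
    by apply: prodr_ge0 => b _; apply: ltW.
  by rewrite ler_wiXn2l ?(ltW m0) ?(ltW m1) // /h /= size_cat /=; lia.
have wh0 : 0 < wt f h by apply: wt_gt0.
have [U [uU UP US]] := first_occurrences hd f2_itv f2_inv f_crit y rh sh.
pose pre u : seq (letter d) := take (size u - size h) u.
pose code u := u ++ inv_word (pre u) ++ t'.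
have UE u : u \in U -> u = pre u ++ h.
  move=> /UP/and4P[_ _ hu hu'].
  suff /suffixP[g gu] : suffix h u.
    by rewrite /pre {2 3}gu size_cat addnK take_size_cat.
  case/lastP: u hu hu' => [|u b]; first by case: (h) sh.
  by rewrite size_rcons /= -cats1 take_size_cat // cats1 infix_rconsl => /orP[//|->].
have code_inj u u' : u \in U -> u' \in U -> seq.prefix (code u) (code u') -> u = u'.
  (* A shorter v would be a proper prefix of v' and so contain h before the end of v'. *)
  have aux v v' z' : v \in U -> v' \in U -> v ++ z' = code v' -> (size v < size v')%N
    -> False.
    move=> vU v'U E lt; have /UP/and4P[_ _ hv _] := vU; have /UP/and4P[_ _ _ /negP hv']
      := v'U.
    have Ev : v = take (size v) (take (size v').-1 v').
      have lt' : (size v <= (size v').-1)%N by clear -lt; lia.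
      rewrite (take_takel _ lt').
      have := congr1 (take (size v)) E.
      by rewrite take_size_cat // /code takel_cat // ltnW.
    by apply: hv'; apply: infix_prefix_trans hv _; rewrite Ev; apply: prefix_take.
  move=> uU' u'U /prefixP[z' E].
  have := code u'; case: (ltngtP (size u) (size u')) => [lt|lt|eqs] _.
  - exfalso; apply: (aux u u' (inv_word (pre u) ++ t' ++ z') uU' u'U _ lt).
    by rewrite E /code -!catA.
  - exfalso; apply: (aux u' u (drop (size u') (code u)) u'U uU' _ lt).
    have su' : (size u' <= size (code u))%N.
      by rewrite /code size_cat (leq_trans (ltnW lt)) ?leq_addr.
    have E1 : take (size u') (code u') = u' by rewrite /code take_size_cat.
    have E2 : take (size u') (code u ++ z') = take (size u') (code u) by rewrite
      takel_cat.
    by rewrite -[X in X ++ _]E1 E E2 cat_take_drop.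
  - have E1 : take (size u) (code u') = u' by rewrite eqs /code take_size_cat.
    have E2 : take (size u) (code u ++ z') = u by rewrite /code -catA take_size_cat.
    by rewrite -[RHS]E1 E E2.
have Uy u : u \in U -> exists w, u = y :: w.
  move=> uU'; have /UP/and4P[/eqP yu _ hu _] := uU'.
  case: u yu hu {uU'} => [_ /size_infix hs|a w /= -> _]; last by exists w.
  by have := leq_trans sh hs.
(* As h has the form [z u0 z^-1], it begins with the same letter as its inverse; so
   [pre u ++ inv_word h] is reduced and begins with y just as [pre u ++ h] does. *)
have inv_h : exists w, inv_word h = z :: w.
  rewrite /inv_word /h /= map_cat rev_cons rev_cat /=.
  by exists (rcons (rev (map (@invl d) u0)) (invl z)); rewrite invlK.
have inv_tail u : u \in U -> exists w, h ++ inv_word (pre u) = rcons w (invl y).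
  move=> uU'; have [w uw] := Uy u uU'; have := UE u uU'; have [w' hw'] := inv_h.
  have -> : h ++ inv_word (pre u) = inv_word (pre u ++ inv_word h).
    by rewrite inv_word_cat inv_wordK.
  case: (pre u) => [|a g] /=; rewrite uw.
    rewrite hw' /h => -[yz _].
    by exists (inv_word w'); rewrite /inv_word /= rev_cons yz.
  by case=> <- _; exists (inv_word (g ++ inv_word h)); rewrite /inv_word /= rev_cons.
have red_pre u : u \in U -> reduced (pre u ++ h ++ inv_word (pre u)).
  move=> uU'; have /UP/and4P[_ ru _ _] := uU'; rewrite (UE u uU') in ru.
  case E : (pre u) ru => [|a g] ru; first by rewrite /= cats0.
  have r2 : reduced (h ++ inv_word (a :: g)).
    have -> : h ++ inv_word (a :: g) = inv_word ((a :: g) ++ inv_word h).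
      by rewrite inv_word_cat inv_wordK.
    apply: inv_word_reduced; move: ru; have [w' hw'] := inv_h.
    have ih0 : inv_word h != [::] by rewrite hw'.
    rewrite !(reduced_cat y y) // => /and3P[-> _ H].
    by rewrite inv_word_reduced // hw'.
  move: ru; rewrite (reduced_cat y y) // => /and3P[ra _ H].
  by rewrite (reduced_cat y y) // ra r2.
have red_code u : u \in U -> reduced (code u).
  move=> uU'; have [w Ew] := inv_tail u uU'.
  have -> : code u = (pre u ++ rcons w (invl y)) ++ t' by rewrite -Ew /code {1}(UE u
    uU') -!catA.
  rewrite (reduced_cat y y) //; last by rewrite -size_eq0 size_cat size_rcons addnS.
  by rewrite -Ew red_pre // rx last_cat Ew last_rcons /= (inj_eq (can_inj (@invlK d)))
    eq_sym.
exists y, [seq code u | u <- U]; split.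
  split.
  - rewrite map_inj_in_uniq // => u u' uU' u'U E; apply: code_inj => //.
    by rewrite E prefix_refl.
  - by move=> _ _ /mapP[u uU' ->] /mapP[u' u'U ->] /code_inj ->.
  - by move=> _ /mapP[u uU' ->]; apply: red_code.
  - move=> _ /mapP[u uU' ->]; rewrite /code wordg_cat wordg_cat mulgA.
    apply: (normalM hN) => //; rewrite wordg_inv {1}(UE u uU') wordg_cat.
    by have := normalJ hN ((wordg (pre u))^-1)%g Nh; rewrite /conjg invgK mulgA.
  - by move=> _ /mapP[u uU' ->]; have [w uw] := Uy u uU'; rewrite /code {1}uw; eexists;
    reflexivity.
  - move=> _ /mapP[u uU' ->]; rewrite /code !last_cat /t' /= last_cat /=.
    by rewrite invlK eq_sym.
rewrite big_map.
(* With u = g h the weight is f(g)^2 f(h) f(t') = f(u)^2 f(t') / f(h): conjugation counts g twice,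
   which brings in the critical weight f^2. *)
have E u : u \in U -> wt f (code u) = wt (fun a => f a ^+ 2) u * (wt f t' / wt f h).
  move=> uU'; rewrite /code {1}(UE u uU') [X in _ = wt _ X * _](UE u uU') !wt_cat
    wt_inv //.
  have sq w : wt (fun a => f a ^+ 2) w = wt f w ^+ 2 by rewrite /wt prodrXl.
  by rewrite !sq; field; rewrite gt_eqF.
rewrite big_seq (eq_bigr (fun u => wt (fun a => f a ^+ 2) u * (wt f t' / wt f h)));
  last by move=> u; exact: E.
rewrite -big_seq -mulr_suml mulrA ltr_pdivlMr // mul1r.
apply: le_lt_trans wh _; apply: lt_le_trans Hk _.
by rewrite ler_pM2r.
Qed.

(** * Euclidean similarities *)

Section EuclideanSimilarities.
Variables (R : realType) (D : nat).
Implicit Types (x y z : 'rV[R]_D) (f : 'rV[R]_D -> 'rV[R]_D) (A : set 'rV[R]_D).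

Lemma dotpE x y : dotp x y = (x *m y^T) 0 0.
Proof. by rewrite mxE; apply: eq_bigr => i _; rewrite mxE. Qed.

Lemma dotpC x y : dotp x y = dotp y x.
Proof. by apply: eq_bigr => i _; rewrite mulrC. Qed.

Lemma dotpDl x y z : dotp (x + y) z = dotp x z + dotp y z.
Proof. by rewrite !dotpE mulmxDl mxE. Qed.

Lemma dotpZl a x y : dotp (a *: x) y = a * dotp x y.
Proof. by rewrite !dotpE -scalemxAl mxE. Qed.

Lemma dotpBl x y z : dotp (x - y) z = dotp x z - dotp y z.
Proof. by rewrite -scaleN1r dotpDl dotpZl mulN1r. Qed.

Lemma dotpBr x y z : dotp x (y - z) = dotp x y - dotp x z.
Proof. by rewrite dotpC dotpBl !(dotpC x). Qed.

Lemma dotp_ge0 x : 0 <= dotp x x.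
Proof. by apply: sumr_ge0 => i _; rewrite -expr2 sqr_ge0. Qed.

Lemma dotp_eq0 x : dotp x x = 0 -> x = 0.
Proof.
move=> x0; apply/rowP => i; apply/eqP; rewrite mxE -sqrf_eq0 expr2; apply/eqP.
by apply: (psumr_eq0P _ x0) => // j _; rewrite -expr2 sqr_ge0.
Qed.

Lemma enorm_sqr x : enorm x ^+ 2 = dotp x x.
Proof. by rewrite sqr_sqrtr ?dotp_ge0. Qed.

Lemma enorm_ge0 x : 0 <= enorm x.
Proof. exact: sqrtr_ge0. Qed.

Lemma edist_ge0 x y : 0 <= edist x y.
Proof. exact: enorm_ge0. Qed.

Lemma edistxx x : edist x x = 0.
Proof. by rewrite /edist subrr /enorm /dotp big1 ?sqrtr0 // => i _; rewrite mxE mul0r.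
  Qed.

Lemma coord_le_edist x y i : `|x 0 i - y 0 i| <= edist x y.
Proof.
rewrite -(@ler_pXn2r _ 2) ?nnegrE ?edist_ge0 // enorm_sqr real_normK ?num_real //.
rewrite /dotp (bigD1 i) //= !mxE expr2 lerDl.
by apply: sumr_ge0 => j _; rewrite -expr2 sqr_ge0.
Qed.

Lemma edist_le_coord x y (e : R) : 0 <= e ->
  (forall i, `|x 0 i - y 0 i| <= e) -> edist x y <= D%:R * e.
Proof.
move=> e0 xy.
rewrite -(@ler_pXn2r _ 2) ?nnegrE ?edist_ge0 ?mulr_ge0 ?ler0n // enorm_sqr.
apply: (@le_trans _ _ (D%:R * e ^+ 2)).
  apply: (@le_trans _ _ (\sum_(i < D) e ^+ 2)); last by rewrite sumr_const card_ord
    mulr_natl.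
  apply: ler_sum => i _; have := xy i; rewrite !mxE -expr2 -real_normK ?num_real //.
  by move=> H; rewrite ler_pXn2r ?nnegrE.
rewrite exprMn ler_wpM2r ?sqr_ge0 // expr2 -natrM ler_nat.
by case: (D) => // n; rewrite leq_pmulr.
Qed.

Lemma interiorP_edist A x :
  interior A x <-> exists2 e : R, 0 < e & forall y, edist x y < e -> A y.
Proof.
split=> [/nbhs_ballP[e /= e0 eA]|[e e0 eA]].
  exists e => // y xy; apply: eA; split=> // i j; rewrite !ord1.
  by rewrite /ball /= (le_lt_trans (coord_le_edist x y j)).
apply/nbhs_ballP; exists (e / (D.+1)%:R) => /=; first by rewrite divr_gt0.
move=> y xy; apply: eA.
have e1 : 0 < e / D.+1%:R by rewrite divr_gt0.
apply: (@le_lt_trans _ _ (D%:R * (e / D.+1%:R))).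
  by apply: edist_le_coord => [|i]; [exact: ltW|apply: ltW; have [_ /(_ 0 i)] := xy].
by rewrite mulrCA -[ltRHS]mulr1 ltr_pM2l // ltr_pdivrMr // mul1r ltr_nat.
Qed.

Lemma compact_edist_bounded A : compact A ->
  exists2 B : R, 0 < B & forall x y, A x -> A y -> edist x y <= B.
Proof.
move=> /compact_bounded [M [Mr MA]].
have M1 : `|M| + 1 > M by have := ler_norm M; lra.
have M0 : 0 < `|M| + 1 by have := normr_ge0 M; lra.
exists (D%:R * ((`|M| + 1) *+ 2) + 1).
  by rewrite ltr_wpDl // mulr_ge0 ?ler0n // mulrn_wge0 // ltW.
have c x i : A x -> `|x 0 i| <= `|M| + 1.
  move=> Ax; apply: le_trans (MA _ M1 x Ax).
  by rewrite [leRHS]mx_normrE; apply: (le_bigmax _ (fun i : 'I_1 * 'I_D => `|x i.1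
    i.2|) (0, i)).
move=> x y Ax Ay; apply: (@le_trans _ _ (D%:R * ((`|M| + 1) *+ 2))); last by rewrite
  lerDl.
apply: edist_le_coord => [|i]; first by rewrite mulrn_wge0 // ltW.
by apply: le_trans (ler_normB _ _) _; rewrite mulr2n; apply: lerD; apply: c.
Qed.

(* A distance preserving map fixing 0 preserves inner products; hence it is
   linear, and given by an orthogonal matrix. *)
Lemma similarity_surj c f : 0 < c -> similarity c f -> forall y, exists x, f x = y.
Proof.
move=> c0 fs; pose g x := c^-1 *: (f x - f 0).
have gd x y : dotp (g x - g y) (g x - g y) = dotp (x - y) (x - y).
  have -> : g x - g y = c^-1 *: (f x - f y).
    by rewrite /g -scalerBr opprB addrA subrK.
  rewrite dotpZl dotpC dotpZl -!enorm_sqr -[enorm (f x - f y)]/(edist (f x) (f y)) fs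
    /edist.
  by rewrite exprMn; field; rewrite gt_eqF.
have gn x : dotp (g x) (g x) = dotp x x.
  by have := gd x 0; rewrite /g subrr scaler0 !subr0.
have gp x y : dotp (g x) (g y) = dotp x y.
  have := gd x y; rewrite !(dotpBl, dotpBr) !gn (dotpC y x) (dotpC (g y) (g x)); lra.
pose e (i : 'I_D) : 'rV[R]_D := delta_mx 0 i.
have dote x i : dotp x (e i) = x 0 i.
  by rewrite dotpE /e trmx_delta -colE mxE.
pose M : 'M[R]_D := \matrix_(i, j) g (e i) 0 j.
have rM i : row i M = g (e i) by apply/rowP => j; rewrite !mxE.
have MMT : M *m M^T = 1%:M.
  apply/matrixP => i j; rewrite !mxE.
  have -> : \sum_k M i k * M^T k j = dotp (g (e i)) (g (e j)).
    by apply: eq_bigr => k _; rewrite !mxE.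
  by rewrite gp dote /e mxE eqxx /= eq_sym.
have dM x z : dotp (x *m M) z = \sum_i x 0 i * dotp (g (e i)) z.
  rewrite dotpE [x *m M]mulmx_sum_row mulmx_suml summxE; apply: eq_bigr => i _.
  by rewrite rM -scalemxAl mxE -dotpE.
have gM x : g x = x *m M.
  apply/eqP; rewrite -subr_eq0; apply/eqP/dotp_eq0.
  have H1 : dotp (x *m M) (g x) = dotp x x.
    by rewrite dM; apply: eq_bigr => i _; rewrite gp dotpC dote.
  have H2 : dotp (x *m M) (x *m M) = dotp x x.
    by rewrite !dotpE trmx_mul mulmxA -(mulmxA x) MMT mulmx1.
  by rewrite !(dotpBl, dotpBr) gn (dotpC (g x)) H1 H2; ring.
move=> y; exists ((c^-1 *: (y - f 0)) *m M^T).
have := gM ((c^-1 *: (y - f 0)) *m M^T).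
rewrite -mulmxA (mulmx1C MMT) mulmx1 /g => /(scalerI _) H.
by apply: (addIr (- f 0)); apply: H; rewrite invr_eq0 gt_eqF.
Qed.

Lemma similarity_inj c f : 0 < c -> similarity c f -> injective f.
Proof.
move=> c0 fs x y fxy; apply/eqP; rewrite -subr_eq0; apply/eqP/dotp_eq0.
have := fs x y; rewrite fxy edistxx => /esym/eqP; rewrite mulf_eq0 gt_eqF //=.
by rewrite -enorm_sqr => /eqP xy; rewrite -[enorm _]/(edist x y) xy expr0n.
Qed.

(** Surjectivity enters here: every point of a ball around [f x] has to be an image. *)
Lemma similarity_interior c f A B : 0 < c -> similarity c f -> f @` A `<=` B ->
  f @` interior A `<=` interior B.
Proof.
move=> c0 fs AB _ [x /interiorP_edist[e e0 eA] <-].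
apply/interiorP_edist; exists (c * e); first by rewrite mulr_gt0.
move=> y; have [z <-] := similarity_surj c0 fs y.
by rewrite fs ltr_pM2l // => /eA Az; apply: AB; exists z.
Qed.

Lemma similarity_continuous c f : 0 < c -> similarity c f -> continuous f.
Proof.
move=> c0 fs x A /interiorP_edist[e e0 eA].
apply/interiorP_edist; exists (e / c); first by rewrite divr_gt0.
by move=> y xy; apply: eA; rewrite fs mulrC -ltr_pdivlMr.
Qed.

End EuclideanSimilarities.

(** * Self-similar sets *)

Section Kraft.
Variables (R : realType) (I T : finType) (q : I -> R).
Hypothesis q0 : forall i, 0 < q i.
Hypothesis q1 : 1 <= \sum_i q i.
Variable ww : nat -> T -> seq I.
Hypothesis ww_cover : forall xi : nat -> I, exists i k n, ww i k = mkseq xi n.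

Let wq (w : seq I) := \prod_(i <- w) q i.
Let cov (u : seq I) : \bar R :=
  (\esum_(i in [set: nat]) (\sum_k if seq.prefix u (ww i k) then wq (ww i k) else
    0)%:E)%E.

Let wq0 w : 0 < wq w. Proof. exact: prodr_gt0. Qed.

Let term0 u i : 0 <= \sum_k if seq.prefix u (ww i k) then wq (ww i k) else 0.
Proof. by apply: sumr_ge0 => k _; case: ifP => // _; apply: ltW. Qed.

(* If the total weight were smaller than 1 then some sequence could be chosen
   greedily so as to avoid the whole family. *)
Lemma kraft_cover : (1 <= \esum_(i in [set: nat]) (\sum_k wq (ww i k))%:E)%E.
Proof.
have <- : cov [::] = (\esum_(i in [set: nat]) (\sum_k wq (ww i k))%:E)%E.
  by apply: eq_esum => i _; congr EFin; apply: eq_bigr => k _; rewrite prefix0s.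
rewrite leNgt; apply/negP => cov1.
(* Each member of the family extends at most one child of u. So if every child were fully covered, u
   would be too, since the weights of the children add up to at least that of u. *)
have step u : (cov u < (wq u)%:E)%E -> exists a, (cov (rcons u a) < (wq (rcons u
  a))%:E)%E.
  move=> cu; apply: contrapT => H; move: cu; apply/negP; rewrite -leNgt.
  apply: (@le_trans _ _ (\sum_a cov (rcons u a))%E); last first.
    rewrite /cov -esum_sum; last by move=> *; rewrite lee_fin.
    apply: le_esum => i _; rewrite sumEFin lee_fin exchange_big /=.
    apply: ler_sum => k _; case: ifP => [/prefixP[z ->]|/negP uk]; last first.
      rewrite big1 // => a _; case: ifP => // /prefixP[z E].
      by case: uk; rewrite E cat_rcons; apply: prefix_prefix.
    case: z => [|a z].
      rewrite big1 ?ltW // => a _; case: ifP => // /size_prefix.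
      by rewrite size_rcons cats0 ltnn.
    rewrite (bigD1 a) //= big1 ?addr0 ?cat_rcons //; last first.
      move=> b ba; case: ifP => // /prefixP[z' /eqP].
      by rewrite cat_rcons eqseq_cat // eqxx /= eqseq_cons eq_sym (negbTE ba).
    by case: ifP => // _; apply: ltW.
  apply: (@le_trans _ _ (\sum_a (wq (rcons u a))%:E)%E).
    rewrite sumEFin lee_fin /wq; under [leRHS]eq_bigr do rewrite -cats1 big_cat big_seq1.
    by rewrite /= -mulr_sumr; apply: ler_peMr => //; apply: ltW; apply: wq0.
  by apply: lee_sum => a _; rewrite leNgt; apply/negP => h; apply: H; exists a.
have i0 : I.
  by case: (pickP (@predT I)) => // I0; move: q1; rewrite big_pred0 // ler10.
pose next u := if pselect (cov u < (wq u)%:E)%E is left h then sval (cid (step u h))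
  else i0.
pose us := fix us n := if n is m.+1 then rcons (us m) (next (us m)) else [::].
have usP n : (cov (us n) < (wq (us n))%:E)%E.
  elim: n => [|n IH] /=; first by rewrite /wq big_nil.
  by rewrite /next; case: pselect => // h; case: cid.
have usE n : us n = mkseq (fun m => next (us m)) n.
  by elim: n => //= n IH; rewrite mkseqS -IH.
have [i [k [n Hn]]] := ww_cover (fun m => next (us m)).
move: (usP n); apply/negP; rewrite -leNgt.
apply: esum_ge; exists [set i]; first by split.
rewrite fsbig_set1 lee_fin (bigD1 k) //= usE Hn prefix_refl lerDl.
by apply: sumr_ge0 => k' _; case: ifP => // _; apply: ltW.
Qed.

End Kraft.

Section DiameterWeight.
Variables (R : realType) (T : Type) (dist : T -> T -> \bar R).
Hypothesis dist_ge0 : forall p q, (0 <= dist p q)%E.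

Lemma diam_ge0 (U : set T) p : U p -> (0 <= diam dist U)%E.
Proof.
move=> Up; apply: le_trans (dist_ge0 p p) _; apply: ereal_sup_ubound.
by exists p => //; exists p.
Qed.

Lemma weight_ge0 (U : set T) (s : R) : (0 <= weight dist s U)%E.
Proof. by rewrite /weight; case: ifP => _ //; apply: poweR_ge0. Qed.

Lemma weight_mono (U : set T) (s' s : R) : 0 <= s' -> s' <= s ->
  (diam dist U <= 1)%E -> (0 <= weight dist s U <= weight dist s' U)%E.
Proof.
move=> s'0 ss' dU; rewrite weight_ge0 /= /weight; case: eqP => [//|/eqP/set0P[p Up]].
have := diam_ge0 Up; case: (diam dist U) dU => [x| |] //.
rewrite !lee_fin => x1 x0.
(* At diameter 0 the power is 1 for exponent 0 and 0 otherwise, so the monotonicity of powers does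
   not apply directly. *)
have [->|xn] := eqVneq x 0; last by apply: ger_powR => //; rewrite lt_neqAle eq_sym xn x0.
have [s00|sn] := eqVneq s 0; last by rewrite powR0 // powR_ge0.
have s'00 : s' = 0 by apply/eqP; rewrite eq_le s'0 -s00 ss'.
by rewrite s00 s'00.
Qed.

Lemma weight_le1 (U : set T) (s : R) : 0 <= s ->
  (diam dist U <= 1)%E -> (weight dist s U <= 1)%E.
Proof.
move=> s0 dU; have /andP[_ /le_trans] := weight_mono (lexx 0) s0 dU; apply.
by rewrite /weight; case: ifP => //; rewrite poweRe0.
Qed.

End DiameterWeight.

Lemma sum_dist_ge0 (R : realType) (d D : nat) (p q : letter d * 'rV[R]_D) :
  (0 <= sum_dist p q)%E.
Proof. by rewrite /sum_dist; case: ifP => _; rewrite ?leey // lee_fin edist_ge0. Qed.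

(** * Dimension of self-similar sets from below *)

Section IFS.
Variables (R : realType) (D : nat) (I : finType).
Variables (g : I -> 'rV[R]_D -> 'rV[R]_D) (rho : I -> R).
Variables (X O : set 'rV[R]_D) (z0 : 'rV[R]_D) (r0 B s : R).
Hypothesis rho_itv : forall i, 0 < rho i < 1.
Hypothesis g_sim : forall i, similarity (rho i) (g i).
Hypothesis gO : forall i, g i @` O `<=` O.
Hypothesis g_osc : forall i j, i != j -> g i @` O `&` g j @` O = set0.
Hypothesis r0_gt0 : 0 < r0.
Hypothesis z0_ball : forall y, edist z0 y < r0 -> O y.
Hypothesis z0X : X z0.
Hypothesis B_gt0 : 0 < B.
Hypothesis X_bounded : forall x y, X x -> X y -> edist x y <= B.
Hypothesis rho_s : 1 <= \sum_i rho i `^ s.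

Definition ifs_map (w : seq I) : 'rV[R]_D -> 'rV[R]_D :=
  foldr (fun i h => g i \o h) id w.

Let wr (w : seq I) := \prod_(i <- w) rho i.

Let rho0 i : 0 < rho i. Proof. by have /andP[] := rho_itv i. Qed.
Let wr0 w : 0 < wr w. Proof. exact: prodr_gt0. Qed.
Let wr_cat u v : wr (u ++ v) = wr u * wr v. Proof. exact: big_cat. Qed.
Let ifs_sim w : similarity (wr w) (ifs_map w).
Proof.
elim: w => [|i w IH] x y /=; first by rewrite /wr big_nil mul1r.
by rewrite g_sim IH mulrA /wr big_cons.
Qed.

Let ifsO w : ifs_map w @` O `<=` O.
Proof.
elim: w => [|i w IH] y /=; first by case=> x Ox <-.
by case=> x Ox <-; apply: (gO (i := i)); exists (ifs_map w x) => //; apply: IH; exists x.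
Qed.

Let ifs_disjoint w w' : ~~ seq.prefix w w' -> ~~ seq.prefix w' w ->
  forall x y, O x -> O y -> ifs_map w x <> ifs_map w' y.
Proof.
elim: w w' => [|i w IH] [|j w'] //= ww' w'w x y Ox Oy E.
have [ij|ij] := eqVneq i j.
  move: ww' w'w; rewrite ij !eqxx /= => ww' w'w.
  apply: (IH w' ww' w'w x y Ox Oy); apply: (similarity_inj (rho0 j) (g_sim j)).
  by rewrite -{1}ij.
have : (g i @` O `&` g j @` O) (g i (ifs_map w x)).
  by split; [exists (ifs_map w x) => //; apply: ifsO; exists x|rewrite E; exists
    (ifs_map w' y) => //; apply: ifsO; exists y].
by rewrite g_osc.
Qed.

Let I_inh : I.
Proof. by case: (pickP (@predT I)) => // I0; move: rho_s; rewrite big_pred0 // ler10. Qed.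

Let rmax_ex : exists2 m : R, 0 < m < 1 & forall i, rho i <= m.
Proof.
pose m := \big[Num.max/0]_i rho i.
have mP i : rho i <= m by rewrite /m (bigD1 i) //= le_max lexx.
exists m => //; rewrite (lt_le_trans (rho0 I_inh)) //= /m.
elim/big_ind: _ => //; first by move=> *; rewrite gt_max; apply/andP.
by move=> i _; have /andP[] := rho_itv i.
Qed.

Let rmin_ex : exists2 m : R, 0 < m & forall i, m <= rho i.
Proof.
pose m := \big[Num.min/1]_i rho i.
exists m; last by move=> i; rewrite /m (bigD1 i) //= ge_min lexx.
by rewrite /m; elim/big_ind: _ => //; move=> *; rewrite lt_min; apply/andP.
Qed.

Let small (r : R) : 0 < r -> exists n, forall xi : nat -> I, wr (mkseq xi n) <= r.
Proof.
move=> r_gt0; have [m /andP[m0 m1] mP] := rmax_ex.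
have cv : (fun j => m ^+ j) @ \oo --> 0 by apply: cvg_expr; rewrite ger0_norm // ltW.
have /cvgr0Pnorm_le/(_ _ r_gt0)[n _ /(_ n (leqnn _))] := cv.
rewrite /= ger0_norm ?exprn_ge0 ?(ltW m0) // => H; exists n => xi.
apply: le_trans H; elim: n => [|n IH]; first by rewrite /wr big_nil expr0.
by rewrite mkseqS -cats1 wr_cat exprSr /wr big_seq1 ler_pM // ltW // prodr_gt0.
Qed.

(** The Moran cut at scale r: the words whose ratio has just dropped to r. They are pairwise
    incomparable, and for r < 1 their ratio is still at least the smallest [rho i] times r. *)
Let stop r w := wr w <= r /\ forall m, (m < size w)%N -> r < wr (take m w).

Let stop_ex r (xi : nat -> I) : 0 < r -> exists n, stop r (mkseq xi n).
Proof.
move=> /small[n0 /(_ xi) H].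
have [|n Hn nmin] := @ex_minnP (fun n => wr (mkseq xi n) <= r); first by exists n0.
exists n; split=> // m; rewrite size_mkseq => mn.
rewrite ltNge; apply/negP => Hm.
suff : (n <= m)%N by rewrite leqNgt mn.
apply: nmin; rewrite (_ : mkseq xi m = take m (mkseq xi n)) //.
by rewrite /mkseq -map_take take_iota (minn_idPl (ltnW mn)).
Qed.

Let stop_prefix r w w' : stop r w -> stop r w' -> seq.prefix w w' -> w = w'.
Proof.
move=> [wr_ _] [_ w'r] /prefixP[[|i z] E]; first by rewrite E cats0.
have := w'r (size w); rewrite E size_cat /= addnS ltnS leq_addr => /(_ isT).
by rewrite take_size_cat // ltNge wr_.
Qed.

(* Stopping words of size comparable to r whose pieces meet a set of diameter
   r are told apart by the cell of a grid that contains the image of z0. *)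
Let cover_family : exists M : nat, forall (r : R) (A : set 'rV[R]_D), 0 < r ->
  (forall x y, A x -> A y -> edist x y <= r) ->
  exists ww : {ffun 'I_D -> 'I_M.+1} -> seq I, (forall k, wr (ww k) <= r) /\
    forall (xi : nat -> I) p, A p -> (forall n, (ifs_map (mkseq xi n) @` X) p) ->
      exists k n, ww k = mkseq xi n.
Proof.
have [mu mu0 muP] := rmin_ex.
(* In a grid of mesh c r, two points of one cell are less than (D + 1) c r = mu r0 r apart, which is
   less than the radius [wr w * r0] of the image of the ball around z0. Relevant images of z0 lie
   within (B + 1) r of a point of A, so each coordinate needs about 2 (B + 1) / c cells, whatever r
   is. *)
pose c := mu * r0 / D.+1%:R.
have c0 : 0 < c by rewrite divr_gt0 ?mulr_gt0.
exists (Num.truncn (2 * (B + 1) / c)) => r A r_gt0 Ar.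
set M := Num.truncn _.
(* At scale at least 1 the empty word suffices; otherwise a stopping word has a last letter, as
   [big_enough] requires. *)
have [r1|r1] := leP 1 r.
  exists (fun=> [::]); split=> [k|xi p _ _]; first by rewrite /wr big_nil.
  by exists [ffun=> ord0], 0%N.
have [n0 Hn0] := small r_gt0.
have [[ps Aps]|A0] := pselect (A !=set0); last first.
  exists (fun=> mkseq (fun=> I_inh) n0); split=> // xi p Ap _.
  by case: A0; exists p.
pose P w := exists (xi : nat -> I) p n, [/\ A p, forall n, (ifs_map (mkseq xi n) @` X) p,
  w = mkseq xi n & stop r w].
pose co w i := (ifs_map w z0 0 i - ps 0 i + (B + 1) * r) / (c * r).
pose cell w : {ffun 'I_D -> 'I_M.+1} := [ffun i => inord (Num.truncn (co w i))].
have cr0 : 0 < c * r by rewrite mulr_gt0.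
have near w i : P w -> `|ifs_map w z0 0 i - ps 0 i| <= (B + 1) * r.
  move=> [xi [p [n [Ap xip wE [wr_ _]]]]].
  have [x Xx xp] := xip n; rewrite -wE in xp.
  have -> : ifs_map w z0 0 i - ps 0 i = (ifs_map w z0 0 i - p 0 i) + (p 0 i - ps 0 i)
    by ring.
  apply: le_trans (ler_normD _ _) _; rewrite mulrDl mul1r; apply: lerD.
    apply: le_trans (coord_le_edist _ _ _) _; rewrite -xp ifs_sim mulrC.
    by apply: ler_pM => //; [exact: edist_ge0|exact: ltW|exact: X_bounded].
  by apply: le_trans (coord_le_edist _ _ _) _; apply: Ar.
have co_itv w i : P w -> 0 <= co w i /\ (Num.truncn (co w i) <= M)%N.
  move=> /(near _ i); rewrite ler_norml => /andP[h1 h2]; split.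
    by rewrite divr_ge0 ?(ltW cr0) //; lra.
  apply: le_truncn; rewrite /co ler_pdivrMr //.
  rewrite (_ : 2 * (B + 1) / c * (c * r) = 2 * ((B + 1) * r)); last by field; rewrite
    gt_eqF.
  by move: ((B + 1) * r) h1 h2 => Br; lra.
have big_enough w : P w -> mu * r < wr w.
  move=> [xi [p [n [_ _ _]]]]; case/lastP: w => [|w i] [wr_ Hw].
    by move: wr_; rewrite /wr big_nil leNgt r1.
  have := Hw (size w); rewrite size_rcons ltnSn => /(_ isT).
  rewrite -cats1 take_size_cat // wr_cat => Hwr.
  have -> : wr [:: i] = rho i by rewrite /wr big_seq1.
  apply: (@lt_le_trans _ _ (mu * wr w)); first by rewrite ltr_pM2l.
  by rewrite mulrC ler_pM2l.
have cell_inj w w' : P w -> P w' -> cell w = cell w' -> w = w'.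
  move=> Pw Pw' E.
  have cl i : `|ifs_map w z0 0 i - ifs_map w' z0 0 i| <= c * r.
    have [h1 h2] := co_itv w i Pw; have [h1' h2'] := co_itv w' i Pw'.
    have := congr1 (fun F : {ffun 'I_D -> 'I_M.+1} => F i : nat) E.
    rewrite !ffunE !inordK ?ltnS // => Et.
    have /andP[a1 a2] := truncn_itv h1; have /andP[] := truncn_itv h1'.
    rewrite -Et => b1 b2; move: a1 a2 b1 b2; rewrite -natr1.
    rewrite /co ler_pdivlMr // ler_pdivlMr // ltr_pdivrMr // ltr_pdivrMr // !mulrDl mul1r.
    by rewrite ler_norml => *; apply/andP; split; lra.
  have Hd : edist (ifs_map w z0) (ifs_map w' z0) < wr w * r0.
    apply: (@le_lt_trans _ _ (D%:R * (c * r))).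
      by apply: edist_le_coord; [exact: ltW|].
    apply: (@lt_le_trans _ _ (D.+1%:R * (c * r))); first by rewrite ltr_pM2r // ltr_nat.
    rewrite /c (_ : _ * _ = mu * r * r0); last by field; rewrite addr_eq0 -?natr1
      gt_eqF // ltr_pwDr // ler0n.
    by rewrite ler_pM2r // ltW // big_enough.
  have [y yE] := similarity_surj (wr0 w) (ifs_sim w) (ifs_map w' z0).
  have Oy : O y by apply: z0_ball; move: Hd; rewrite -yE ifs_sim ltr_pM2l.
  have Oz : O z0 by apply: z0_ball; rewrite edistxx.
  have [_ [_ [_ [_ _ _ sw]]]] := Pw; have [_ [_ [_ [_ _ _ sw']]]] := Pw'.
  have [/(stop_prefix sw sw') //|ww'] := boolP (seq.prefix w w').
  have [/(stop_prefix sw' sw) //|w'w] := boolP (seq.prefix w' w).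
  by have := ifs_disjoint ww' w'w Oy Oz yE.
(* Cells that contain no stopping word receive a dummy word of ratio at most r. *)
have /choice[ww wwP] : forall k, exists w, wr w <= r /\ ((exists2 w', P w' & cell w' =
  k) -> P w /\ cell w = k).
  move=> k; have [[w Pw wk]|H] := pselect (exists2 w', P w' & cell w' = k).
    by exists w; split=> //; have [_ [_ [_ [_ _ _ []]]]] := Pw.
  by exists (mkseq (fun=> I_inh) n0); split.
exists ww; split=> [k|xi p Ap xip]; first by have [] := wwP k.
have [n sn] := stop_ex xi r_gt0.
have Pn : P (mkseq xi n) by exists xi, p, n.
exists (cell (mkseq xi n)), n; have [_ []] := wwP (cell (mkseq xi n)); first by exists
  (mkseq xi n).
by move=> Pw; apply: cell_inj.
Qed.

Variable d : nat.
Variables (v0 : letter d) (L : set (letter d * 'rV[R]_D)).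
Hypothesis L_ifs : forall xi : nat -> I, exists p, L (v0, p) /\
  forall n, (ifs_map (mkseq xi n) @` X) p.

Let wr_powR w : \prod_(i <- w) rho i `^ s = wr w `^ s.
Proof.
elim: w => [|i w IH]; first by rewrite /wr !big_nil powR1.
by rewrite big_cons IH -powRM ?(ltW (rho0 i)) ?(ltW (wr0 w)) // /wr big_cons.
Qed.

(** The Kraft inequality takes the role of a mass distribution: a cover of small weight would give
    words of total weight below 1 that meet every sequence. *)
Lemma ifs_dim_ge : (s%:E <= hausdorff_dim (@sum_dist R d D) L)%E.
Proof.
apply: le_ereal_inf_tmp => _ [s' [s'0 Hs'] <-]; rewrite lee_fin leNgt; apply/negP => ss'.
have s0 : 0 < s by apply: le_lt_trans ss'.
have [M fam] := cover_family.
pose T := {ffun 'I_D -> 'I_M.+1}; pose K : R := #|T|%:R.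
have K0 : 0 < K.
  by rewrite ltr0n; apply/card_gt0P; exists [ffun=> ord0].
(* Each set of the cover is charged K words, so the budget is 1/K; one half is for the weights of
   the cover, the other for the padding in c below. *)
pose k := (2 * K)^-1; have k0 : 0 < k by rewrite invr_gt0 mulr_gt0.
have : (hausdorff_content (@sum_dist R d D) s' 1 L < k%:E)%E.
  apply: (@le_lt_trans _ _ 0%E); last by rewrite lte_fin.
  by rewrite -Hs'; apply: ereal_sup_ubound; exists 1 => //=.
move=> /ereal_inf_lt[_ [U [LU dU] <-] Uk].
pose W i := weight (@sum_dist R d D) s (U i).
have sd0 p q : (0 <= @sum_dist R d D p q)%E := sum_dist_ge0 p q.
have W_itv i : (0 <= W i <= weight (@sum_dist R d D) s' (U i))%E.
  by apply: weight_mono => //; apply: ltW.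
have W1 i : (W i <= 1)%E.
  by apply: weight_le1 => //; exact: ltW.
have W0 i : (0 <= W i)%E by have /andP[] := W_itv i.
have Wf i : W i \is a fin_num by rewrite ge0_fin_numE // (le_lt_trans (W1 i)) ?ltry.
have WS : (\sum_(0 <= i <oo) W i < k%:E)%E.
  by apply: le_lt_trans Uk; apply: lee_nneseries => [i _ _|i _]; have /andP[] := W_itv i.
(* The padding makes the scale [r i] positive even where [U i] has weight 0; the added terms sum to
   at most k. *)
pose c i : R := fine (W i) + k / (2 ^ i.+1)%:R.
have c0 i : 0 < c i.
  by rewrite ltr_wpDl ?fine_ge0 // divr_gt0 // ltr0n expn_gt0.
pose r i := c i `^ s^-1.
have r_gt0 i : 0 < r i by apply: powR_gt0.
have rE i : r i `^ s = c i.
  by rewrite /r -powRrM mulVf ?gt_eqF // powRr1 // ltW.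
have Ur i p q : U i (v0, p) -> U i (v0, q) -> edist p q <= r i.
  move=> Up Uq; have d0 := diam_ge0 sd0 Up.
  have le_diam : ((edist p q)%:E <= diam (@sum_dist R d D) (U i))%E.
    apply: ereal_sup_ubound; exists (v0, p) => //; exists (v0, q) => //.
    by rewrite /sum_dist /= eqxx.
  have : ((diam (@sum_dist R d D) (U i)) `^ s = W i)%E.
    by rewrite /W /weight; case: eqP => // U0; rewrite U0 in Up.
  move: le_diam d0 (dU i); case: (diam _ _) => [x| |] //; rewrite !lee_fin => xe x0 x1.
  rewrite poweR_EFin => xs; apply: le_trans xe _.
  have -> : x = (x `^ s) `^ s^-1 by rewrite -powRrM divff ?gt_eqF // powRr1.
  rewrite /r; apply: ge0_ler_powR; rewrite ?nnegrE ?invr_ge0 ?powR_ge0 ?(ltW (c0 i))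
    ?(ltW s0) //.
  by rewrite /c -xs /= lerDl divr_ge0 ?ler0n // ltW.
have /choice[ww wwP] := fun i => fam (r i) [set p | U i (v0, p)] (r_gt0 i) (Ur i).
have cover xi : exists i k n, ww i k = mkseq xi n.
  have [p [Lp xip]] := L_ifs xi; have [i _ Uip] := LU _ Lp.
  by exists i; have [_ H] := wwP i; apply: (H xi p Uip xip).
have := kraft_cover (fun i => powR_gt0 s (rho0 i)) rho_s cover.
apply/negP; rewrite -ltNge.
apply: (@le_lt_trans _ _ (\esum_(i in [set: nat]) (K%:E * ((W i) + (k / (2 ^
  i.+1)%:R)%:E)))%E).
  apply: le_esum => i _.
  have -> : (W i + (k / (2 ^ i.+1)%:R)%:E)%E = (c i)%:E by rewrite EFinD fineK.
  rewrite -EFinM lee_fin -rE /K mulr_natl -sumr_const.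
  apply: ler_sum => j _; rewrite wr_powR; apply: ge0_ler_powR; rewrite ?nnegrE ?(ltW
    s0) ?(ltW (wr0 _)) ?(ltW (r_gt0 _)) //.
  by have [] := wwP i.
have kn i : (0 <= (k / (2 ^ i.+1)%:R)%:E)%E by rewrite lee_fin divr_ge0 ?ler0n // ltW.
rewrite -nneseries_esumT; last by move=> i; rewrite mule_ge0 ?lee_fin ?(ltW K0) //
  adde_ge0.
rewrite nneseriesZl; last by move=> i _; rewrite adde_ge0.
have := epsilon_trick xpredT W0 (ltW k0).
move=> H.
have {}H : (\sum_(0 <= i <oo) (W i + (k / (2 ^ i.+1)%:R)%:E) < (k + k)%:E)%E.
  by apply: le_lt_trans H _; rewrite EFinD lteD2rE.
rewrite (_ : 1%E = K%:E * (k + k)%:E)%E; last first.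
  by rewrite -EFinM /k; congr EFin; field; rewrite gt_eqF.
by rewrite lte_pmul2l.
Qed.

End IFS.

(** * The coding map *)

Section WordMaps.
Variables (R : realType) (d D : nat) (Phi : linear_GDMS R d D).
Implicit Types (a b : letter d) (u v w : seq (letter d)).

Let c := Defs.ratio Phi.
Let X := Defs.space Phi.

Let c0 a : 0 < c a. Proof. by have /andP[] := ratio_itv Phi a. Qed.

Definition letter_map a b : 'rV[R]_D -> 'rV[R]_D :=
  if (insub (a, b) : option (edge d)) is Some e then smap Phi e else id.

(** The last letter only names the domain: n.+1 letters compose n maps. This is why [belast] and an
    appended final letter accompany it. *)
Fixpoint word_map w : 'rV[R]_D -> 'rV[R]_D :=
  if w is a :: w' then
    if w' is b :: _ then letter_map a b \o word_map w' else id
  else id.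

Lemma letter_map_edge (e : edge d) : letter_map (src e) (tgt e) = smap Phi e.
Proof. by rewrite /letter_map /src /tgt -surjective_pairing valK. Qed.

Lemma edge_ex a b : a != invl b -> exists e : edge d, src e = a /\ tgt e = b.
Proof. by move=> ab; exists (Sub (a, b) ab). Qed.

Lemma letter_map_sim a b : a != invl b -> similarity (c a) (letter_map a b).
Proof. by move=> /edge_ex[e [<- <-]]; rewrite letter_map_edge; apply: smap_similarity.
  Qed.

Lemma letter_map_space a b : a != invl b -> letter_map a b @` X b `<=` X a.
Proof. by move=> /edge_ex[e [<- <-]]; rewrite letter_map_edge; apply: smap_space. Qed.

Lemma letter_map_inj a b : a != invl b -> injective (letter_map a b).
Proof. by move=> /letter_map_sim; apply: similarity_inj. Qed.

Lemma letter_map_disjoint a b b' x x' : a != invl b -> a != invl b' -> b != b' ->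
  interior (X b) x -> interior (X b') x' -> letter_map a b x <> letter_map a b' x'.
Proof.
move=> /edge_ex[e [ea eb]] /edge_ex[e' [ea' eb']] bb' Ix Ix' E.
have ee' : e <> e' by move=> e_e'; move: bb'; rewrite -eb -eb' e_e' eqxx.
move: E; rewrite -{1}ea -{1}ea' -eb -eb' !letter_map_edge => E.
have : (smap Phi e @` interior (X (tgt e)) `&` smap Phi e' @` interior (X (tgt e')))
  (smap Phi e x).
  by split; [exists x; rewrite ?eb|exists x'; rewrite ?eb'].
by rewrite open_set_condition.
Qed.

Lemma word_map_sim a w : reduced (a :: w) ->
  similarity (wt c (belast a w)) (word_map (a :: w)).
Proof.
elim: w a => [|b w IH] a; first by move=> _ x y; rewrite /wt big_nil mul1r.
rewrite reduced_cons => /andP[ab rw] x y /=.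
by rewrite letter_map_sim // IH // wt_cons mulrA.
Qed.

Lemma word_map_space a w : reduced (a :: w) ->
  word_map (a :: w) @` X (last a w) `<=` X a.
Proof.
elim: w a => [|b w IH] a; first by move=> _ _ [x Xx <-].
rewrite reduced_cons => /andP[ab rw] _ [x Xx <-] /=.
by apply: letter_map_space ab _ _; exists (word_map (b :: w) x) => //; apply: IH => //;
  exists x.
Qed.

Lemma word_map_interior a w : reduced (a :: w) ->
  word_map (a :: w) @` interior (X (last a w)) `<=` interior (X a).
Proof.
move=> rw; apply: similarity_interior (word_map_sim rw) _; first exact: wt_gt0.
exact: word_map_space.
Qed.

Lemma word_map_cat u a w : word_map (u ++ a :: w) = word_map (rcons u a) \o word_map (a
  :: w).
Proof.
elim: u => [//|b u IH].
by case: u IH => [//|b' u] IH; rewrite !rcons_cons !cat_cons; congr (_ \o _).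
Qed.

Lemma word_map_disjoint a u u' x x' : ~~ seq.prefix u u' -> ~~ seq.prefix u' u ->
  reduced (a :: u) -> reduced (a :: u') ->
  interior (X (last a u)) x -> interior (X (last a u')) x' ->
  word_map (a :: u) x <> word_map (a :: u') x'.
Proof.
elim: u a u' => [|b u IH] a [|b' u'] //=.
rewrite ![reduced (a :: _)]reduced_cons => p1 p2 /andP[ab ru] /andP[ab' ru'] Ix Ix' E.
have [bb'|bb'] := eqVneq b b'.
  move: p1 p2; rewrite bb' !eqxx /= => p1 p2.
  move: E ru; rewrite bb' in Ix * => E ru; apply: (IH b' u' p1 p2 ru ru' Ix Ix').
  exact: (letter_map_inj ab' E).
apply: (letter_map_disjoint ab ab' bb' _ _ E).
  by apply: word_map_interior ru _ _; exists x.
by apply: word_map_interior ru' _ _; exists x'.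
Qed.

Lemma code_spaceP (omega : nat -> edge d) i : code_space omega ->
  src (omega i) != invl (src (omega i.+1)).
Proof. by move=> /(_ i) <-; have := valP (omega i). Qed.

Lemma comp_smapE omega n : code_space omega ->
  comp_smap Phi omega n = word_map (mkseq (@src d \o omega) n.+1).
Proof.
move=> co; elim: n => [//|n IH]; rewrite [LHS]/= IH.
rewrite !mkseqS -[rcons (rcons _ _) _]cats1 cat_rcons.
by rewrite word_map_cat /= -letter_map_edge -co.
Qed.

Lemma cylinderE omega n : code_space omega ->
  cylinder Phi omega n = word_map (mkseq (@src d \o omega) n.+2) @` X (src (omega n.+1)).
Proof. by move=> co; rewrite /cylinder comp_smapE // co. Qed.

Lemma mkseq_reduced (al : nat -> letter d) n :
  (forall i, al i != invl (al i.+1)) -> reduced (mkseq al n).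
Proof.
move=> ad; elim: n => [//|n IH]; rewrite mkseqS.
case: n IH => [//|n] IH; rewrite -cats1 (reduced_cat (al 0) (al 0)) //.
rewrite IH mkseqS last_rcons; exact: ad.
Qed.

Lemma mkseq_cons (T : Type) (al : nat -> T) n : mkseq al n.+1 = al 0%N :: mkseq (al \o
  S) n.
Proof. by rewrite /mkseq /= -[1%N]addn0 iotaDl -map_comp. Qed.

(** The cylinders are decreasing nonempty compact sets. This guarantees that the [get] in [coding]
    returns a point of the intersection rather than a default. *)
Lemma cylinder_nonempty omega : code_space omega -> (\bigcap_n cylinder Phi omega n)
  !=set0.
Proof.
move=> co; pose al := @src d \o omega.
have ad i : al i != invl (al i.+1) by apply: code_spaceP.
have r n : reduced (al 0%N :: mkseq (al \o S) n) by rewrite -mkseq_cons; apply: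
  mkseq_reduced.
have cylE n : cylinder Phi omega n = word_map (al 0%N :: mkseq (al \o S) n.+1) @` X (al
  n.+1).
  by rewrite cylinderE // mkseq_cons.
have dec n : cylinder Phi omega n.+1 `<=` cylinder Phi omega n.
  rewrite !cylE => _ [x Xx <-].
  have -> : al 0%N :: mkseq (al \o S) n.+2 = (al 0%N :: mkseq (al \o S) n) ++ [:: al
    n.+1; al n.+2].
    by rewrite !mkseqS -!cats1 /= -!catA.
  rewrite word_map_cat [X in X x]/=.
  exists (letter_map (al n.+1) (al n.+2) x); last by rewrite mkseqS.
  by apply: letter_map_space; [apply: ad|exists x].
have dec_le m n : (m <= n)%N -> cylinder Phi omega n `<=` cylinder Phi omega m.
  elim: n => [|n IH]; first by rewrite leqn0 => /eqP ->.
  by rewrite leq_eqVlt => /predU1P[->//|/IH]; apply: subset_trans.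
have cc n : compact (cylinder Phi omega n).
  rewrite cylE; apply: continuous_compact; last exact: space_compact.
  apply: continuous_subspaceT; apply: similarity_continuous (word_map_sim (r _)).
  exact: wt_gt0.
have /choice[x xP] : forall n, exists x, cylinder Phi omega n x.
  move=> n; rewrite cylE; have [z Xz] := space_neq0 Phi (al n.+1).
  by eexists; exists z.
have F0 : \oo (x @^-1` cylinder Phi omega 0%N).
  by exists 0%N => // n _; apply: (dec_le 0%N n) (xP n).
have [p [_ clp]] := cc 0%N (x @ \oo) _ F0.
exists p => n _.
have : closed (cylinder Phi omega n) by apply: compact_closed => //; apply:
  norm_hausdorff.
move=> /closure_id ->; move=> V Vp; apply: clp Vp.
exists n => // m /= nm; exact: dec_le (xP m).
Qed.

Lemma codingP omega n : code_space omega -> cylinder Phi omega n (coding Phi omega).2.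
Proof.
move=> co; have [p pP] := cylinder_nonempty co.
by have : (\bigcap_n cylinder Phi omega n) (get (\bigcap_n cylinder Phi omega n));
  [apply: getI pP|apply].
Qed.

Lemma prefixE omega n : Defs.prefix omega n = wordg (mkseq (@src d \o omega) n).
Proof.
elim: n => [|n IH]; first by rewrite /Defs.prefix /wordg big_ord0 big_nil.
rewrite /Defs.prefix big_ord_recr /= -/(Defs.prefix omega n) IH mkseqS -cats1 wordg_cat.
by rewrite wordg_cons /wordg big_nil mulg1.
Qed.

End WordMaps.

(** * Self-similar subsets of the radial limit set *)

Section CodeDimension.
Variables (R : realType) (d D : nat) (Phi : linear_GDMS R d D).
Variables (N : set (free_group d)) (y : letter d) (W : seq (seq (letter d))).
Hypothesis hN : normal_subgroup N.
Hypothesis hW : prefix_code N y W.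

Let c := Defs.ratio Phi.
Let X := Defs.space Phi.
Let c0 a : 0 < c a. Proof. by have /andP[] := ratio_itv Phi a. Qed.

Let wd (i : 'I_(size W)) := nth [::] W i.
Let wdW i : wd i \in W. Proof. exact: mem_nth. Qed.
Let flat (us : seq 'I_(size W)) := flatten (map wd us).

Let wd_neq0 i : wd i != [::].
Proof. by have [u ->] := code_head hW (wdW i). Qed.

Let flat_cons us : rcons (flat us) y = y :: behead (rcons (flat us) y).
Proof.
case: us => [//|i us]; rewrite /flat /=.
by have [u ->] := code_head hW (wdW i).
Qed.

Let flat_reduced us : reduced (rcons (flat us) y).
Proof.
elim: us => [//|i us IH].
have -> : rcons (flat (i :: us)) y = wd i ++ rcons (flat us) y by rewrite rcons_cat.
rewrite (reduced_cat y y) // ?(code_reduced hW (wdW i)) ?IH //=; last first.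
  by rewrite flat_cons.
by rewrite flat_cons /= invl_neq (code_last hW).
Qed.

Let wd_reduced i : reduced (rcons (wd i) y).
Proof. by have := flat_reduced [:: i]; rewrite /flat /= cats0. Qed.

(** Appending y closes the loop: the map sends [X y] into itself with ratio [wt c (wd i)], and
    concatenation of code words becomes composition. *)
Let g i := word_map Phi (rcons (wd i) y).

Let g_shape i : exists u, wd i = y :: u. Proof. exact: code_head hW _ (wdW i). Qed.

Let g_sim i : similarity (wt c (wd i)) (g i).
Proof.
have [u E] := g_shape i; have := wd_reduced i; rewrite /g E rcons_cons.
by move=> /(word_map_sim Phi); rewrite belast_rcons.
Qed.

Let g_interior i : g i @` interior (X y) `<=` interior (X y).
Proof.
have [u E] := g_shape i; have := wd_reduced i; rewrite /g E rcons_cons.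
by move=> /(word_map_interior (Phi := Phi)); rewrite last_rcons.
Qed.

Let g_disjoint i j : i != j -> g i @` interior (X y) `&` g j @` interior (X y) = set0.
Proof.
move=> ij; rewrite -subset0 => _ [[x Ix <-] [x' Ix']].
have np a b : a != b -> ~~ seq.prefix (rcons (wd a) y) (rcons (wd b) y).
  move=> ab; apply/negP => /prefixP[z]; case/lastP: z => [|z e].
    rewrite cats0 => /eqP; rewrite eqseq_rcons eqxx andbT eq_sym.
    by rewrite /wd nth_uniq ?(code_uniq hW) // => /eqP/val_inj/eqP; rewrite (negbTE ab).
  rewrite -rcons_cat => /eqP; rewrite eqseq_rcons => /andP[/eqP E _].
  have := code_prefix hW (wdW a) (wdW b).
  rewrite E -cats1 -!catA prefix_prefix => /(_ isT) E'.
  have := congr1 size E'; rewrite !size_cat /=; lia.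
have [u E] := g_shape i; have [u' E'] := g_shape j.
have := np _ _ ij; have := np j i; rewrite eq_sym ij => /(_ isT).
have := wd_reduced i; have := wd_reduced j.
rewrite /g E E' !rcons_cons /= !eqxx /= => r' r p' p /esym.
by apply: word_map_disjoint => //; rewrite last_rcons.
Qed.

Let ifs_mapE us : ifs_map g us = word_map Phi (rcons (flat us) y).
Proof.
elim: us => [//|i us IH].
have -> : rcons (flat (i :: us)) y = wd i ++ rcons (flat us) y by rewrite rcons_cat.
by rewrite flat_cons word_map_cat -flat_cons -IH.
Qed.

Section Point.
Variable xi : nat -> 'I_(size W).

(** The letters of the infinite concatenation; i.+1 blocks reach position i, since no block is
    empty. *)
Let al i := nth y (flat (mkseq xi i.+1)) i.

Let flat_prefix m n : (m <= n)%N ->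
  exists z, flat (mkseq xi n) = flat (mkseq xi m) ++ z.
Proof.
elim: n => [|n IH]; first by rewrite leqn0 => /eqP ->; exists [::]; rewrite cats0.
rewrite leq_eqVlt => /predU1P[->|/IH[z E]]; first by exists [::]; rewrite cats0.
by exists (z ++ wd (xi n)); rewrite mkseqS /flat map_rcons flatten_rcons -/(flat _) E
  catA.
Qed.

Let flat_size n : (n <= size (flat (mkseq xi n)))%N.
Proof.
elim: n => [//|n IH]; rewrite mkseqS /flat map_rcons flatten_rcons size_cat.
have : (0 < size (wd (xi n)))%N by rewrite lt0n size_eq0.
rewrite -/(flat _); lia.
Qed.

(** The position just behind the blocks is included, because the next code word begins with y as
    well. *)
Let al_nth n i : (i < size (rcons (flat (mkseq xi n)) y))%N ->
  nth y (rcons (flat (mkseq xi n)) y) i = al i.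
Proof.
rewrite size_rcons ltnS leq_eqVlt => /predU1P[->|ilt].
  rewrite nth_rcons ltnn eqxx /al; set m := size (flat _).
  have [|z' ->] := flat_prefix (m := n.+1) (n := m.+1); first exact: flat_size.
  rewrite mkseqS /flat map_rcons flatten_rcons -/(flat _) -catA nth_cat -/m ltnn subnn.
  by have [u ->] := g_shape (xi n).
rewrite nth_rcons ilt /al.
case: (leqP n i.+1) => ni.
  by have [z ->] := flat_prefix ni; rewrite nth_cat ilt.
have [z ->] := flat_prefix (ltnW ni).
by rewrite nth_cat ifT //; apply: leq_trans (flat_size i.+1).
Qed.

Let al_mkseq n : mkseq al (size (flat (mkseq xi n))).+1 = rcons (flat (mkseq xi n)) y.
Proof.
apply: (@eq_from_nth _ y); rewrite size_mkseq ?size_rcons // => i ilt.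
by rewrite nth_mkseq // al_nth ?size_rcons.
Qed.

Let al_adm i : al i != invl (al i.+1).
Proof.
have s2 : (i.+1 < size (rcons (flat (mkseq xi i.+2)) y))%N.
  by rewrite size_rcons ltnS; apply: leq_trans (flat_size _).
have /(sortedP y)/(_ i) := flat_reduced (mkseq xi i.+2).
by move=> /(_ s2); rewrite !al_nth // ltnW.
Qed.

Let omega i : edge d := Sub (al i, al i.+1) (al_adm i).

Let omega_code : code_space omega. Proof. by []. Qed.
Let omega_src : @src d \o omega = al. Proof. by []. Qed.

Lemma code_point : exists p, radial_limit_set Phi N (y, p) /\
  forall n, (ifs_map g (mkseq xi n) @` X y) p.
Proof.
have al0 : al 0%N = y.
  by have := al_nth (n := 0) (i := 0) isT.
exists (coding Phi omega).2; split.
  exists omega; last by rewrite /coding /= -[src _]/(al 0%N) al0.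
  split=> //; exists 1%g.
  (* The prefix formed by the first m.+1 blocks lies in N and is longer than m, which contradicts
     the bound m. *)
  move=> /finite_seqP[sq sqE]; pose m := \max_(i <- sq) i.
  have mP n : (exists2 x, N x & (x * 1)%g = Defs.prefix omega n) -> (n <= m)%N.
    move=> Hn; apply: leq_bigmax_seq => //.
    by have : [set` sq] n by rewrite -sqE; exact: Hn.
  pose k := size (flat (mkseq xi m.+1)).
  have : (k <= m)%N.
    apply: mP; exists (Defs.prefix omega k); last by rewrite mulg1.
    rewrite prefixE omega_src.
    have -> : mkseq al k = flat (mkseq xi m.+1).
      apply: (@eq_from_nth _ y); rewrite size_mkseq // => i ilt.
      by rewrite nth_mkseq // -(@al_nth m.+1) ?size_rcons 1?ltnW // nth_rcons ilt.
    elim: (mkseq xi m.+1) => [|i us IH]; first by rewrite /flat /wordg big_nil; exact: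
      normal1 hN.
    by rewrite /flat /= wordg_cat; apply: (normalM hN) => //; apply: code_mem hW _ (wdW
      i).
  by have := flat_size m.+1; rewrite -/k => h1 h2; have := leq_trans h1 h2; rewrite ltnn.
case=> [|n].
  have := codingP Phi 0 omega_code; rewrite cylinderE // omega_src => -[x Xx px].
  exists (coding Phi omega).2 => //; rewrite -px -al0.
  have r2 : reduced [:: al 0%N; al 1%N] by apply: (mkseq_reduced 2 al_adm).
  by apply: (word_map_space (Phi := Phi) r2); exists x.
(* [cylinder omega m] reads m.+2 letters; for this m they are the first n.+1 blocks followed by
   y. *)
pose m := (size (flat (mkseq xi n.+1))).-1.
have mE : m.+1 = size (flat (mkseq xi n.+1)).
  by rewrite prednK // (leq_trans _ (flat_size n.+1)).
have := codingP Phi m omega_code; rewrite cylinderE // omega_src mE al_mkseq ifs_mapE.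
rewrite -[src _]/(al (size (flat (mkseq xi n.+1)))).
have -> : al (size (flat (mkseq xi n.+1))) = y; last by [].
by rewrite -(@al_nth n.+1) ?size_rcons // nth_rcons ltnn eqxx.
Qed.

End Point.

Lemma code_dim_ge s : 1 <= \sum_(w <- W) wt c w `^ s ->
  (s%:E <= dimH (radial_limit_set Phi N))%E.
Proof.
move=> Ws.
have [z0 Iz0] : interior (X y) !=set0.
  have [x Xx] := space_neq0 Phi y.
  move: Xx; rewrite -space_regular => /(_ setT filterT)[z [Iz _]]; by exists z.
have /interiorP_edist[r0 r00 z0P] : interior (interior (X y)) z0 by apply: nbhs_interior.
have [B B0 BP] := compact_edist_bounded (@space_compact _ _ _ Phi y).
have cw1 i : 0 < wt c (wd i) < 1.
  rewrite wt_gt0 //=; have [u ->] := g_shape i; rewrite wt_cons.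
  have /andP[_ c1] := ratio_itv Phi y.
  apply: (@le_lt_trans _ _ (c y)) => //; rewrite ler_piMr ?(ltW (c0 y)) //.
  by apply: prodr_ile1 => a _; have /andP[/ltW -> /ltW ->] := ratio_itv Phi a.
apply: (@ifs_dim_ge _ _ _ g (fun i => wt c (wd i)) (X y) (interior (X y)) z0 r0 B s) =>
  //.
- exact: interior_subset.
- by apply: le_trans Ws _; rewrite (big_nth [::]) big_mkord.
- exact: code_point.
Qed.

End CodeDimension.

(** * The upper bound *)

Lemma wt_powR (R : realType) (d : nat) (c : letter d -> R) (s : R) w :
  (forall a, 0 < c a) -> wt (fun a => c a `^ s) w = wt c w `^ s.
Proof.
move=> c0; elim: w => [|a w IH]; first by rewrite /wt !big_nil powR1.
by rewrite !wt_cons IH -powRM // ltW // wt_gt0.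
Qed.

Lemma sum_uniq_sub (R : realType) (T : eqType) (S S' : seq T) (F : T -> R) :
  uniq S -> {subset S <= S'} -> (forall x, 0 <= F x) ->
  \sum_(x <- S) F x <= \sum_(x <- S') F x.
Proof.
move=> + + F0; elim: S S' => [|x S IH] S' /=; first by rewrite big_nil sumr_ge0.
move=> /andP[xS uS] SS'; have xS' : x \in S' by apply: SS'; rewrite mem_head.
rewrite big_cons (big_rem x xS') /= lerD2l; apply: IH => // z zS.
have := SS' z; rewrite inE zS orbT => /(_ isT).
by rewrite (perm_mem (perm_to_rem xS')) inE => /predU1P[zx|//]; rewrite -zx zS in xS.
Qed.

(** With m halfway between l and 1 and m / l = 1 + h, Bernoulli's inequality bounds n.+1 by a
    multiple of (1 + h)^n. *)
Lemma geom_poly_bound (R : realType) (l : R) : 0 < l < 1 ->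
  exists A m : R, [/\ 0 < A, 0 < m < 1 & forall n, n.+1%:R * l ^+ n <= A * m ^+ n].
Proof.
move=> /andP[l0 l1]; pose m := (1 + l) / 2; pose h := m / l - 1.
have lm : l < m by rewrite /m; lra.
have m1 : m < 1 by rewrite /m; lra.
have h0 : 0 < h by rewrite /h subr_gt0 ltr_pdivlMr // mul1r.
have bern n : 1 + n%:R * h <= (1 + h) ^+ n.
  elim: n => [|n IH]; first by rewrite mul0r addr0 expr0.
  rewrite exprS; apply: (@le_trans _ _ ((1 + h) * (1 + n%:R * h))).
    rewrite -natr1 -subr_ge0 (_ : _ - _ = n%:R * h ^+ 2); last by ring.
    by rewrite mulr_ge0 ?ler0n ?sqr_ge0.
  by rewrite ler_pM2l // addr_gt0.
exists (1 + h^-1), m; split; first by rewrite addr_gt0 ?invr_gt0.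
  by rewrite m1 andbT; apply: lt_trans lm.
move=> n; have -> : m = (1 + h) * l by rewrite /h addrC subrK divfK ?gt_eqF.
rewrite exprMn mulrA ler_pM2r ?exprn_gt0 //.
apply: (@le_trans _ _ ((1 + h^-1) * (1 + n%:R * h))).
  have hn0 : 0 <= n%:R * h by rewrite mulr_ge0 ?ler0n // ltW.
  have -> : (1 + h^-1) * (1 + n%:R * h) = n.+1%:R + (n%:R * h + h^-1).
    by rewrite -natr1; field; rewrite gt_eqF.
  by rewrite lerDl addr_ge0 // invr_ge0 ltW.
by rewrite ler_pM2l ?bern // addr_gt0 ?invr_gt0.
Qed.

Lemma ex_pow_small (R : realType) (m e : R) : 0 < m < 1 -> 0 < e ->
  exists n, forall k, (n <= k)%N -> m ^+ k <= e.
Proof.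
move=> /andP[m0 m1] e0.
have cv : (fun j => m ^+ j) @ \oo --> 0 by apply: cvg_expr; rewrite ger0_norm // ltW.
have /cvgr0Pnorm_le/(_ _ e0)[n _ nP] := cv.
by exists n => k nk; have := nP k nk; rewrite /= ger0_norm // exprn_ge0 // ltW.
Qed.

Section RadialUpperBound.
Variables (R : realType) (d D : nat) (Phi : linear_GDMS R d D).
Variables (N : set (free_group d)) (hN : normal_subgroup N).
Variables (s C l : R).
Hypothesis s0 : 0 < s.
Hypothesis C0 : 0 <= C.
Hypothesis l_itv : 0 < l < 1.

Let c := Defs.ratio Phi.
Let f a := c a `^ s.
Hypothesis decay : forall n x,
  \sum_(w <- words d n | reduced w && (proj hN (wordg w) == x)) wt f w <= C * l ^+ n.

Let c0 a : 0 < c a. Proof. by have /andP[] := ratio_itv Phi a. Qed.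
Let f0 a : 0 < f a. Proof. exact: powR_gt0. Qed.

Let V (w : seq (letter d)) : set (letter d * 'rV[R]_D) :=
  [set coding Phi omega | omega in
    [set omega | code_space omega /\ mkseq (@src d \o omega) (size w) = w]].

Let V_diam : exists2 B : R, 0 < B & forall w p q, (1 < size w)%N -> V w p -> V w q ->
  (sum_dist p q <= (B * wt c w)%:E)%E.
Proof.
have /choice[B BP] : forall a, exists B, 0 < B /\
    forall x y, Defs.space Phi a x -> Defs.space Phi a y -> edist x y <= B.
  by move=> a; have [B B0 BP] := compact_edist_bounded (@space_compact _ _ _ Phi a);
    exists B.
(* The last letter of w contributes to [wt c w] but not to the ratio of the map, hence the division
   by [c a]. *)
pose m := \sum_a B a / c a.
have Bc a : 0 < B a / c a by rewrite divr_gt0 // (proj1 (BP a)).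
have m_ge a : B a / c a <= m.
  by rewrite /m (bigD1 a) //= lerDl; apply: sumr_ge0 => b _; apply: ltW.
have m0 : 0 <= m by apply: sumr_ge0 => b _; apply: ltW.
exists (m + 1); first by rewrite ltr_wpDl.
move=> w _ _ sw [om [co wE] <-] [om' [co' wE'] <-].
case/lastP: w sw wE wE' => [//|w b]; rewrite size_rcons ltnS; case: w => [//|a w] _ wE
  wE'.
have cyl om1 : code_space om1 -> mkseq (@src d \o om1) (size w).+2 = rcons (a :: w) b ->
    (coding Phi om1).1 = a /\ (word_map Phi (rcons (a :: w) b) @` Defs.space Phi b)
      (coding Phi om1).2.
  move=> co1 E; have := codingP Phi (size w) co1; rewrite cylinderE //.
  rewrite E.
  have -> : src (om1 (size w).+1) = b.
    by have := congr1 (last b) E; rewrite last_rcons mkseqS last_rcons.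
  by split=> //; have := congr1 (head b) E.
have [h1 [x Xx h2]] := cyl _ co wE; have [h1' [x' Xx' h2']] := cyl _ co' wE'.
rewrite /sum_dist h1 h1' eqxx lee_fin -h2 -h2'.
have rw : reduced (rcons (a :: w) b).
  by rewrite -wE; apply: mkseq_reduced => i; apply: code_spaceP.
rewrite rcons_cons in rw *; rewrite (word_map_sim Phi rw) belast_rcons.
have -> : wt c (a :: rcons w b) = wt c (a :: w) * c b.
  by rewrite -cats1 -cat_cons wt_cat [wt c [:: b]]wt_cons /wt big_nil mulr1.
rewrite mulrCA ler_pM2l ?wt_gt0 //.
have [_ BPb] := BP b; apply: le_trans (BPb _ _ Xx Xx') _.
by rewrite -ler_pdivrMr //; apply: le_trans (m_ge b) _; rewrite lerDl.
Qed.

Let late n0 (w : seq (letter d)) := reduced w /\ exists g : free_group d,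
  (n0 + choice.pickle (word_of g : seq ('I_d * bool)) <= size w)%N /\ proj hN (wordg w)
    = proj hN g.

Let late_sum n0 n : \sum_(w <- words d n | `[< late n0 w >]) wt f w <= n.+1%:R * (C * l
  ^+ n).
Proof.
pose x k : quotient_group hN := if (choice.unpickle k : option (seq ('I_d * bool))) is
  Some w
  then proj hN (wordg w) else 1%g.
apply: (@le_trans _ _ (\sum_(k < n.+1) \sum_(w <- words d n | reduced w && (proj hN
  (wordg w) == x k)) wt f w)); last first.
  apply: (@le_trans _ _ (\sum_(k < n.+1) C * l ^+ n)); first exact: ler_sum.
  by rewrite sumr_const card_ord mulr_natl.
under [leRHS]eq_bigr do rewrite big_mkcond.
rewrite exchange_big /= big_mkcond big_seq [leRHS]big_seq; apply: ler_sum => w.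
rewrite mem_words => /eqP sw; case: asboolP => [[rw [g [gn gw]]]|_]; last first.
  by apply: sumr_ge0 => k _; case: ifP => // _; apply: ltW; apply: wt_gt0.
have kn : (choice.pickle (word_of g : seq ('I_d * bool)) < n.+1)%N by rewrite ltnS -sw
  (leq_trans _ gn) // leq_addl.
rewrite (bigD1 (Ordinal kn)) //= rw /x choice.pickleK wordg_word gw eqxx lerDl.
by apply: sumr_ge0 => k _; case: ifP => // _; apply: ltW; apply: wt_gt0.
Qed.

Let late_small : forall e, 0 < e -> exists n1, forall n0, (n1 <= n0)%N -> forall S,
  uniq S -> \sum_(w <- S | `[< late n0 w >]) wt f w <= e.
Proof.
move=> e e0; have [A [m [A0 m_itv AmP]]] := geom_poly_bound l_itv.
have /andP[m0 m1] := m_itv.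
have e1 : 0 < e * (1 - m) / (A * (C + 1)).
  by rewrite divr_gt0 ?mulr_gt0 ?subr_gt0 // ltr_wpDl.
have [n1 n1P] := ex_pow_small m_itv e1.
exists n1 => n0 n10 S uS.
pose L := (\max_(w <- S) size w).+1.
have SL w : w \in S -> (size w < L)%N by move=> wS; rewrite ltnS; apply: leq_bigmax_seq.
apply: (@le_trans _ _ (\sum_(n0 <= n < n0 + L) n.+1%:R * (C * l ^+ n))).
  apply: (@le_trans _ _ (\sum_(n0 <= n < n0 + L) \sum_(w <- words d n | `[< late n0 w
    >]) wt f w)); last first.
    by apply: ler_sum => n _; apply: late_sum.
  pose AW := [seq w | n <- index_iota n0 (n0 + L), w <- words d n].
  have -> : \sum_(n0 <= n < n0 + L) \sum_(w <- words d n | `[< late n0 w >]) wt f w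
      = \sum_(w <- AW) if `[< late n0 w >] then wt f w else 0.
    by rewrite big_allpairs_dep; apply: eq_bigr => n _; rewrite [LHS]big_mkcond.
  have G0 w : 0 <= (if `[< late n0 w >] then wt f w else 0).
    by case: ifP => // _; apply: ltW; apply: wt_gt0.
  rewrite -big_filter (eq_big_seq (fun w => if `[< late n0 w >] then wt f w else 0));
    last first.
    by move=> w; rewrite mem_filter => /andP[->].
  apply: sum_uniq_sub => //; first by rewrite filter_uniq.
  move=> w; rewrite mem_filter => /andP[/asboolP[_ [g [gw _]]] wS].
  apply/allpairsPdep; exists (size w), w; split=> //=; last by rewrite mem_words.
  by rewrite mem_index_iota (leq_trans _ gw) ?leq_addr //= (leq_trans (SL w wS))
    ?leq_addl.
apply: (@le_trans _ _ (\sum_(n0 <= n < n0 + L) A * C * m ^+ n)).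
  apply: ler_sum => n _; rewrite mulrCA [A * C]mulrC -mulrA.
  by apply: ler_wpM2l.
rewrite -mulr_sumr.
have geo : \sum_(n0 <= n < n0 + L) m ^+ n <= m ^+ n0 / (1 - m).
  rewrite ler_pdivlMr ?subr_gt0 //.
  have -> : (\sum_(n0 <= n < n0 + L) m ^+ n) * (1 - m) = m ^+ n0 - m ^+ (n0 + L).
    elim: (L) => [|j IH]; first by rewrite addn0 big_geq // mul0r subrr.
    by rewrite addnS big_nat_recr ?leq_addr //= mulrDl IH exprS; ring.
  by rewrite gerBl exprn_ge0 // ltW.
apply: (@le_trans _ _ (A * (C + 1) * (m ^+ n0 / (1 - m)))).
  apply: ler_pM => //; first by rewrite mulr_ge0 // ltW.
    by apply: sumr_ge0 => n _; rewrite exprn_ge0 // ltW.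
  by rewrite ler_pM2l // lerDl.
rewrite mulrA ler_pdivrMr ?subr_gt0 // -ler_pdivlMl ?mulr_gt0 ?ltr_wpDl //.
by apply: le_trans (n1P n0 n10) _; rewrite mulrC.
Qed.

Let wt_small : forall e, 0 < e -> exists n, forall w, (n <= size w)%N -> wt c w <= e.
Proof.
move=> e e0; pose m := \big[Num.max/2^-1]_a c a.
have mP a : c a <= m by rewrite /m (bigD1 a) //= le_max lexx.
have m0 : 0 < m < 1.
  rewrite /m; elim/big_ind: _ => [|x y /andP[x0 x1] /andP[y0 y1]|a _].
  - by rewrite invr_gt0 ltr0n /= invf_lt1 ?ltr1n ?ltr0n.
  - by rewrite lt_max x0 gt_max x1 y1.
  - exact: ratio_itv.
have [n nP] := ex_pow_small m0 e0.
exists n => w nw; apply: le_trans (nP _ nw).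
rewrite /wt; elim: w {nw} => [|a w IH]; first by rewrite big_nil expr0.
by rewrite big_cons exprS; apply: ler_pM => //; [exact: ltW|apply: ltW; apply: wt_gt0].
Qed.

Lemma radial_dim_le : (dimH (radial_limit_set Phi N) <= s%:E)%E.
Proof.
have [B B0 BP] := V_diam.
apply: ereal_inf_lbound; exists s => //; split; first exact: ltW.
have sd0 p q : (0 <= @sum_dist R d D p q)%E := sum_dist_ge0 p q.
have content0 delta : 0 < delta ->
    hausdorff_content (@sum_dist R d D) s delta (radial_limit_set Phi N) = 0%E.
  move=> delta0; apply/eqP; rewrite eq_le; apply/andP; split; last first.
    apply: le_ereal_inf_tmp => _ [U _ <-]; apply: nneseries_ge0 => i _ _.
    exact: weight_ge0.
  apply/lee_addgt0Pr => e e0; rewrite add0e.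
  have Bs : 0 < B `^ s by apply: powR_gt0.
  have [n1 n1P] := late_small (divr_gt0 e0 Bs).
  have [n2 n2P] := wt_small (divr_gt0 delta0 B0).
  (* Length 2 is required by [V_diam], n1 makes the total weight small, and n2 makes the diameters
     at most delta. *)
  pose n0 := maxn 2 (maxn n1 n2).
  have n02 : (1 < n0)%N by rewrite /n0; lia.
  have n0n1 : (n1 <= n0)%N by rewrite /n0; lia.
  have n0n2 : (n2 <= n0)%N by rewrite /n0; lia.
  pose pick i : option (seq ('I_d * bool)) := choice.pickle_inv i.
  (* The cover is indexed by the code numbers of words; all other indices carry the empty set, of
     weight 0. *)
  pose U i := if pick i is Some w then (if `[< late n0 w >] then V w else set0) else set0.
  have Vdiam w : late n0 w -> (diam (@sum_dist R d D) (V w) <= (B * wt c w)%:E)%E.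
    move=> [_ [g [gw _]]]; apply: ge_ereal_sup => _ [p Vp [q Vq <-]]; apply: BP Vp Vq.
    by apply: leq_trans gw; apply: leq_trans (leq_addr _ _).
  have lw w : late n0 w -> (n0 <= size w)%N.
    by move=> [_ [g [gw _]]]; apply: leq_trans gw; apply: leq_addr.
  have diam0 : (diam (@sum_dist R d D) set0 <= delta%:E)%E.
    by apply: ge_ereal_sup => _ [p []].
  have w0 : weight (@sum_dist R d D) s set0 = 0%E by rewrite /weight eqxx.
  apply: (@le_trans _ _ (\sum_(0 <= i <oo) weight (@sum_dist R d D) s (U i))%E).
    apply: ereal_inf_lbound; exists U => //; split.
      move=> _ [om [co [g ginf]] <-].
      have [n [nn0 [h Nh hE]]] : exists n, (n0 + choice.pickle (word_of g : seq ('I_d *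
        bool)) <= n)%N /\
          [set (h * g)%g | h in N] (Defs.prefix om n).
        apply: contrapT => H; apply: ginf.
        apply: (@sub_finite_set _ _ `I_(n0 + choice.pickle (word_of g : seq ('I_d *
          bool)))); last exact: finite_II.
        move=> n Hn /=; rewrite ltnNge; apply/negP => Hle; apply: H.
        by exists n.
      pose w : seq (letter d) := mkseq (@src d \o om) n.
      exists (choice.pickle (w : seq ('I_d * bool))) => //.
      rewrite /U /pick choice.pickleK_inv; case: asboolP => [_|nl].
        by exists om => //; split=> //; rewrite size_mkseq.
      case: nl; split; first by apply: mkseq_reduced => i; apply: code_spaceP.
      exists g; rewrite size_mkseq; split=> //.
      by apply/rcoset_proj; rewrite -/w -prefixE; exists h.
    move=> i; rewrite /U; case: (pick i) => [w|//]; case: asboolP => // lt.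
    apply: le_trans (Vdiam w lt) _; rewrite lee_fin mulrC -ler_pdivlMr //.
    by apply: n2P; apply: leq_trans n0n2 (lw _ lt).
  apply: lime_le.
    by apply: is_cvg_nneseries => i _ _; apply: weight_ge0.
  apply: nearW => m.
  pose S : seq (seq (letter d)) := pmap pick (iota 0 m).
  have uS : uniq S by apply: pmap_uniq (iota_uniq _ _); exact: choice.pickle_invK.
  apply: (@le_trans _ _ (B `^ s * (\sum_(w <- S | `[< late n0 w >]) wt f w))%:E); last
    first.
    by rewrite lee_fin mulrC -ler_pdivlMr // n1P.
  rewrite /S /index_iota subn0; elim: (iota 0 m) => [|i r IH]; first by rewrite
    !big_nil mulr0.
  rewrite big_cons /=; case E : (pick i) => [w|]; last first.
    by rewrite {1}/U E w0 add0e.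
  rewrite /= big_cons {1}/U E; case: asboolP => lt; last by rewrite w0 add0e.
  rewrite mulrDr EFinD; apply: leeD => //.
  rewrite /f wt_powR // -powRM ?(ltW B0) ?(ltW (wt_gt0 _ _)) //.
  rewrite /weight; case: eqP => [_|/eqP/set0P[p Vp]]; first by rewrite lee_fin powR_ge0.
  rewrite -poweR_EFin.
  have := Vdiam w lt; have := diam_ge0 sd0 Vp.
  case: (diam _ _) => [x| |] //; rewrite !lee_fin => x0 xB.
  apply: ge0_ler_powR; rewrite ?nnegrE ?(ltW s0) //.
  by apply: le_trans xB.
apply/eqP; rewrite eq_le; apply/andP; split.
  by apply: ge_ereal_sup => _ [delta delta0 <-]; rewrite content0.
by apply: ereal_sup_ubound; exists 1 => //=; rewrite content0.
Qed.

End RadialUpperBound.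

(** * The critical exponent *)

Lemma normal_subgroupT (G : groupType) : normal_subgroup [set: G].
Proof. by split. Qed.

Lemma ex_powR_eq (R : realType) (k z : R) : 0 < k < 1 -> 0 < z < 1 ->
  exists2 e : R, 0 < e & k `^ e = z.
Proof.
move=> /andP[k0 k1] /andP[z0 z1].
have lk : ln k < 0 by rewrite ln_lt0 // k0.
have lz : ln z < 0 by rewrite ln_lt0 // z0.
exists (ln z / ln k); first by rewrite nmulr_rgt0 // invr_lt0.
by rewrite /powR gt_eqF // divfK ?lt_eqF // lnK.
Qed.

Lemma powR_lt1 (R : realType) (x s : R) : 0 < x < 1 -> 0 < s -> 0 < x `^ s < 1.
Proof.
move=> /andP[x0 x1] s0; rewrite powR_gt0 //= -[ltRHS](_ : 1 `^ s = 1); last by rewrite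
  powR1.
by apply: gt0_ltr_powR => //; rewrite nnegrE // ltW.
Qed.

Lemma lee_of_lt (R : realType) (x : \bar R) (b : R) : 0 < b ->
  (forall s, 0 < s < b -> (s%:E <= x)%E) -> (b%:E <= x)%E.
Proof.
move=> b0 H; apply/lee_subgt0Pr => e e0.
apply: (@le_trans _ _ (Num.max (b / 2) (b - e))%:E).
  by rewrite -EFinB lee_fin le_max lexx orbT.
by apply: H; rewrite lt_max gt_max divr_gt0 //=; apply/andP; split; lra.
Qed.

Lemma gee_of_gt (R : realType) (x : \bar R) (b : R) :
  (forall s, b < s -> (x <= s%:E)%E) -> (x <= b%:E)%E.
Proof.
move=> H; apply/lee_addgt0Pr => e e0; rewrite -EFinD; apply: H.
by rewrite ltrDl.
Qed.

Section CriticalExponent.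
Variables (R : realType) (d D : nat) (Phi : linear_GDMS R d D).
Hypothesis hd : (2 <= d)%N.
Hypothesis hPhi : symmetric_GDMS Phi.

Let c := Defs.ratio Phi.
Let f s a := c a `^ s.
Let pressure s := \sum_a f s a / (1 + f s a).

Let c_itv a : 0 < c a < 1. Proof. exact: ratio_itv. Qed.
Let c0 a : 0 < c a. Proof. by have /andP[] := c_itv a. Qed.
Let c1 a : c a < 1. Proof. by have /andP[] := c_itv a. Qed.
Let f0 s a : 0 < f s a. Proof. exact: powR_gt0. Qed.
Let f_itv s a : 0 < s -> 0 < f s a < 1. Proof. by move=> s0; apply: powR_lt1. Qed.
Let f_inv s a : f s (invl a) = f s a.
Proof. by rewrite /f /c -hPhi. Qed.

Let y0 : letter d := (Ordinal (ltnW hd), false).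

Let cmax_ex : exists2 m : R, 0 < m < 1 & forall a, c a <= m.
Proof.
pose m := \big[Num.max/0]_a c a.
have mP a : c a <= m by rewrite /m (bigD1 a) //= le_max lexx.
exists m => //; rewrite (lt_le_trans (c0 y0)) //= /m.
by elim/big_ind: _ => // *; rewrite gt_max; apply/andP.
Qed.

Let cmin_ex : exists2 m : R, 0 < m < 1 & forall a, m <= c a.
Proof.
pose m := \big[Num.min/1]_a c a.
have mP a : m <= c a by rewrite /m (bigD1 a) //= ge_min lexx.
exists m => //; rewrite (le_lt_trans (mP y0)) // andbT /m.
by elim/big_ind: _ => // *; rewrite lt_min; apply/andP.
Qed.

Let pressure_mono s s' : s < s' -> pressure s' < pressure s.
Proof.
move=> ss'; have lt a : f s' a / (1 + f s' a) < f s a / (1 + f s a).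
  have := f0 s a; have := f0 s' a.
  have : f s' a < f s a.
    rewrite /f -[s'](subrK s) powRD; last by rewrite (gt_eqF (c0 a)) implybT.
    have s's : 0 < s' - s by rewrite subr_gt0.
    by rewrite gtr_pMl ?powR_gt0 //; case/andP: (powR_lt1 (c_itv a) s's).
  move: (f s a) (f s' a) => p q qp q0 p0.
  by rewrite ltr_pdivrMr ?addr_gt0 // mulrAC ltr_pdivlMr ?addr_gt0 //; nra.
rewrite /pressure (bigD1 y0) // [ltRHS](bigD1 y0) //=.
by apply: ltr_leD => //; apply: ler_sum => a _; apply: ltW.
Qed.

(** At exponent 0 each of the 2 d terms is 1/2, so the value is d > 1; it has dropped to at most 1
    when [m ^+ n] is at most 1 / (2 d). The intermediate value theorem does the rest. *)
Lemma critical_ex : exists2 b : R, 0 < b & pressure b = 1.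
Proof.
have [m m_itv mP] := cmax_ex; have /andP[m0 m1] := m_itv.
have d0 : 0 < (2 * d)%:R^-1 :> R by rewrite invr_gt0 ltr0n; lia.
have [n /(_ n (leqnn _)) nP] := ex_pow_small m_itv d0.
have P0 : 1 < pressure 0.
  rewrite /pressure (eq_bigr (fun=> 2^-1)); last by move=> a _; rewrite /f powRr0 mul1r.
  rewrite sumr_const card_prod card_ord card_bool -[_ *+ _]mulr_natr natrM mulrCA mulVf
    ?pnatr_eq0 // mulr1.
  by rewrite ltr1n.
have Pn : pressure n%:R <= 1.
  apply: (@le_trans _ _ (\sum_(a : letter d) m ^+ n)).
    apply: ler_sum => a _; rewrite ler_pdivrMr ?addr_gt0 //.
    apply: (@le_trans _ _ (m ^+ n)); last by rewrite ler_peMr ?exprn_ge0 ?(ltW m0) //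
      lerDl ltW.
    rewrite /f powR_mulrn; last exact: ltW.
    by apply: lerXn2r; rewrite ?nnegrE ?(ltW (c0 a)) ?(ltW m0).
  rewrite sumr_const card_prod card_ord card_bool -[_ *+ _]mulr_natr mulnC.
  by rewrite -ler_pdivlMr ?div1r // ltr0n; lia.
have cont : continuous pressure.
  move=> s; apply: cvg_big => [|a _]; first exact: add_continuous.
  have cf : f ^~ a @ s --> f s a.
    rewrite /f /powR (gt_eqF (c0 a)).
    apply: continuous_comp; last exact: continuous_expR.
    by apply: cvgMr_tmp; apply: cvg_id.
  apply: cvgM => //; apply: cvgV; first by rewrite gt_eqF ?addr_gt0.
  by apply: cvgD => //; apply: cvg_cst.
have [] := @IVT R pressure 0 n%:R 1 (ler0n _ _) (continuous_subspaceT cont).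
  by rewrite ge_min Pn orbT le_max ltW.
move=> b; rewrite in_itv /= => /andP[b0 _] bE; exists b => //.
by rewrite lt_neqAle b0 andbT; apply/eqP => b00; move: P0; rewrite b00 bE ltxx.
Qed.

(** A change of exponent costs a factor exponential in the length; this exchanges exponential growth
    rates of sums for differences of exponents. *)
Let wt_shift_le s e m w : 0 <= e -> (forall a, c a <= m) ->
  wt (f (s + e)) w <= wt (f s) w * (m `^ e) ^+ size w.
Proof.
move=> e0 cm; elim: w => [|a w IH]; first by rewrite /wt !big_nil mulr1.
rewrite !wt_cons /= exprS mulrACA; apply: ler_pM => //.
- exact: ltW.
- by apply: ltW; apply: wt_gt0.
- rewrite /f powRD; last by rewrite (gt_eqF (c0 a)) implybT.
  rewrite ler_pM2l ?powR_gt0 //; apply: ge0_ler_powR; rewrite ?nnegrE ?(ltW (c0 a)) //.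
  by apply: le_trans (cm a); apply: ltW.
Qed.

Let wt_shift_ge s e k w : 0 <= e -> 0 < k -> (forall a, k <= c a) ->
  wt (f s) w * (k `^ e) ^+ size w <= wt (f (s + e)) w.
Proof.
move=> e0 k0 kc; elim: w => [|a w IH]; first by rewrite /wt !big_nil mulr1.
rewrite !wt_cons /= exprS mulrACA; apply: ler_pM => //.
- by apply: mulr_ge0; [exact: ltW|exact: powR_ge0].
- by apply: mulr_ge0; [apply: ltW; apply: wt_gt0|rewrite exprn_ge0 // powR_ge0].
- rewrite /f powRD; last by rewrite (gt_eqF (c0 a)) implybT.
  by rewrite ler_pM2l ?powR_gt0 //; apply: ge0_ler_powR; rewrite ?nnegrE ?(ltW (c0 a))
    ?(ltW k0).
Qed.

Section AtCritical.
Variable b : R.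
Hypothesis b0 : 0 < b.
Hypothesis b_crit : pressure b = 1.

Let t a := f b a / (1 + f b a).

Let sum_t_neq a : \sum_(a' | a' != invl a) t a' = (1 + f b a)^-1.
Proof.
have := b_crit; rewrite /pressure (bigD1 (invl a)) //= f_inv => /(canRL (addKr _)) ->.
by field; rewrite gt_eqF // addr_gt0.
Qed.

(** [2 * t a] dominates [f b a], which is less than 1, and t is fixed by the transfer operator, so
    the bound passes to all lengths. *)
Let words_critical n a :
  \sum_(w <- words d n | reduced (a :: w)) wt (f b) (a :: w) <= 2 * t a.
Proof.
elim: n a => [|n IH] a.
  have f1 : 0 < 1 + f b a by rewrite addr_gt0.
  rewrite big_mkcond big_seq1 /= wt_cons /wt big_nil mulr1 /t mulrA ler_pdivlMr //.
  have := f0 b a; have /andP[_] := f_itv a b0; nra.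
have -> : \sum_(w <- words d n.+1 | reduced (a :: w)) wt (f b) (a :: w) =
    f b a * \sum_(a' | a' != invl a) \sum_(w <- words d n | reduced (a' :: w)) wt (f b)
      (a' :: w).
  rewrite big_words_cons [in RHS]big_mkcond mulr_sumr; apply: eq_bigr => a' _.
  under eq_bigl do rewrite reduced_cons invl_neq.
  case: ifP => aa'; last by rewrite mulr0 big1.
  by rewrite mulr_sumr; apply: eq_bigr => w _; rewrite wt_cons.
have tE : t a = f b a * \sum_(a' | a' != invl a) t a' by rewrite sum_t_neq.
rewrite tE mulrCA ler_pM2l // mulr_sumr; apply: ler_sum => a' _; exact: IH.
Qed.

Let words_le n : \sum_(w <- words d n | reduced w) wt (f b) w <= 2.
Proof.
case: n => [|n]; first by rewrite /= big_cons big_nil /wt big_nil addr0; case: (reduced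
  _); lra.
rewrite big_words_cons; apply: (@le_trans _ _ (\sum_a 2 * t a)).
  by apply: ler_sum => a _; apply: words_critical.
by rewrite -mulr_sumr -[\sum_a _]/(pressure b) b_crit mulr1.
Qed.

Lemma dim_le_critical N (hN : normal_subgroup N) :
  (dimH (radial_limit_set Phi N) <= b%:E)%E.
Proof.
apply: gee_of_gt => s bs; have [m m_itv mP] := cmax_ex.
have e0 : 0 < s - b by rewrite subr_gt0.
apply: (@radial_dim_le _ _ _ Phi N hN s 2 (m `^ (s - b))) => //.
- exact: lt_trans bs.
- exact: powR_lt1.
move=> n x.
apply: (@le_trans _ _ (\sum_(w <- words d n | reduced w) wt (f b) w * (m `^ (s - b)) ^+
  n)).
  rewrite big_mkcond [leRHS]big_mkcond big_seq [leRHS]big_seq; apply: ler_sum => w.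
  rewrite mem_words => /eqP sw; case: (reduced w) => //=; case: ifP => _.
    have := wt_shift_le b w (ltW e0) mP; rewrite addrC subrK sw; exact.
  by apply: mulr_ge0; [apply: ltW; apply: wt_gt0|rewrite exprn_ge0 // powR_ge0].
by rewrite -mulr_suml ler_wpM2r ?exprn_ge0 ?powR_ge0.
Qed.

(** Amenability yields only a divergent series, at an exponent s1 between s and b. If the sums at s
    were bounded, those at s1 would decay geometrically. *)
Lemma dim_ge_critical N (hN : normal_subgroup N) :
  amenable R (quotient_group hN) -> (b%:E <= dimH (radial_limit_set Phi N))%E.
Proof.
move=> amN; apply: lee_of_lt b0 _ => s /andP[s0 sb].
pose s1 := (s + b) / 2; have ss1 : s < s1 by rewrite /s1; lra.
have s10 : 0 < s1 := lt_trans s0 ss1.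
have press1 : 1 < \sum_a f s1 a / (1 + f s1 a).
  by rewrite -[ltLHS]b_crit; apply: pressure_mono; rewrite /s1; lra.
have unb := sphere_sum_unbounded (fun a => f_itv a s10) (f_inv s1)
  (qgen_inv hN) (qgen_ind (hN := hN)) press1 amN.
pose A s' n := \sum_(w <- words d n | reduced w && `[< N (wordg w) >]) wt (f s') w.
have AE n : \sum_a sphere (f s1) (qgen hN) n 1%g a = A s1 n.+1.
  rewrite sum_sphere_words /A; apply: eq_bigl => w; congr (_ && _).
  by apply/eqP/asboolP => H; [apply/(proj_eq1 hN)|apply/proj_eq1].
have A0 s' n : 0 <= A s' n by apply: sumr_ge0 => w _; apply: ltW; apply: wt_gt0.
have [m m_itv mP] := cmax_ex.
have e0 : 0 < s1 - s by rewrite subr_gt0.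
have /andP[z0 z1] := powR_lt1 m_itv e0; set z := m `^ (s1 - s) in z0 z1.
have AA n : A s1 n <= A s n * z ^+ n.
  rewrite /A big_mkcond [in leRHS]big_mkcond mulr_suml big_seq [leRHS]big_seq.
  apply: ler_sum => w; rewrite mem_words => /eqP sw; case: ifP => _; last by rewrite
    mul0r.
  by have := wt_shift_le s w (ltW e0) mP; rewrite addrC subrK sw.
(* Divergence itself supplies a nontrivial element of N, since otherwise all these sums would
   vanish. *)
have [t0 [t00 rt Nt]] : exists t0, [/\ t0 != [::], reduced t0 & N (wordg t0)].
  have [L HL] := unb 0; apply: contrapT => H; move: HL; rewrite big1 ?ltxx // => n _.
  rewrite AE /A big_seq_cond big1 // => w; rewrite mem_words.
  move=> /andP[/eqP sw /andP[rw /asboolP Nw]]; case: H; exists w; split=> //.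
  by rewrite -size_eq0 sw.
have unbA M : exists n, M < A s n.
  apply: contrapT => H; have AM n : A s n <= M.
    by rewrite leNgt; apply/negP => Hn; apply: H; exists n.
  have M0 : 0 <= M by apply: le_trans (AM 0%N).
  have [L] := unb (M / (1 - z)); apply/negP; rewrite -leNgt.
  apply: (@le_trans _ _ (\sum_(n < L) M * z ^+ n)).
    apply: ler_sum => n _; rewrite AE; apply: le_trans (AA _) _.
    rewrite exprS mulrA; apply: ler_wpM2r; first by rewrite exprn_ge0 // ltW.
    by apply: le_trans (AM n.+1); rewrite ler_piMr // ltW.
  rewrite -mulr_sumr; apply: ler_wpM2l => //; rewrite -[leRHS]mul1r ler_pdivlMr
    ?subr_gt0 //.
  have -> : (\sum_(n < L) z ^+ n) * (1 - z) = 1 - z ^+ L.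
    by rewrite mulrC -[in RHS](expr1n _ L) subrXX; congr (_ * _); apply: eq_bigr => n
      _; rewrite expr1n mul1r.
  by rewrite gerBl exprn_ge0 // ltW.
have [y [W [Wc W1]]] := prefix_code_of_unbounded hd hN (fun a => f_itv a s0) t00 rt Nt
  unbA.
apply: (code_dim_ge hN Wc); apply: ltW; apply: lt_le_trans W1 _.
by rewrite le_eqVlt; apply/orP; left; apply/eqP; apply: eq_bigr => w _; apply: wt_powR.
Qed.

Lemma dim_lt_critical N (hN : normal_subgroup N) :
  ~ amenable R (quotient_group hN) ->
  exists2 s, s < b & (dimH (radial_limit_set Phi N) <= s%:E)%E.
Proof.
move=> namN.
have [C [l [C0 l_itv HC]]] := sphere_decay hd (fun a => f_itv a b0) (f_inv b) b_crit
  (qgen_inv hN) (qgen_ind (hN := hN)) namN.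
have /andP[l0 l1] := l_itv.
pose r := Num.sqrt l; have r2 : r * r = l by rewrite -expr2 sqr_sqrtr // ltW.
have r0 : 0 < r by rewrite sqrtr_gt0.
have r1 : r < 1 by rewrite -sqrtr1 ltr_sqrt.
have [k k_itv kP] := cmin_ex; have /andP[k0 k1] := k_itv.
have [e e0 eE] : exists2 e : R, 0 < e < b & r <= k `^ e.
  have [e e0 eE] := ex_powR_eq k_itv (introT andP (conj r0 r1)).
  exists (Num.min e (b / 2)); last first.
    by rewrite -eE; apply: ger_powR; rewrite ?k0 ?(ltW k1) // ge_min lexx.
  have b2 : 0 < b / 2 < b by rewrite divr_gt0 //= ltr_pdivrMr // ltr_pMr // ltr1n.
  by case/andP: b2 => b20 b2b; rewrite lt_min e0 b20 gt_min b2b orbT.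
have /andP[e_gt0 eb] := e0.
exists (b - e); first by rewrite ltrBlDr ltrDl.
have sp : 0 < b - e by rewrite subr_gt0.
(* The 1 is for the empty word, 2 d counts the first letters, and 1 / l corrects the shift between
   the index of [sphere] and the length. *)
pose C' := 1 + (2 * d)%:R * C / l.
have C'0 : 0 <= (2 * d)%:R * C / l by rewrite divr_ge0 ?(ltW l0) // mulr_ge0 ?ler0n.
apply: (@radial_dim_le _ _ _ Phi N hN (b - e) C' r) => //.
- by rewrite addr_ge0.
- by rewrite r0.
move=> n x.
have rn n' : 0 < r ^+ n' by apply: exprn_gt0.
case: n => [|n].
  rewrite expr0 mulr1 /C' big_mkcond big_seq1 /wt big_nil.
  by case: ifP => _; rewrite ?lerDl // addr_ge0.
apply: (@le_trans _ _ ((\sum_(w <- words d n.+1 | reduced w && (proj hN (wordg w) ==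
  x)) wt (f b) w) / r ^+ n.+1)).
  rewrite big_mkcond [in leRHS]big_mkcond mulr_suml big_seq [leRHS]big_seq.
  apply: ler_sum => w; rewrite mem_words => /eqP sw; case: ifP => _; last by rewrite
    mul0r.
  rewrite ler_pdivlMr //.
  have := wt_shift_ge (b - e) w (ltW e_gt0) k0 kP; rewrite subrK sw; apply: le_trans.
  rewrite ler_pM2l ?wt_gt0 //; last by move=> a; apply: f0.
  by apply: lerXn2r; rewrite ?nnegrE ?powR_ge0 ?(ltW r0).
rewrite -sum_sphere_words ler_pdivrMr //.
apply: (@le_trans _ _ (\sum_(a : letter d) C * l ^+ n)); first by apply: ler_sum => a
  _; apply: HC.
rewrite sumr_const card_prod card_ord card_bool -[_ *+ _]mulr_natl mulnC.
have -> : C' * r ^+ n.+1 * r ^+ n.+1 = l ^+ n.+1 + (2 * d)%:R * (C * l ^+ n).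
  by rewrite -mulrA -exprMn r2 /C' exprS; field; rewrite gt_eqF.
by rewrite lerDr exprn_ge0 // ltW.
Qed.

Lemma dim_gt_half_critical N : normal_subgroup N -> N <> [set 1%g] ->
  exists2 s, b / 2 < s & (s%:E <= dimH (radial_limit_set Phi N))%E.
Proof.
move=> hN N1; have b2 : 0 < b / 2 by rewrite divr_gt0.
have [t0 [t00 rt Nt]] : exists t0, [/\ t0 != [::], reduced t0 & N (wordg t0)].
  have [g [Ng g1]] : exists g, N g /\ g <> 1%g.
    apply: contrapT => H; apply: N1; apply/seteqP; split=> [g Ng /=|_ ->]; last exact:
      normal1 hN.
    by apply: contrapT => g1; apply: H; exists g.
  exists (word_of g); split; [|exact: word_ofP|by rewrite wordg_word].
  by apply/eqP => g0; apply: g1; apply: val_inj.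
have f2 a : f (b / 2) a ^+ 2 = f b a.
  by rewrite expr2 /f -powRD ?(gt_eqF (c0 a)) ?implybT // -splitr.
have crit2 : \sum_a f (b / 2) a ^+ 2 / (1 + f (b / 2) a ^+ 2) = 1.
  by rewrite -[RHS]b_crit; apply: eq_bigr => a _; rewrite f2.
have [y [W [Wc W1]]] := prefix_code_of_critical hd hN (fun a => f_itv a b2) (f_inv _)
  crit2 t00 rt Nt.
set S := \sum_(w <- W) _ in W1.
have S0 : 0 < S by apply: lt_trans W1.
have [k k_itv kP] := cmin_ex; have /andP[k0 k1] := k_itv.
pose L := (\max_(w <- W) size w).+1.
have kL : 0 < k ^+ L < 1 by rewrite exprn_gt0 // exprn_ilt1 // ltW.
have S1 : 0 < S^-1 < 1 by rewrite invr_gt0 S0 invf_lt1.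
have [e e0 eE] := ex_powR_eq kL S1.
exists (b / 2 + e); first by rewrite ltrDl.
apply: (code_dim_ge hN Wc).
apply: (@le_trans _ _ (\sum_(w <- W) wt (f (b / 2)) w * (k ^+ L) `^ e)).
  by rewrite -mulr_suml -/S eE divff // gt_eqF.
rewrite big_seq [leRHS]big_seq; apply: ler_sum => w wW.
rewrite -wt_powR //; apply: le_trans (wt_shift_ge (b / 2) w (ltW e0) k0 kP).
rewrite ler_pM2l ?wt_gt0 //.
have -> : (k `^ e) ^+ size w = (k ^+ size w) `^ e.
  by rewrite -powR_mulrn ?powR_ge0 // -powRrM mulrC powRrM powR_mulrn // ltW.
apply: ge0_ler_powR; rewrite ?nnegrE ?exprn_ge0 ?(ltW k0) ?(ltW e0) //.
apply: ler_wiXn2l; rewrite ?(ltW k0) ?(ltW k1) // /L ltnW // ltnS.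
exact: leq_bigmax_seq.
Qed.

Lemma dim_full : dimH (radial_limit_set Phi setT) = b%:E.
Proof.
have hT := normal_subgroupT (free_group d).
apply/eqP; rewrite eq_le dim_le_critical //= (dim_ge_critical (hN := hT)) //.
have T1 (x z : quotient_group hT) : x = z.
  by rewrite -(proj_repr x) -(proj_repr z); apply/projP.
(* The quotient is trivial, so the Dirac mean at 1 is invariant. *)
exists (fun A => `[< A 1%g >]%:R); split=> [A||A B AB|g A].
- exact: ler0n.
- by rewrite asboolT.
- rewrite -natrD; congr (_%:R); case: (asboolP (A 1%g)) => A1; case: (asboolP (B 1%g))
  => B1.
  + by have : (A `&` B) 1%g by []; rewrite AB.
  + by rewrite asboolT //; left.
  + by rewrite asboolT //; right.
  + by rewrite asboolF // => -[].
- congr (_%:R); congr (nat_of_bool _); apply: asbool_equiv_eq.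
  by split=> [[x Ax _]|A1]; [rewrite (T1 1%g x)|exists 1%g].
Qed.

End AtCritical.
End CriticalExponent.

Theorem corollary1p4 (R : realType) (d D : nat) (hd : (2 <= d)%N)
    (hD : (1 <= D)%N) (Phi : linear_GDMS R d D) (hPhi : symmetric_GDMS Phi)
    (N : set (free_group d)) (hN : normal_subgroup N) :
  (dimH (radial_limit_set Phi N) = dimH (radial_limit_set Phi setT) <->
     amenable R (quotient_group hN)) /\
  (N <> [set 1%g] ->
     (dimH (radial_limit_set Phi setT) / 2%:E
        < dimH (radial_limit_set Phi N))%E).
Proof.
have [b b0 b_crit] := critical_ex Phi hd.
rewrite (dim_full hd hPhi b0 b_crit); split; [split|].
- move=> Nb; apply: contrapT => /(dim_lt_critical hd hPhi b0 b_crit)[s sb].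
  by rewrite Nb lee_fin leNgt sb.
- move=> amN; apply/eqP; rewrite eq_le (dim_le_critical hd hPhi b0 b_crit hN) /=.
  exact: (dim_ge_critical hd hPhi b0 b_crit amN).
- move=> N1; have [s bs sN] := dim_gt_half_critical hd hPhi b0 b_crit hN N1.
  apply: lt_le_trans sN.
  by rewrite inver /= pnatr_eq0 /= -EFinM lte_fin.
Qed.
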